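(* For every $\kappa>0$, $\mathcal W_\kappa$ is a distance on $\mathcal P^{\oplus}(\bar\Omega)$.
   Context: Setting: $\Omega\subset\mathbb R^d$ is a smooth bounded domain; $\Gamma:=\partial\Omega$ is viewed as a smooth $(d-1)$-dimensional manifold without boundary, and $\nabla$ applied to functions on $\Gamma$ is the intrinsic (tangential) gradient. $Q_{\bar\Omega}:=[0,1]\times\bar\Omega$, $Q_\Gamma:=[0,1]\times\Gamma$. $\mathcal M(X)$, $\mathcal M^+(X)$, $\mathcal P(X)$ are the finite signed Borel measures, nonnegative measures, probability measures on $X$; $\mathcal M(Q_{\bar\Omega})^d$ and $\mathcal M(Q_\Gamma)^{d-1}$ denote vector measures (tangential to $\Gamma$ in the second case). Measures on $\Gamma$ are also regarded as measures on $\bar\Omega$ supported on $\partial\Omega$. $\mathcal P^{\oplus}(\bar\Omega):=\{(\omega,\gamma)\in\mathcal M^+(\bar\Omega)\times\mathcal M^+(\Gamma):\ \omega+\gamma\in\mathcal P(\bar\Omega)\}$. Continuity equations: for $\rho_i=(\omega_i,\gamma_i)\in\mathcal P^\oplus(\bar\Omega)$, $\mathcal{CE}(\rho_0,\rho_1)$ is the set of $\mu=(\omega,F;\gamma,G,f)\in\mathcal M(Q_{\bar\Omega})\times\mathcal M(Q_{\bar\Omega})^d\times\mathcal M(Q_\Gamma)\times\mathcal M(Q_\Gamma)^{d-1}\times\mathcal M(Q_\Gamma)$ such that, for all $\varphi\in\mathcal C^1(Q_{\bar\Omega})$ and $\psi\in\mathcal C^1(Q_\Gamma)$, $$\iint_{Q_{\bar\Omega}}\partial_t\varphi\,d\omega+\iint_{Q_{\bar\Omega}}\nabla\varphi\cdot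 dF-\iint_{Q_\Gamma}\varphi\,df=\int_{\bar\Omega}\varphi(1,\cdot)\,d\omega_1-\int_{\bar\Omega}\varphi(0,\cdot)\,d\omega_0,$$ $$\iint_{Q_\Gamma}\partial_t\psi\,d\gamma+\iint_{Q_\Gamma}\nabla\psi\cdot dG+\iint_{Q_\Gamma}\psi\,df=\int_\Gamma\psi(1,\cdot)\,d\gamma_1-\int_\Gamma\psi(0,\cdot)\,d\gamma_0.$$ Action: $A_\Omega(\omega,F)=\frac{|F|^2}{2\omega}$ if $\omega>0$, $0$ if $(\omega,F)=(0,0)$, $+\infty$ otherwise, on $\mathbb R\times\mathbb R^d$; $A^\kappa_\Gamma(\gamma,G,f)=\frac{|G|^2+\kappa^2f^2}{2\gamma}$ if $\gamma>0$, $0$ if $(\gamma,G,f)=(0,0,0)$, $+\infty$ otherwise, on $\mathbb R\times\mathbb R^{d-1}\times\mathbb R$. For $\mu=(\mu_\Omega,\mu_\Gamma)$ with $\mu_\Omega=(\omega,F)$, $\mu_\Gamma=(\gamma,G,f)$, $$\mathcal A(\mu):=\iint_{Q_{\bar\Omega}}A_\Omega\Big(\tfrac{d\mu_\Omega}{d\lambda_\Omega}\Big)d\lambda_\Omega+\iint_{Q_\Gamma}A^\kappa_\Gamma\Big(\tfrac{d\mu_\Gamma}{d\lambda_\Gamma}\Big)d\lambda_\Gamma$$ for any nonnegative measures $\lambda_\Omega,\lambda_\Gamma$ with $|\mu_\Omega|\ll\lambda_\Omega$, $|\mu_\Gamma|\ll\lambda_\Gamma$ (independent of the choice by $1$-homogeneity).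 Finally $\mathcal W_\kappa^2(\rho_0,\rho_1):=\inf_{\mu\in\mathcal{CE}(\rho_0,\rho_1)}\mathcal A(\mu)$ and $\mathcal W_\kappa\ge0$ is its square root. *)

(* Defs.v *)
From Stdlib Require List.
From HB Require Import structures.
From mathcomp Require Import all_boot all_order all_algebra.
From mathcomp Require Import all_classical all_reals all_analysis.

Set Implicit Arguments.
Unset Strict Implicit.
Unset Printing Implicit Defensive.

Import Order.TTheory GRing.Theory Num.Theory.
Import numFieldNormedType.Exports.

Local Open Scope classical_set_scope.
Local Open Scope ring_scope.
Local Open Scope charge_scope.

Section calculus.
Context {R : realType}.

Definition dot n (u v : 'rV[R]_n) : R := \sum_(i < n) u 0 i * v 0 i.

(* Continuity of all iterated directional derivatives up to order k; in finite
   dimension this is the usual class C^k on an open set U. *)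
Fixpoint Ck_on (V : normedModType R) (k : nat) (U : set V) (f : V -> R) : Prop :=
  (forall x, U x -> {for x, continuous f}) /\
  if k is k'.+1 then
    (forall x v, U x -> derivable f x v) /\
    (forall v, Ck_on k' U (fun x => 'D_v f x))
  else True.

Definition smooth_on (V : normedModType R) (U : set V) (f : V -> R) : Prop :=
  forall k, Ck_on k U f.

Definition C1 (V : normedModType R) (f : V -> R) : Prop := Ck_on 1 setT f.

Definition grad n (f : 'rV[R]_n -> R) (x : 'rV[R]_n) : 'rV[R]_n :=
  \row_i 'D_(delta_mx 0 i) f x.

Definition partial_t n (phi : R * 'rV[R]_n -> R) (p : R * 'rV[R]_n) : R :=
  'D_((1, 0) : R * 'rV[R]_n) phi p.

End calculus.

Section domains.
Context {R : realType} (d : nat).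
Implicit Types (Omega U : set 'rV[R]_d) (x v : 'rV[R]_d).

Definition bdry Omega : set 'rV[R]_d := closure Omega `\` Omega°.

(* For x on the boundary, continuity forces g x = 0; after shrinking U the
   boundary is {g = 0}, a smooth hypersurface with Omega on one side of it. *)
Definition local_defining_function Omega x U (g : 'rV[R]_d -> R) : Prop :=
  [/\ open U, U x, smooth_on U g,
      (forall y, U y -> (Omega y <-> g y < 0)) &
      exists v, 'D_v g x != 0].

Definition smooth_bounded_domain Omega : Prop :=
  [/\ Omega !=set0, open Omega, connected Omega, bounded_set Omega &
      forall x, bdry Omega x -> exists U g, local_defining_function Omega x U g].

(* The kernel of the differential of a defining function does not depend on
   that function. *)
Definition tangent Omega x : set 'rV[R]_d :=
  [set v | exists U g, local_defining_function Omega x U g /\ 'D_v g x = 0].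

(* Riemannian gradient on the boundary: the tangent vector representing the
   differential of f restricted to the tangent space.  At boundary points and
   for differentiable f it exists, is unique, and depends only on the values of
   f on the boundary. *)
Definition tgrad Omega (f : 'rV[R]_d -> R) x : 'rV[R]_d :=
  get [set v | tangent Omega x v /\
               forall w, tangent Omega x w -> dot v w = 'D_w f x].

Definition Qbulk Omega : set (R * 'rV[R]_d) := `[0, 1] `*` closure Omega.
Definition Qbdry Omega : set (R * 'rV[R]_d) := `[0, 1] `*` bdry Omega.

End domains.


(* Borel sigma-algebras of R^d and of R x R^d.  Measures on a closed subset K are
   represented by measures on the ambient space that are concentrated on K. *)
Notation space R d := (g_sigma_algebraType (@open 'rV[R]_d)).
Notation spacetime R d := (g_sigma_algebraType (@open (R * 'rV[R]_d)%type)).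

Section signed_measures.
Context {disp : measure_display} {T : measurableType disp} {R : realType}.
Implicit Types (nu : {charge set T -> \bar R}) (s : seq ({charge set T -> \bar R})).

(* A charge does not come with its Hahn decomposition; the choice made here
   affects neither the Jordan parts nor the variation on measurable sets. *)
Definition hahn_spec nu :
    {PN : set T * set T | hahn_decomposition nu PN.1 PN.2} :=
  let P := cid (Hahn_decomposition nu) in
  let N := cid (projT2 P) in
  exist _ (projT1 P, projT1 N) (projT2 N).

Definition cintegral nu (D : set T) (f : T -> R) : R :=
  \int[jordan_pos (proj2_sig (hahn_spec nu))]_(x in D) f x -
  \int[jordan_neg (proj2_sig (hahn_spec nu))]_(x in D) f x.

Definition vintegral n (nu : 'I_n -> {charge set T -> \bar R}) (D : set T)
    (X : T -> 'rV[R]_n) : R :=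
  \sum_(i < n) cintegral (nu i) D (fun x => X x 0 i).

(* Sum of the total variations of the components of a vector measure: a finite
   measure equivalent to the total variation of the vector measure. *)
Definition variations s (A : set T) : \bar R :=
  (\sum_(nu <- s) charge_variation (proj2_sig (hahn_spec nu)) A)%E.

Let variations0 s : variations s set0 = 0%E.
Proof. by rewrite /variations big1// => nu _; rewrite measure0. Qed.

Let variations_ge0 s A : (0 <= variations s A)%E.
Proof. by rewrite /variations sume_ge0. Qed.

Let variations_sigma_additive s : semi_sigma_additive (variations s).
Proof.
move=> F mF tF mUF; rewrite /variations.
elim: s => [|nu s ih].
  rewrite big_nil (_ : (fun _ => _) = cst 0%E); first exact: cvg_cst.
  by apply/funext => n; rewrite big1// => i _; rewrite big_nil.
rewrite (_ : (fun _ => _) = (fun n =>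
    \sum_(0 <= i < n) charge_variation (proj2_sig (hahn_spec nu)) (F i)
    + \sum_(0 <= i < n) \sum_(mu <- s)
        charge_variation (proj2_sig (hahn_spec mu)) (F i))%E); last first.
  by apply/funext => n; rewrite -big_split; apply: eq_bigr => i _; rewrite big_cons.
rewrite big_cons; apply: cvgeD => //=.
- by rewrite ge0_adde_def// inE; [exact: measure_ge0|exact: sume_ge0].
- exact: measure_semi_sigma_additive.
Qed.

HB.instance Definition _ s := isMeasure.Build _ _ _ (variations s)
  (variations0 s) (variations_ge0 s) (@variations_sigma_additive s).

Let variations_fin s : fin_num_fun (variations s).
Proof.
move=> A mA; rewrite /variations; elim: s => [|nu s ih]; first by rewrite big_nil.
by rewrite big_cons fin_numD ih fin_num_measure.
Qed.

HB.instance Definition _ s := @Measure_isFinite.Build _ _ _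
  (variations s) (@variations_fin s).

Lemma variations_dominates s nu : List.In nu s -> nu `<< variations s.
Proof.
move=> nus; apply/null_content_dominatesP => A mA sA0.
suff: (`|nu A| <= 0)%E.
  by move=> nuA0; apply/eqP; rewrite -abse_eq0 eq_le nuA0 abse_ge0.
rewrite -sA0; apply: (le_trans (abse_charge_variation (proj2_sig (hahn_spec nu)) mA)).
rewrite /= /variations; move: nus {sA0}; elim: s => [|mu s ih] //= [->|/ih {}ih].
  by rewrite big_cons leeDl// sume_ge0.
by rewrite big_cons (le_trans ih)// leeDr.
Qed.

Definition density nu (la : {sigma_finite_measure set T -> \bar R}) (x : T) : R :=
  fine (('d nu '/d la) x).

Definition vdensity n (nu : 'I_n -> {charge set T -> \bar R})
    (la : {sigma_finite_measure set T -> \bar R}) (x : T) : 'rV[R]_n :=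
  \row_i density (nu i) la x.

Definition concentrated_on (mu : set T -> \bar R) (K : set T) : Prop :=
  forall A, measurable A -> A `&` K = set0 -> mu A = 0%E.

End signed_measures.

Section transport.
Context {R : realType} {d : nat}.
Implicit Types Omega : set 'rV[R]_d.

(* M^+(closure Omega) x M^+(bdry Omega), with total mass one. *)
Record Poplus Omega := {
  bulk_part : {finite_measure set space R d -> \bar R};
  bdry_part : {finite_measure set space R d -> \bar R};
  bulk_part_concentrated : concentrated_on bulk_part (closure Omega);
  bdry_part_concentrated : concentrated_on bdry_part (bdry Omega);
  total_mass : measure_add bulk_part bdry_part [set: space R d] = 1%E }.

(* Library measures are functions on all sets, arbitrary on non-measurable ones,
   so equality of measures is equality on Borel sets. *)
Definition eq_Poplus Omega (rho sigma : Poplus Omega) : Prop :=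
  forall A : set (space R d), measurable A ->
    bulk_part rho A = bulk_part sigma A /\ bdry_part rho A = bdry_part sigma A.

Record evolution := {
  evo_omega : {charge set spacetime R d -> \bar R};
  evo_F : 'I_d -> {charge set spacetime R d -> \bar R};
  evo_gamma : {charge set spacetime R d -> \bar R};
  evo_G : 'I_d -> {charge set spacetime R d -> \bar R};
  evo_f : {charge set spacetime R d -> \bar R} }.

(* Tangential measures on the boundary, locally R^(d-1)-valued, are R^d-valued
   measures whose density takes values in the tangent spaces. *)
Definition tangential Omega (nu : 'I_d -> {charge set spacetime R d -> \bar R}) :
    Prop :=
  let la := variations [seq nu i | i <- enum 'I_d] in
  {ae la, forall p : spacetime R d, Qbdry Omega p ->
    tangent Omega p.2 (vdensity nu la p)}.

Definition admissible Omega (mu : evolution) : Prop :=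
  [/\ concentrated_on (evo_omega mu) (Qbulk Omega),
      (forall i, concentrated_on (evo_F mu i) (Qbulk Omega)),
      concentrated_on (evo_gamma mu) (Qbdry Omega),
      (forall i, concentrated_on (evo_G mu i) (Qbdry Omega)) /\
        tangential Omega (evo_G mu) &
      concentrated_on (evo_f mu) (Qbdry Omega)].

(* In both equations the test functions of class C^1 on the compact set are the
   restrictions of the C^1 functions on R x R^d; only their values and
   (tangential) derivatives on that set enter. *)
Definition bulk_equation Omega (rho0 rho1 : Poplus Omega) (mu : evolution) : Prop :=
  forall phi : R * 'rV[R]_d -> R, C1 phi ->
    cintegral (evo_omega mu) (Qbulk Omega) (partial_t phi)
    + vintegral (evo_F mu) (Qbulk Omega) (fun p => grad (fun x => phi (p.1, x)) p.2)
    - cintegral (evo_f mu) (Qbdry Omega) phi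
    = \int[bulk_part rho1]_(x in closure Omega) phi (1, x)
      - \int[bulk_part rho0]_(x in closure Omega) phi (0, x).

Definition bdry_equation Omega (rho0 rho1 : Poplus Omega) (mu : evolution) : Prop :=
  forall psi : R * 'rV[R]_d -> R, C1 psi ->
    cintegral (evo_gamma mu) (Qbdry Omega) (partial_t psi)
    + vintegral (evo_G mu) (Qbdry Omega)
        (fun p => tgrad Omega (fun x => psi (p.1, x)) p.2)
    + cintegral (evo_f mu) (Qbdry Omega) psi
    = \int[bdry_part rho1]_(x in bdry Omega) psi (1, x)
      - \int[bdry_part rho0]_(x in bdry Omega) psi (0, x).

Definition CE Omega (rho0 rho1 : Poplus Omega) : set evolution :=
  [set mu | [/\ admissible Omega mu, bulk_equation rho0 rho1 mu &
                bdry_equation rho0 rho1 mu]].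

Definition A_bulk (w : R) (J : 'rV[R]_d) : \bar R :=
  if 0 < w then (dot J J / (2 * w))%:E
  else if (w == 0) && (J == 0) then 0%E else +oo%E.

Definition A_bdry (kappa g : R) (J : 'rV[R]_d) (h : R) : \bar R :=
  if 0 < g then ((dot J J + kappa ^+ 2 * h ^+ 2) / (2 * g))%:E
  else if [&& g == 0, J == 0 & h == 0] then 0%E else +oo%E.

(* The integrands are 1-homogeneous, so any other dominating reference measures
   give the same value; see variations_dominates for the ones used here. *)
Definition action Omega (kappa : R) (mu : evolution) : \bar R :=
  let laO := variations (evo_omega mu :: [seq evo_F mu i | i <- enum 'I_d]) in
  let laG := variations [:: evo_gamma mu, evo_f mu & [seq evo_G mu i | i <- enum 'I_d]] in
  (\int[laO]_(p in Qbulk Omega)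
      A_bulk (density (evo_omega mu) laO p) (vdensity (evo_F mu) laO p)
   + \int[laG]_(p in Qbdry Omega)
      A_bdry kappa (density (evo_gamma mu) laG p) (vdensity (evo_G mu) laG p)
        (density (evo_f mu) laG p))%E.

Definition W2 Omega (kappa : R) (rho0 rho1 : Poplus Omega) : \bar R :=
  ereal_inf [set action Omega kappa mu | mu in CE rho0 rho1].

Definition W_dist Omega (kappa : R) (rho0 rho1 : Poplus Omega) : \bar R :=
  sqrte (W2 kappa rho0 rho1).

End transport.

Definition is_distance {R : realType} (X : Type) (eqX : X -> X -> Prop)
    (D : X -> X -> \bar R) : Prop :=
  [/\ forall x y, (0 <= D x y < +oo)%E,
      forall x y, D x y = 0%E <-> eqX x y,
      forall x y, D x y = D y x &
      forall x y z, (D x z <= D x y + D y z)%E].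

(* Main.v *)
From HB Require Import structures.
From mathcomp Require Import all_boot all_order all_algebra.
From mathcomp Require Import all_classical all_reals all_analysis.
From mathcomp Require Import measurable_realfun.
From mathcomp Require Import ring lra.
Require Import Defs.

(** The distance is studied through the relation [linked c e0 e1]: some evolution of action
    at most [c] leads from the endpoint [e0] to [e1].  The squared distance is the infimum of
    these [c] ([linked_W2_le], [W2_lt_linked]), and the axioms become statements on [linked].

    Everything rests on a description of the action without densities.  The integrand
    [dot J J / (2 * w)] is the supremum over [b] of [dot b J - dot b b / 2 * w], and monotone
    convergence turns the integral of a countable supremum into a supremum over finite
    partitions ([integral_A_bulk_leP]).  So a part of the action is at most [c] exactly when one
    linear inequality in the values of the measures holds for each finite family of disjoint
    sets and slopes ([action_leP]).  In the same way tangentiality says that the normal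
    component of the flux vanishes as a measure ([tangentialP]).  Both conditions are visibly
    stable under sums and images.

    Symmetry follows by reversing time, and the triangle inequality by running two evolutions
    one after the other: spending the fraction [tau] of the time on the first one costs
    [c / tau + c' / (1 - tau)] ([linked_trans]), which for the best [tau] is the square of the
    sum of the square roots ([W_triangle]).

    The distance is finite because every configuration can be moved to one interior point
    ([linked_any]).  Boundary mass first turns into bulk mass, decaying like [(1 - t) ^+ 2], for
    which the rate of exchange is square integrable with respect to the mass
    ([bdry_release]).  The closed domain is then covered by finitely many open sets whose
    points see a common interior point along segments of the closed domain; near the boundary
    this uses a defining function ([star_shaped_bdry]).  Each piece moves along these segments,
    and the interior points are joined through connectedness ([points_joined]).

    Equal configurations have distance zero through the static evolution.  Conversely, the test
    function [t] shows that an evolution has total mass one ([mass_conservation]), so that an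
    action [c] bounds the total variation of the fluxes and of the exchange by a multiple of
    [Num.sqrt c] ([flux_le], [bdry_flux_le], [exchange_le]).  If the cost is arbitrarily small,
    the integrals of all functions of class C^1 agree at both ends, and these functions
    determine the measures ([eq_measure_C1], [rigidity]). *)

Set Implicit Arguments.
Unset Strict Implicit.
Unset Printing Implicit Defensive.

Import Order.TTheory GRing.Theory Num.Theory.
Import numFieldNormedType.Exports.

Local Open Scope classical_set_scope.
Local Open Scope ring_scope.
Local Open Scope charge_scope.

(** * Integrals of bounded functions against charges *)

Section bounded_measurable.
Context {disp : measure_display} {T : measurableType disp} {R : realType}.
Implicit Types (f g : T -> R) (mu : {finite_measure set T -> \bar R})
  (nu : {charge set T -> \bar R}).

Definition bmeas f :=
  measurable_fun setT f /\ exists M : R, forall x, `|f x| <= M.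

Lemma bmeas_cst (c : R) : bmeas (fun=> c).
Proof. by split; [exact: measurable_cst|exists `|c|]. Qed.

Lemma bmeasD f g : bmeas f -> bmeas g -> bmeas (fun x => f x + g x).
Proof.
move=> [mf [M fM]] [mg [N gN]]; split; first exact: measurable_funD.
by exists (M + N) => x; rewrite (le_trans (ler_normD _ _))// lerD.
Qed.

Lemma bmeasM f g : bmeas f -> bmeas g -> bmeas (fun x => f x * g x).
Proof.
move=> [mf [M fM]] [mg [N gN]]; split; first exact: measurable_funM.
by exists (M * N) => x; rewrite normrM ler_pM.
Qed.

Lemma bmeasZ (c : R) f : bmeas f -> bmeas (fun x => c * f x).
Proof. by move=> ?; apply: bmeasM => //; exact: bmeas_cst. Qed.

Lemma bmeasN f : bmeas f -> bmeas (fun x => - f x).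
Proof.
by move=> /(bmeasZ (-1)); under eq_fun do rewrite mulN1r.
Qed.

Lemma bmeasB f g : bmeas f -> bmeas g -> bmeas (fun x => f x - g x).
Proof. by move=> bf /bmeasN; exact: bmeasD. Qed.

Lemma bmeas_sum (I : Type) (s : seq I) (P : pred I) (h : I -> T -> R) :
  (forall i, P i -> bmeas (h i)) -> bmeas (fun x => \sum_(i <- s | P i) h i x).
Proof.
move=> bh; elim: s => [|i s ih].
  by under eq_fun do rewrite big_nil; exact: bmeas_cst.
under eq_fun do rewrite big_cons.
by case Pi: (P i) => //; apply: bmeasD => //; exact: bh.
Qed.

Lemma bmeas_indic (A : set T) : measurable A -> bmeas (\1_A : T -> R).
Proof.
move=> mA; split; first exact: measurable_indic.
by exists 1 => x; rewrite indicE; case: (_ \in _); rewrite ?normr1 ?normr0.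
Qed.

Lemma bmeas_restrict (A : set T) f (M : R) : measurable A ->
  measurable_fun A f -> (forall x, A x -> `|f x| <= M) -> bmeas (f \_ A).
Proof.
move=> mA mf fM; split; first exact/(measurable_restrictT f mA).
exists `|M| => x; rewrite patchE; case: ifPn => [|_]; last by rewrite normr0.
by rewrite inE => /fM /le_trans; apply; exact: ler_norm.
Qed.

Lemma bmeas_integrable mu f : bmeas f -> mu.-integrable setT (EFin \o f).
Proof.
move=> [mf [M fM]]; apply: measurable_bounded_integrable => //.
  by rewrite -ge0_fin_numE// fin_num_measure.
by exists M; split; [exact: num_real|move=> y My x _; exact: le_trans (fM _) (ltW My)].
Qed.

(** Integration against a charge is defined through a chosen Hahn decomposition, which
    behaves badly under sums, multiples and images of charges.  All identities between
    integrals are obtained instead by comparing two functionals of this kind on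
    indicators, see [bounded_linear_eq]. *)
Definition bounded_linear (L : (T -> R) -> R) :=
  [/\ forall f g, bmeas f -> bmeas g -> L (fun x => f x + g x) = L f + L g,
      forall c f, bmeas f -> L (fun x => c * f x) = c * L f &
      exists C : R, forall f (M : R), bmeas f -> (forall x, `|f x| <= M) ->
        `|L f| <= C * M].

Lemma bounded_linear_sum L (I : Type) (s : seq I) (P : pred I) (h : I -> T -> R) :
  bounded_linear L -> (forall i, P i -> bmeas (h i)) ->
  L (fun x => \sum_(i <- s | P i) h i x) = \sum_(i <- s | P i) L (h i).
Proof.
move=> [LD LZ _] bh; elim: s => [|i s ih].
  under eq_fun do rewrite big_nil; rewrite big_nil.
  by have := LZ 0 _ (bmeas_cst 0); rewrite !mul0r.
rewrite big_cons; under eq_fun do rewrite big_cons.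
case: ifPn => // Pi; rewrite LD ?ih//; first exact: bh.
exact: bmeas_sum.
Qed.

Lemma bounded_linear_add L1 L2 : bounded_linear L1 -> bounded_linear L2 ->
  bounded_linear (fun f => L1 f + L2 f).
Proof.
move=> [D1 Z1 [C1 B1]] [D2 Z2 [C2 B2]]; split.
- by move=> f g bf bg; rewrite D1// D2// addrACA.
- by move=> c f bf; rewrite Z1// Z2// mulrDr.
- exists (C1 + C2) => f M bf fM; rewrite mulrDl (le_trans (ler_normD _ _))//.
  by rewrite lerD// (B1, B2).
Qed.

Lemma bounded_linear_scale (c : R) L : bounded_linear L ->
  bounded_linear (fun f => c * L f).
Proof.
move=> [D Z [C B]]; split.
- by move=> f g bf bg; rewrite D// mulrDr.
- by move=> a f bf; rewrite Z// mulrCA.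
- by exists (`|c| * C) => f M bf fM; rewrite normrM -mulrA ler_wpM2l// B.
Qed.

(** Halving: [f] differs from a function with half the bound by a multiple of
    the indicator of [f >= M / 2], and [L] ignores indicators. *)
Lemma bounded_linear_eq0 L : bounded_linear L ->
  (forall A, measurable A -> L \1_A = 0) -> forall f, bmeas f -> L f = 0.
Proof.
move=> [LD LZ [C LC]] L1.
have L1c (c : R) : L (fun=> c) = 0.
  rewrite (_ : (fun=> c) = (fun x => c * \1_setT x)); last first.
    by apply/funext => x; rewrite indicT mulr1.
  by rewrite LZ ?L1 ?mulr0//; exact: bmeas_indic.
have Lhalf n : forall f M, bmeas f -> (forall x, 0 <= f x <= M) ->
    `|L f| <= C * M / 2 ^+ n.
  elim: n => [|n ih] f M bf fM.
    rewrite expr0 divr1; apply: LC => // x.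
    by have /andP[f0 ?] := fM x; rewrite ger0_norm.
  pose A := f @^-1` `[M / 2, +oo[.
  have mA : measurable A.
    rewrite -[A]setTI; apply: bf.1 => //.
  pose g x := f x + (- (M / 2)) * \1_A x.
  have bA : bmeas (\1_A : T -> R) by exact: bmeas_indic.
  have bg : bmeas g by apply: bmeasD => //; exact: bmeasZ.
  have -> : L f = L g by rewrite LD// ?LZ// ?L1// ?mulr0 ?addr0//; exact: bmeasZ.
  rewrite exprS invfM mulrA -(mulrA C M); apply: ih => // x.
  rewrite /g indicE; have := fM x => /andP[f0 f1].
  case: (boolP (x \in A)); rewrite (inE, notin_setE) /A/= in_itv/= andbT.
    by move=> h; lra.
  by move/negP; rewrite -ltNge => h; lra.
have Lpos f M : bmeas f -> (forall x, 0 <= f x <= M) -> L f = 0.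
  move=> bf fM; apply/eqP; rewrite -normr_eq0 eq_le normr_ge0 andbT.
  have cv : (fun n => C * M / 2 ^+ n : R) @ \oo --> (0 : R).
    rewrite -(mulr0 (C * M)); apply: cvgM; first exact: cvg_cst.
    have := @cvg_geometric R 1 (2^-1); rewrite ger0_norm ?invr_ge0// invf_lt1 ?ltr1n//.
    move=> /(_ isT); rewrite /geometric /=; under eq_fun do rewrite mul1r exprVn; exact.
  by apply: (cvgr_to_ge cv); apply: nearW => n; exact: Lhalf.
move=> f bf; have [_ [M fM]] := bf.
have -> : f = (fun x => (f x + M) + - M) by apply/funext => x; rewrite addrK.
have bM : bmeas (fun x => f x + M) by apply: bmeasD => //; exact: bmeas_cst.
rewrite LD ?L1c ?addr0//; last exact: bmeas_cst.
apply: (Lpos _ (M + M)) => // x.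
by have := fM x; rewrite ler_norml => /andP[? ?]; lra.
Qed.

Lemma bounded_linear_eq L1 L2 : bounded_linear L1 -> bounded_linear L2 ->
  (forall A, measurable A -> L1 \1_A = L2 \1_A) ->
  forall f, bmeas f -> L1 f = L2 f.
Proof.
move=> b1 b2 L12 f bf; apply/eqP; rewrite -subr_eq0; apply/eqP.
rewrite -mulN1r; apply: (@bounded_linear_eq0 (fun f => L1 f + -1 * L2 f)) => //.
  by apply: bounded_linear_add => //; exact: bounded_linear_scale.
by move=> A /L12 ->; rewrite mulN1r subrr.
Qed.

Lemma bounded_linear_Rintegral mu :
  bounded_linear (fun f => \int[mu]_x f x).
Proof.
split.
- by move=> f g bf bg; rewrite RintegralD//; exact: bmeas_integrable.
- by move=> c f bf; rewrite RintegralZl//; exact: bmeas_integrable.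
- exists (fine (mu setT)) => f M bf fM; have fi := bmeas_integrable mu bf.
  rewrite (le_trans (le_normr_Rintegral _ _))// mulrC -Rintegral_cst//.
  apply: le_Rintegral => //; last exact: finite_measure_integrable_cst.
  exact: (integrable_norm fi).
Qed.

Lemma integrable_bmeasM mu f (h : T -> R) : bmeas f ->
  mu.-integrable setT (EFin \o h) ->
  mu.-integrable setT (EFin \o (fun x => f x * h x)).
Proof.
move=> [mf [M fM]] ih; rewrite (_ : _ \o _ = (EFin \o f) \* (EFin \o h))%E//.
apply: integrableMr => //; exists M; split; first exact: num_real.
by move=> y My x _; exact: le_trans (fM _) (ltW My).
Qed.

Lemma bounded_linear_Rintegral_density mu (h : T -> R) :
  mu.-integrable setT (EFin \o h) ->
  bounded_linear (fun f => \int[mu]_x (f x * h x)).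
Proof.
move=> ih.
have ifh f (bf : bmeas f) := integrable_bmeasM bf ih.
split.
- move=> f g bf bg; rewrite -RintegralD//; try exact: ifh.
  by apply: eq_Rintegral => x _; rewrite mulrDl.
- move=> c f bf; rewrite -RintegralZl//; try exact: ifh.
  by apply: eq_Rintegral => x _; rewrite mulrA.
- exists (\int[mu]_x `|h x|) => f M bf fM.
  rewrite (le_trans (le_normr_Rintegral _ _))//; first exact: ifh.
  rewrite mulrC -RintegralZl//; last exact: integrable_norm ih.
  apply: le_Rintegral => //; first exact: (integrable_norm (ifh _ bf)).
    rewrite (_ : _ \o _ = fun x => M%:E * (EFin \o (fun y => `|h y|%R)) x)%E//.
    by apply: integrableZl => //; exact: integrable_norm ih.
  by move=> x _; rewrite normrM ler_wpM2r.
Qed.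

Lemma Rintegral_indic mu (A : set T) (h : T -> R) : measurable A ->
  \int[mu]_x (\1_A x * h x) = \int[mu]_(x in A) h x.
Proof.
move=> mA; rewrite (Rintegral_mkcond mu A); apply: eq_Rintegral => x _.
by rewrite patchE indicE; case: ifPn => _; rewrite (mul1r, mul0r).
Qed.

Definition cint nu f := cintegral nu setT f.

Lemma cintE nu f : cint nu f =
  \int[jordan_pos (proj2_sig (hahn_spec nu))]_x f x -
  \int[jordan_neg (proj2_sig (hahn_spec nu))]_x f x.
Proof. by []. Qed.

Lemma cintegralE nu (D : set T) f : cintegral nu D f = cint nu (f \_ D).
Proof. by rewrite /cint /cintegral -!(Rintegral_mkcond _ D). Qed.

Lemma bounded_linear_cint nu : bounded_linear (cint nu).
Proof.
rewrite (_ : cint nu = (fun f =>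
    \int[jordan_pos (proj2_sig (hahn_spec nu))]_x f x + (-1) *
    \int[jordan_neg (proj2_sig (hahn_spec nu))]_x f x)); last first.
  by apply/funext => f; rewrite cintE mulN1r.
apply: bounded_linear_add; first exact: bounded_linear_Rintegral.
exact/bounded_linear_scale/bounded_linear_Rintegral.
Qed.

Lemma cint_indic nu (A : set T) : measurable A -> cint nu \1_A = fine (nu A).
Proof.
move=> mA; rewrite cintE.
have E (mu : {finite_measure set T -> \bar R}) : \int[mu]_x \1_A x = fine (mu A).
  rewrite -[RHS]mul1r -Rintegral_cst// -(Rintegral_indic _ (fun=> 1)) //.
  by apply: eq_Rintegral => x _; rewrite mulr1.
rewrite !E (jordan_decomp (proj2_sig (hahn_spec nu)) mA) /cadd /cscale/=.
by rewrite cscaleN1 fineB// fin_num_measure.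
Qed.

(** The integral against a charge is the only bounded linear extension of its values on
    sets; this frees every later computation from Hahn decompositions. *)
Lemma cint_eq nu L : bounded_linear L ->
  (forall A, measurable A -> L \1_A = fine (nu A)) ->
  forall f, bmeas f -> cint nu f = L f.
Proof.
move=> bL L1; apply: bounded_linear_eq => //; first exact: bounded_linear_cint.
by move=> A mA; rewrite cint_indic// L1.
Qed.

Lemma cintZ nu c f : bmeas f -> cint nu (fun x => c * f x) = c * cint nu f.
Proof. by case: (bounded_linear_cint nu) => _ + _; exact. Qed.

Lemma cint_cadd (nu1 nu2 : {charge set T -> \bar R}) f : bmeas f ->
  cint (cadd nu1 nu2) f = cint nu1 f + cint nu2 f.
Proof.
move=> bf; rewrite (@cint_eq _ (fun f => cint nu1 f + cint nu2 f))//.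
  by apply: bounded_linear_add; exact: bounded_linear_cint.
by move=> A mA; rewrite !cint_indic// /cadd fineD// fin_num_measure.
Qed.

Lemma cint_cscale (c : R) nu f : bmeas f -> cint (cscale c nu) f = c * cint nu f.
Proof.
move=> bf; rewrite (@cint_eq _ (fun f => c * cint nu f))//.
  by apply: bounded_linear_scale; exact: bounded_linear_cint.
by move=> A mA; rewrite !cint_indic// /cscale fineM// fin_num_measure.
Qed.

Lemma cint_czero f : bmeas f -> cint (@czero _ T R) f = 0.
Proof.
move=> bf; rewrite (@cint_eq _ (fun=> 0))//; split => //.
- by move=> *; rewrite addr0.
- by move=> *; rewrite mulr0.
- by exists 0 => ? ? _ _; rewrite normr0 mul0r.
Qed.

Lemma cint_density nu mu (h : T -> R) : mu.-integrable setT (EFin \o h) ->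
  (forall A, measurable A -> nu A = (\int[mu]_(x in A) (h x)%:E)%E) ->
  forall f, bmeas f -> cint nu f = \int[mu]_x (f x * h x).
Proof.
move=> ih nuE; apply: cint_eq; first exact: bounded_linear_Rintegral_density.
by move=> A mA; rewrite Rintegral_indic// nuE.
Qed.

Lemma concentrated_on_cint nu (K : set T) f g : measurable K ->
  concentrated_on nu K -> bmeas f -> bmeas g -> {in K, f =1 g} ->
  cint nu f = cint nu g.
Proof.
move=> mK cK bf bg fg.
have bK := bmeas_indic mK.
have E h : bmeas h -> cint nu h = cint nu (fun x => \1_K x * h x).
  apply: (bounded_linear_eq (L2 := fun h => cint nu (fun x => \1_K x * h x))).
  - exact: bounded_linear_cint.
  - have [D Z [C B]] := bounded_linear_cint nu; split.
    - move=> u v bu bv; under eq_fun do rewrite mulrDr.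
      by rewrite D//; exact: bmeasM.
    - move=> c u bu; under eq_fun do rewrite mulrCA.
      by rewrite Z//; exact: bmeasM.
    - exists C => u M bu uM; apply: B; first exact: bmeasM.
      move=> x; rewrite indicE; case: (_ \in _); rewrite ?mul1r// mul0r normr0.
      exact: le_trans (uM x).
  move=> A mA.
  rewrite (_ : (fun x => _) = \1_(K `&` A)); last by rewrite indicI.
  rewrite !cint_indic//; last exact: measurableI.
  rewrite -[in LHS](setUIDK A K) chargeU; [|exact: measurableI|exact: measurableD|].
    rewrite setIC [X in (_ + X)%E]cK ?adde0//; first exact: measurableD.
    by rewrite setDE -setIA setICl setI0.
  by rewrite setDE setIACA setICr setI0.
rewrite E// [RHS]E//; congr (cint _ _); apply/funext => x.
rewrite indicE; case: (boolP (x \in K)) => xK; last by rewrite !mul0r.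
by rewrite fg.
Qed.

End bounded_measurable.

Section pushforward.
Context {d1 d2 : measure_display} {T1 : measurableType d1}
  {T2 : measurableType d2} {R : realType}.

Lemma bmeas_comp (S : T1 -> T2) (f : T2 -> R) : measurable_fun setT S ->
  bmeas f -> bmeas (fun x => f (S x)).
Proof.
move=> mS [mf [M fM]]; split; last by exists M.
exact: measurableT_comp.
Qed.

Lemma cint_pushforward (S : T1 -> T2) (mS : measurable_fun setT S)
    (nu : {charge set T1 -> \bar R}) (nu' : {charge set T2 -> \bar R}) :
  (forall A, measurable A -> nu' A = nu (S @^-1` A)) ->
  forall f, bmeas f -> cint nu' f = cint nu (fun x => f (S x)).
Proof.
move=> nuE; apply: cint_eq.
  have [D Z [C B]] := bounded_linear_cint nu; split.
  - by move=> f g bf bg; rewrite D//; exact: bmeas_comp.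
  - by move=> c f bf; rewrite Z//; exact: bmeas_comp.
  - by exists C => f M bf fM; apply: B => //; exact: bmeas_comp.
move=> A mA; rewrite nuE// -cint_indic//.
by rewrite -[X in measurable X]setTI; exact: mS.
Qed.

End pushforward.

(** * Directional derivatives and functions of class C^1 *)

Section directional_derivatives.
Context {R : realType}.

Section normed.
Context {V : normedModType R}.
Implicit Types (f g : V -> R) (U : set V) (x v w : V).

Lemma is_derive_line f x v (s : R) : derivable f (s *: v + x) v ->
  is_derive s (1 : R) (fun h : R => f (h *: v + x)) ('D_v f (s *: v + x)).
Proof.
move=> fx.
have E : (fun h : R => h^-1 *: (f ((h *: (1 : R) + s) *: v + x) - f (s *: v + x))) =
         (fun h : R => h^-1 *: (f (h *: v + (s *: v + x)) - f (s *: v + x))).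
  by apply/funext => h; rewrite scaler1 scalerDl addrA.
split; first by rewrite /derivable/= E; exact: fx.
by rewrite /derive /= E.
Qed.

(** Steps [h] of either sign occur in [Ck_on1_deriveD], hence the two-sided bound. *)
Lemma line_MVT f x v (h : R) :
  (forall s : R, `|s| <= `|h| -> derivable f (s *: v + x) v) ->
  exists2 c : R, `|c| <= `|h| & f (h *: v + x) - f x = 'D_v f (c *: v + x) * h.
Proof.
move=> fd.
pose F (s : R) := f (s *: v + x).
have FD s : `|s| <= `|h| -> is_derive s (1 : R) F ('D_v f (s *: v + x)).
  by move=> /fd; exact: is_derive_line.
have Fc s : `|s| <= `|h| -> {for s, continuous F}.
  by move=> /FD => dF; apply/differentiable_continuous/derivable1_diffP.
have F0 : f x = F 0 by rewrite /F scale0r add0r.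
have [h0|h0] := leP 0 h.
- have [||c] := @MVT_segment R F (fun s => 'D_v f (s *: v + x)) 0 h h0.
  + move=> s; rewrite in_itv/= => /andP[s0 sh]; apply: FD.
    by rewrite !ger0_norm ?(ltW s0)// ltW.
  + apply: continuous_in_subspaceT => s; rewrite inE/= in_itv/= => /andP[s0 sh].
    by apply: Fc; rewrite !ger0_norm.
  rewrite in_itv/= => /andP[c0 ch]; rewrite subr0 => cE; exists c.
    by rewrite !ger0_norm.
  by rewrite F0 -cE.
- have [||c] := @MVT_segment R F (fun s => 'D_v f (s *: v + x)) h 0 (ltW h0).
  + move=> s; rewrite in_itv/= => /andP[s0 sh]; apply: FD.
    by rewrite !ltr0_norm// lerN2 ltW.
  + apply: continuous_in_subspaceT => s; rewrite inE/= in_itv/= => /andP[s0 sh].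
    by apply: Fc; rewrite !ler0_norm ?lerN2// ltW.
  rewrite in_itv/= => /andP[c0 ch]; rewrite sub0r => cE; exists c.
    by rewrite !ler0_norm ?lerN2// ltW.
  by rewrite F0 -[LHS]opprB cE mulrN opprK.
Qed.

(** Directional derivatives need not be linear in the direction, but they are always
    homogeneous: only the line through [x] is involved. *)
Lemma derive_scale f x v (c : R) : derivable f x v ->
  derivable f x (c *: v) /\ 'D_(c *: v) f x = c * 'D_v f x.
Proof.
move=> fd.
have d0 : is_derive ((c * 0) : R) (1 : R) (fun h : R => f (h *: v + x)) ('D_v f x).
  by have := @is_derive_line f x v (c * 0); rewrite mulr0 scale0r add0r; exact.
have d1 : is_derive (0 : R) (1 : R) ( *%R c) c.
  have := @is_deriveZ R R R id c 0 1 1 (is_derive_id _ _).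
  by rewrite /GRing.scale /= mulr1; exact.
have d2 := @is_derive1_comp R (fun h : R => f (h *: v + x)) ( *%R c) 0 _ _ d0 d1.
have E : (fun h : R => f (h *: v + x)) \o *%R c = (fun h : R => f (h *: (c *: v) + x)).
  by apply/funext => h /=; rewrite scalerA (mulrC h).
rewrite E in d2.
have dd : derivable f x (c *: v) by apply/derivable1P; case: d2.
split => //; have := @is_derive_line f x (c *: v) 0.
rewrite scale0r add0r => /(_ dd) [_ <-]; case: d2 => _ ->.
by rewrite mulrC.
Qed.

Lemma Ck_on_continuous k U f x : Ck_on k U f -> U x -> {for x, continuous f}.
Proof. by case: k => [|k] [fc _]; exact: fc. Qed.

Lemma Ck_on1_derivable U f x v : Ck_on 1 U f -> U x -> derivable f x v.
Proof. by move=> [_ [fd _]] Ux; exact: fd. Qed.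

Lemma Ck_on1_continuous_derive U f x v : Ck_on 1 U f -> U x ->
  {for x, continuous (fun y => 'D_v f y)}.
Proof. by move=> [_ [_ fd]] Ux; have [+ _] := fd v; exact. Qed.

(** Step first along one direction, then along the other, and use the mean value theorem
    for the second step: continuity of the derivative absorbs the moved base point. *)
Lemma Ck_on1_deriveD U f x v w : open U -> Ck_on 1 U f -> U x ->
  'D_(v + w) f x = 'D_v f x + 'D_w f x.
Proof.
move=> oU f1 Ux.
suff : h^-1 *: (f (h *: (v + w) + x) - f x) @[h --> (0:R)^'] --> 'D_v f x + 'D_w f x.
  by move=> /cvg_lim; apply; exact: norm_hausdorff.
rewrite [X in _ --> X]addrC.
have -> : (fun h : R => h^-1 *: (f (h *: (v + w) + x) - f x)) =
  (fun h : R => h^-1 *: (f (h *: w + (h *: v + x)) - f (h *: v + x)) +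
           h^-1 *: (f (h *: v + x) - f x)).
  apply/funext => h; rewrite -scalerDr addrA subrK addrA -scalerDr.
  by rewrite (addrC w).
apply: cvgD; last exact: (Ck_on1_derivable f1 Ux).
apply/cvgrPdist_le => /= e e0.
have := @Ck_on1_continuous_derive _ _ _ w f1 Ux.
move=> /cvgrPdist_le /(_ e e0) Dw.
have : \forall y \near x, U y /\ `|'D_w f x - 'D_w f y| <= e.
  by near=> y; split; near: y => //; exact: open_nbhs_nbhs.
move=> /nbhs_ballP[r /= r0 Br].
have vw0 : 0 < `|v| + `|w| + 1 by rewrite ltr_wpDl// addr_ge0.
have Bh : \forall h \near (0 : R)^', `|h| < r / (`|v| + `|w| + 1).
  apply: dnbhs0_lt; exact: divr_gt0.
near=> h.
have hr : `|h| < r / (`|v| + `|w| + 1) by near: h.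
have h0 : h != 0 by near: h; exact: nbhs_dnbhs_neq.
have inB (s : R) : `|s| <= `|h| -> ball x r (s *: w + (h *: v + x)).
  move=> sh; rewrite -ball_normE /ball_ /= distrC addrA addrK.
  rewrite (le_lt_trans (ler_normD _ _))// !normrZ.
  apply: (@le_lt_trans _ _ (`|h| * (`|v| + `|w| + 1))).
    by rewrite !mulrDr mulr1 addrC -addrA lerD2l -[leLHS]addr0 lerD// ler_wpM2r.
  by rewrite -ltr_pdivlMr.
have [|c ch ->] := @line_MVT f (h *: v + x) w h.
  by move=> s sh; apply: (Ck_on1_derivable f1); have [] := Br _ (inB s sh).
rewrite mulrC scalerA mulVf// scale1r.
by have [] := Br _ (inB c ch).
Unshelve. all: by end_near. Qed.

Lemma Ck_on1_derive_sum U f x (I : Type) (s : seq I) (P : pred I) (v : I -> V) :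
  open U -> Ck_on 1 U f -> U x ->
  'D_(\sum_(i <- s | P i) v i) f x = \sum_(i <- s | P i) 'D_(v i) f x.
Proof.
move=> oU f1 Ux; elim: s => [|i s ih].
  by rewrite !big_nil derive0.
by rewrite !big_cons; case: (P i) => //; rewrite (Ck_on1_deriveD _ _ oU f1 Ux) ih.
Qed.

End normed.

Section row_vectors.
Context {n : nat}.
Implicit Types (u v x : 'rV[R]_n) (f : 'rV[R]_n -> R) (U : set 'rV[R]_n).

Lemma dotC u v : dot u v = dot v u.
Proof. by apply: eq_bigr => i _; rewrite mulrC. Qed.

Lemma dotDl u v w : dot (u + v) w = dot u w + dot v w.
Proof. by rewrite -big_split; apply: eq_bigr => i _; rewrite mxE mulrDl. Qed.

Lemma dotZl (c : R) u w : dot (c *: u) w = c * dot u w.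
Proof. by rewrite mulr_sumr; apply: eq_bigr => i _; rewrite mxE mulrA. Qed.

Lemma dotDr u v w : dot w (u + v) = dot w u + dot w v.
Proof. by rewrite dotC dotDl !(dotC w). Qed.

Lemma dotZr (c : R) u w : dot w (c *: u) = c * dot w u.
Proof. by rewrite dotC dotZl dotC. Qed.

Lemma dotNl u w : dot (- u) w = - dot u w.
Proof. by rewrite -scaleN1r dotZl mulN1r. Qed.

Lemma dotNr u w : dot w (- u) = - dot w u.
Proof. by rewrite dotC dotNl dotC. Qed.

Lemma dotBl u v w : dot (u - v) w = dot u w - dot v w.
Proof. by rewrite dotDl dotNl. Qed.

Lemma dotBr u v w : dot w (u - v) = dot w u - dot w v.
Proof. by rewrite dotDr dotNr. Qed.

Lemma dot0l u : dot 0 u = 0.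
Proof. by rewrite -(scale0r (0 : 'rV_n)) dotZl mul0r. Qed.

Lemma dot0r u : dot u 0 = 0. Proof. by rewrite dotC dot0l. Qed.

Lemma dot_ge0 u : 0 <= dot u u.
Proof. by apply: sumr_ge0 => i _; rewrite -expr2 sqr_ge0. Qed.

Lemma dot_eq0 u : (dot u u == 0) = (u == 0).
Proof.
apply/idP/idP => [|/eqP ->]; last by rewrite dot0l.
rewrite psumr_eq0 => [/allP u0|i _]; last by rewrite -expr2 sqr_ge0.
apply/eqP/rowP => i; rewrite mxE; apply/eqP.
by have := u0 i; rewrite mem_index_enum -expr2 sqrf_eq0; apply.
Qed.

Lemma dot_gt0 u : (0 < dot u u) = (u != 0).
Proof. by rewrite lt_neqAle dot_ge0 andbT eq_sym dot_eq0. Qed.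

Lemma derive_grad U f x v : open U -> Ck_on 1 U f -> U x ->
  'D_v f x = dot v (grad f x).
Proof.
move=> oU f1 Ux; rewrite {1}(row_sum_delta v) (Ck_on1_derive_sum _ _ _ oU f1 Ux).
apply: eq_bigr => i _; rewrite mxE.
by have [_ ->] := derive_scale (v 0 i) (@Ck_on1_derivable _ _ _ _ 'e_i f1 Ux).
Qed.

Lemma continuous_sum (T : topologicalType) (I : Type) (s : seq I)
    (F : I -> T -> R) (x : T) : (forall i, {for x, continuous (F i)}) ->
  {for x, continuous (fun y => \sum_(i <- s) F i y)}.
Proof.
move=> cF; elim: s => [|i s ih].
  rewrite (_ : (fun y => _) = cst 0); first exact: cst_continuous.
  by apply/funext => y; rewrite big_nil.
rewrite (_ : (fun y => _) = (fun y => F i y + \sum_(j <- s) F j y)).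
  by apply: cvgD; [exact: cF|exact: ih].
by apply/funext => y; rewrite big_cons.
Qed.

Lemma continuous_coord (i : 'I_n) : continuous (fun v : 'rV[R]_n => v 0 i).
Proof. exact: coord_continuous. Qed.

Lemma continuous_dot (T : topologicalType) (F G : T -> 'rV[R]_n) (x : T) :
  {for x, continuous F} -> {for x, continuous G} ->
  {for x, continuous (fun y => dot (F y) (G y))}.
Proof.
move=> cF cG; apply: continuous_sum => i.
apply: cvgM.
  by apply: (@continuous_comp _ _ _ F (fun v => v 0 i)) => //; exact: continuous_coord.
by apply: (@continuous_comp _ _ _ G (fun v => v 0 i)) => //; exact: continuous_coord.
Qed.

End row_vectors.

Section spacetime.
Context {n : nat}.
Implicit Types (phi : R * 'rV[R]_n -> R).

Lemma C1P (V : normedModType R) (f : V -> R) : C1 f <->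
  [/\ continuous f, forall x v, derivable f x v & forall v, continuous (fun y => 'D_v f y)].
Proof.
split=> [[fc [fd fD]]|[fc fd fD]].
  split; [by move=> x; exact: fc|by move=> x v; exact: fd|].
  by move=> v x; have [+ _] := fD v; exact.
by split; [move=> x _; exact: fc|split=> [x v _|v]; [exact: fd|split=> // x _; exact: fD]].
Qed.

Section affine_substitution.
Context {V W : normedModType R} (A L : W -> V) (f : V -> R).
Hypothesis AL : forall (h : R) v p, A (h *: v + p) = h *: L v + A p.

Let quotientE p v :
  (fun h : R => h^-1 *: ((fun q => f (A q)) (h *: v + p) - f (A p))) =
  (fun h : R => h^-1 *: (f (h *: L v + A p) - f (A p))).
Proof. by apply/funext => h /=; rewrite AL. Qed.

Lemma derive_affine p v : 'D_v (fun q => f (A q)) p = 'D_(L v) f (A p).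
Proof. by rewrite /derive quotientE. Qed.

Lemma C1_affine : continuous A -> C1 f -> C1 (fun q => f (A q)).
Proof.
move=> cA /C1P[fc fd fD]; apply/C1P; split.
- by move=> p; apply: (continuous_comp (cA p)); exact: fc.
- by move=> p v; rewrite /derivable quotientE; exact: fd.
- move=> v; under eq_fun do rewrite derive_affine.
  by move=> p; apply: (@continuous_comp _ _ _ A ('D_(L v) f)); [exact: cA|exact: fD].
Qed.

End affine_substitution.

Lemma continuous_pair (T U V : topologicalType) (F : T -> U) (G : T -> V) (x : T) :
  {for x, continuous F} -> {for x, continuous G} ->
  {for x, continuous (fun y => (F y, G y))}.
Proof. by move=> cF cG; exact: (@cvg_pair _ _ _ _ (nbhs (F x)) (nbhs (G x))). Qed.

Let slice_affine (t h : R) (v x : 'rV[R]_n) :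
  (t, h *: v + x) = h *: ((0, v) : R * 'rV[R]_n) + (t, x).
Proof. by congr pair; rewrite /= scaler0 add0r. Qed.

Lemma derive_slice phi (t : R) (x v : 'rV[R]_n) :
  'D_v (fun y => phi (t, y)) x = 'D_((0, v) : R * 'rV[R]_n) phi (t, x).
Proof. exact: (derive_affine phi (slice_affine t)). Qed.

Lemma C1_slice phi (t : R) : C1 phi -> C1 (fun x => phi (t, x)).
Proof.
apply: (C1_affine (slice_affine t)) => x.
by apply: continuous_pair; [exact: cst_continuous|exact: cvg_id].
Qed.

(** Affine reparametrisation of time, used to reverse evolutions and to run one after
    the other. *)
Definition time_map (a b : R) (p : R * 'rV[R]_n) : R * 'rV[R]_n := (a + b * p.1, p.2).

Lemma continuous_time_map a b : continuous (time_map a b).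
Proof.
move=> p; apply: (@continuous_pair _ _ _ (fun p => a + b * p.1)); last exact: cvg_snd.
apply: cvgD; first exact: cvg_cst.
by apply: cvgM; [exact: cvg_cst|exact: cvg_fst].
Qed.

Let time_map_affine a b (h : R) (v p : R * 'rV[R]_n) :
  time_map a b (h *: v + p) = h *: (b * v.1, v.2) + time_map a b p.
Proof. by rewrite /time_map /=; congr pair; rewrite /GRing.scale/= mulrDr addrCA (mulrCA b). Qed.

Lemma C1_time_map phi a b : C1 phi -> C1 (fun p => phi (time_map a b p)).
Proof. exact: (C1_affine (time_map_affine a b) (@continuous_time_map a b)). Qed.

Lemma partial_t_time_map phi a b p : C1 phi ->
  partial_t (fun q => phi (time_map a b q)) p = b * partial_t phi (time_map a b p).
Proof.
move=> /C1P[fc fd fD]; rewrite /partial_t (derive_affine phi (time_map_affine a b))/= mulr1.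
rewrite (_ : (b, 0) = b *: ((1, 0) : R * 'rV[R]_n)); last first.
  by rewrite /GRing.scale/= /scale_pair/= scaler0 /GRing.scale/= mulr1.
by have [_ ->] := derive_scale b (fd (time_map a b p) (1, 0)).
Qed.

Lemma C1_continuous_grad phi (i : 'I_n) : C1 phi ->
  continuous (fun p : R * 'rV[R]_n => grad (fun x => phi (p.1, x)) p.2 0 i).
Proof.
move=> /C1P[fc fd fD].
under eq_fun do rewrite mxE derive_slice -surjective_pairing.
exact: fD.
Qed.

Lemma C1_continuous_partial_t phi : C1 phi -> continuous (partial_t phi).
Proof. by move=> /C1P[_ _]; exact. Qed.

(** The derivative of a test function along a moving point splits into the two terms
    of the continuity equation. *)
Lemma C1_derive_pair phi p (v : 'rV[R]_n) (c : R) : C1 phi ->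
  'D_((c, v) : R * 'rV[R]_n) phi p =
  c * partial_t phi p + dot v (grad (fun x => phi (p.1, x)) p.2).
Proof.
move=> c1.
rewrite (_ : (c, v) = c *: ((1, 0) : R * 'rV[R]_n) + (0, v)); last first.
  by congr pair; rewrite /= ?scaler0 ?add0r// addr0 /GRing.scale/= mulr1.
rewrite (Ck_on1_deriveD _ _ openT c1)//.
have /C1P[fc fd fD] := c1.
have [_ ->] := derive_scale c (fd p (1, 0)); congr (_ + _).
have := derive_slice phi p.1 p.2 v; rewrite -surjective_pairing => <-.
by apply: (derive_grad _ openT) => //; exact: C1_slice.
Qed.

End spacetime.
End directional_derivatives.

(** * Borel sets of space and space-time *)

Section borel.
Context {R : realType}.

Definition rat_box n (c : 'rV[rat]_n * rat) : set 'rV[R]_n :=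
  ball (map_mx ratr c.1 : 'rV[R]_n) (ratr c.2).

Lemma open_rat_box n (c : 'rV[rat]_n * rat) : open (rat_box c).
Proof.
have [r0|r0] := ltP 0 (ratr c.2 : R); first exact: ball_open.
rewrite (_ : rat_box c = set0); first exact: open0.
by rewrite -subset0 => x [/lt_le_trans /(_ r0)]; rewrite ltxx.
Qed.

Lemma rat_between (x e : R) : 0 < e -> exists q : rat, `|x - ratr q| < e.
Proof.
move=> e0; have [q] := @rat_in_itvoo R (x - e) (x + e) ltac:(lra).
by rewrite in_itv/= => /andP[q1 q2]; exists q; rewrite ltr_norml; lra.
Qed.

Lemma rat_box_nbhs n (x : 'rV[R]_n) (r : rat) : 0 < r ->
  exists q : 'rV[rat]_n, rat_box (q, r) x /\
    rat_box (q, r) `<=` ball x (2 * ratr r : R).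
Proof.
move=> r0; have r0' : 0 < ratr r :> R by rewrite ltr0q.
have /choice[q qx] : forall i, exists q : rat, `|x 0 i - ratr q| < ratr r.
  by move=> i; exact: rat_between.
have xq : rat_box (\row_i q i, r) x.
  split => // i j; rewrite /ball/= !mxE (ord1 i) distrC; exact: qx.
exists (\row_i q i); split => // y qy.
by rewrite mulrDl !mul1r; apply: ball_triangle qy; exact/ball_sym.
Qed.

(** Boxes with rational data form a countable base.  This makes the Borel sets of
    space-time generated by products, and those of space generated by orthants. *)
Lemma open_bigcup_rat_box n (A : set 'rV[R]_n) : open A ->
  A = \bigcup_(c in [set c | rat_box c `<=` A]) rat_box c.
Proof.
move=> oA; apply/seteqP; split=> [x Ax|x [c]]; last exact.
have /nbhs_ballP[e /= e0 eA] := open_nbhs_nbhs (conj oA Ax).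
have [r] := @rat_in_itvoo R 0 (e / 2) ltac:(exact: divr_gt0).
rewrite in_itv/= ltr0q => /andP[r0 re].
have [q [qx qA]] := rat_box_nbhs x r0; exists (q, r) => //.
apply: (subset_trans qA); apply: subset_trans eA.
by apply: le_ball; lra.
Qed.

Definition rat_cyl n (c : rat * ('rV[rat]_n * rat)) : set (R * 'rV[R]_n) :=
  ball (ratr c.1 : R) (ratr c.2.2 : R) `*` rat_box c.2.

Lemma open_bigcup_rat_cyl n (A : set (R * 'rV[R]_n)) : open A ->
  A = \bigcup_(c in [set c | rat_cyl c `<=` A]) rat_cyl c.
Proof.
move=> oA; apply/seteqP; split=> [[t x] Ax|x [c]]; last exact.
have /nbhs_ballP[e /= e0 eA] := open_nbhs_nbhs (conj oA Ax).
have [r] := @rat_in_itvoo R 0 (e / 2) ltac:(exact: divr_gt0).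
rewrite in_itv/= ltr0q => /andP[r0 re].
have [q [qx qA]] := rat_box_nbhs x r0.
have [p pt] := @rat_between t (ratr r) ltac:(by rewrite ltr0q).
have tp : ball (ratr p : R) (ratr r) t by rewrite /ball/= distrC.
exists (p, (q, r)) => //; apply: subset_trans eA => -[s y] [/= ps qy]; split => /=.
  apply: (@le_ball _ _ _ (2 * ratr r)); first by lra.
  by rewrite mulrDl !mul1r; apply: ball_triangle ps; exact/ball_sym.
by apply: (@le_ball _ _ _ (2 * ratr r)); [lra|exact: qA].
Qed.

Lemma bigcup_measurable_count {d} {T : measurableType d} (I : countType)
    (P : set I) (F : I -> set T) :
  (forall i, P i -> measurable (F i)) -> measurable (\bigcup_(i in P) F i).
Proof.
move=> mF; rewrite bigcup_mkcond; apply: countable_bigcupT_measurable.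
  exact: countableP.
by move=> i; case: ifPn => // /set_mem; exact: mF.
Qed.

Lemma bigcap_measurable_count {d} {T : measurableType d} (I : countType)
    (F : I -> set T) :
  (forall i, measurable (F i)) -> measurable (\bigcap_i F i).
Proof.
move=> mF; rewrite -[X in measurable X]setCK setC_bigcap; apply: measurableC.
by apply: bigcup_measurable_count => i _; exact: measurableC.
Qed.

Lemma space_open_measurable n (A : set 'rV[R]_n) : open A ->
  measurable (A : set (space R n)).
Proof. by move=> oA; exact: sub_sigma_algebra. Qed.

Lemma spacetime_open_measurable n (A : set (R * 'rV[R]_n)) : open A ->
  measurable (A : set (spacetime R n)).
Proof. by move=> oA; exact: sub_sigma_algebra. Qed.

Lemma space_closed_measurable n (A : set 'rV[R]_n) : closed A ->
  measurable (A : set (space R n)).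
Proof.
move=> cA; rewrite -[A]setCK; apply: measurableC.
by apply: space_open_measurable; exact: closed_openC.
Qed.

Lemma spacetime_closed_measurable n (A : set (R * 'rV[R]_n)) : closed A ->
  measurable (A : set (spacetime R n)).
Proof.
move=> cA; rewrite -[A]setCK; apply: measurableC.
by apply: spacetime_open_measurable; exact: closed_openC.
Qed.

Lemma continuous_borel {T U : normedModType R} (f : T -> U) : continuous f ->
  measurable_fun setT (f : g_sigma_algebraType (@open T) ->
                           g_sigma_algebraType (@open U)).
Proof.
move=> cf; apply: (@measurability _ _ (g_sigma_algebraType (@open T)) (g_sigma_algebraType (@open U))
  setT f (@open U)) => // _ [A oA <-].
by rewrite setTI; apply: sub_sigma_algebra; move/continuousP: cf; exact.
Qed.

Lemma open_generates_R : @measurable _ R = <<s @open R >>.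
Proof.
apply/seteqP; split => A; last first.
  by apply: smallest_sub => [|B oB]; [exact: sigma_algebra_measurable|exact: open_measurable].
have E : @measurable _ R = <<s @RGenOpens.G R >> := RGenOpens.measurableE R.
rewrite E; apply: sub_sigma_algebra2 => _ [a [b ->]].
exact: interval_open.
Qed.

Lemma continuous_borel_real {T : normedModType R} (f : T -> R) : continuous f ->
  measurable_fun setT (f : g_sigma_algebraType (@open T) -> R).
Proof.
move=> cf; apply: (measurability _ open_generates_R) => // _ [A oA <-].
by rewrite setTI; apply: sub_sigma_algebra; move/continuousP: cf; exact.
Qed.

Lemma within_continuous_borel_real {T : normedModType R} (D : set T) (f : T -> R) :
  closed D -> {within D, continuous f} ->
  measurable_fun (D : set (g_sigma_algebraType (@open T)))
    (f : g_sigma_algebraType (@open T) -> R).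
Proof.
move=> cD cf; apply: (measurability _ open_generates_R) => // _ [A oA <-].
move/continuousP: cf => /(_ A oA)/open_subspaceP[V oV VD].
rewrite setIC -VD; apply: measurableI; first exact: sub_sigma_algebra.
by rewrite -[D]setCK; apply: measurableC; apply: sub_sigma_algebra; exact: closed_openC.
Qed.

(** Orthants form a pi-system generating the Borel sets, and their indicators are limits
    of smooth functions with explicit formulas. *)
Definition orthant n (a : 'rV[R]_n) : set 'rV[R]_n := [set x | forall i, a 0 i < x 0 i].

Lemma orthantI n (a b : 'rV[R]_n) :
  orthant a `&` orthant b = orthant (\row_i Num.max (a 0 i) (b 0 i)).
Proof.
apply/seteqP; split=> x /=; rewrite /orthant/=.
  by move=> [xa xb] i; rewrite mxE gt_max xa xb.
by move=> h; split=> i; have := h i; rewrite mxE gt_max => /andP[].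
Qed.

Lemma open_orthant n (a : 'rV[R]_n) : open (orthant a).
Proof.
rewrite openE => x ax; rewrite /interior.
apply: (@filter_forall _ _ (fun i y => a 0 i < y 0 i) (nbhs x)) => i.
have := @coord_continuous R 1 n 0 i x.
move=> /(_ [set y | a 0 i < y]); apply.
by apply: open_nbhs_nbhs; split; [exact: open_gt|exact: ax].
Qed.

(** Half-spaces are countable unions of orthants, complements of countable intersections of
    these supply the opposite strict inequalities, and both kinds together give the boxes. *)
Lemma borel_orthant n :
  @measurable _ (space R n) = <<s range (@orthant n) >>.
Proof.
pose T := g_sigma_algebraType (range (@orthant n)).
apply/seteqP; split => A; last first.
  apply: smallest_sub; first exact: sigma_algebra_measurable.
  by move=> _ [a _ <-]; apply: space_open_measurable; exact: open_orthant.
have mO a : measurable (orthant a : set T) by apply: sub_sigma_algebra; exists a.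
have mH (i : 'I_n) a : measurable ([set x : 'rV[R]_n | a < x 0 i] : set T).
  rewrite (_ : [set x | _] =
      \bigcup_k orthant (\row_j if j == i then a else - k%:R)).
    by apply: bigcup_measurable_count => k _; exact: mO.
  apply/seteqP; split=> [x /= ax|x [k _ /(_ i)]]; last by rewrite /= mxE eqxx.
  pose M := \sum_j `|x 0 j|.
  exists (Num.truncn M).+1 => // j; rewrite mxE; case: eqP => [->//|_].
  rewrite ltrNl (le_lt_trans _ (truncnS_gt M))//.
  rewrite (le_trans (ler_norm _))// normrN /M (bigD1 j)//= lerDl.
  exact: sumr_ge0.
have mL (i : 'I_n) a : measurable ([set x : 'rV[R]_n | x 0 i < a] : set T).
  rewrite (_ : [set x | _] = ~` \bigcap_k [set x : 'rV[R]_n | a - k.+1%:R^-1 < x 0 i]).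
    by apply: measurableC; apply: bigcap_measurable_count => k; exact: mH.
  apply/seteqP; split=> [x /= ax xa|x /= xa].
    have d0 : 0 < a - x 0 i by rewrite subr_gt0.
    have [k _ /(_ k (leqnn k)) /= kd] := near_infty_natSinv_lt (PosNum d0).
    have := xa k I; rewrite /= ltNge => /negP; apply.
    by rewrite lerBrDl -lerBrDr; exact: ltW.
  rewrite ltNge; apply/negP => ax; apply: xa => k _ /=.
  by rewrite (lt_le_trans _ ax)// ltrBlDr ltrDl invr_gt0.
apply: smallest_sub => [|B oB]; first exact: smallest_sigma_algebra.
rewrite (open_bigcup_rat_box oB).
apply: (@bigcup_measurable_count _ T) => c _.
have [r0|r0] := ltP 0 (ratr c.2 : R); last first.
  rewrite (_ : rat_box c = set0); first exact: measurable0.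
  by rewrite -subset0 => x [/lt_le_trans /(_ r0)]; rewrite ltxx.
rewrite (_ : rat_box c = \bigcap_(i in [set: 'I_n])
    ([set x : 'rV[R]_n | ratr (c.1 0 i) - ratr c.2 < x 0 i] `&`
     [set x : 'rV[R]_n | x 0 i < ratr (c.1 0 i) + ratr c.2])).
  by apply: (@bigcap_measurable_count _ T) => i; apply: measurableI; [exact: mH|exact: mL].
apply/seteqP; split=> x /=.
  move=> [_ xB] i _; have := xB 0 i; rewrite /ball/= mxE distrC ltr_distl.
  by move=> /andP[? ?]; split => /=.
move=> xI; split => // j i; have [/= ? ?] := xI i Logic.I.
by rewrite (ord1 j) /ball/= mxE distrC ltr_distl; apply/andP; split.
Qed.

Lemma eq_measure_orthant n (m1 m2 : {finite_measure set space R n -> \bar R}) :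
  (forall a, m1 (orthant a) = m2 (orthant a)) ->
  forall A : set (space R n), measurable A -> m1 A = m2 A.
Proof.
move=> m12 A mA.
apply: (@measure_unique _ R (space R n) (range (@orthant n)) (fun k => orthant (const_mx (- k%:R)))) => //.
- exact: borel_orthant.
- by move=> _ _ [a _ <-] [b _ <-]; rewrite orthantI; eexists.
- apply/seteqP; split => // x _.
  pose M := \sum_j `|x 0 j|.
  exists (Num.truncn M).+1 => // j; rewrite mxE.
  rewrite ltrNl (le_lt_trans _ (truncnS_gt M))//.
  rewrite (le_trans (ler_norm _))// normrN /M (bigD1 j)//= lerDl.
  exact: sumr_ge0.
- by move=> _ [a _ <-]; exact: m12.
- move=> k; rewrite -ge0_fin_numE// fin_num_measure//.
  by apply: space_open_measurable; exact: open_orthant.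
Qed.
End borel.

(** * The action as a supremum over disjoint sets *)

Lemma EFin_Rintegral {d : measure_display} {T : measurableType d} {R : realType}
    (mu : {measure set T -> \bar R}) (D : set T) (f : T -> R) :
  measurable D -> mu.-integrable D (EFin \o f) ->
  (\int[mu]_(x in D) f x)%:E = (\int[mu]_(x in D) (f x)%:E)%E.
Proof. by move=> mD fi; rewrite fineK//; exact: integrable_fin_num. Qed.

Section sup_integral.
Context {d : measure_display} {T : measurableType d} {R : realType}.
Variables (la : {finite_measure set T -> \bar R}) (D : set T) (mD : measurable D).
Variables (h : nat -> T -> R) (Phi : T -> \bar R).
Hypothesis ih : forall k, la.-integrable setT (EFin \o h k).
Hypothesis h0 : forall x, h 0%N x = 0.
Hypothesis h_le : forall k x, ((h k x)%:E <= Phi x)%E.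
Hypothesis h_sup : forall x (r : R), (r%:E < Phi x)%E -> exists k, r < h k x.

Let mh k : measurable_fun setT (h k).
Proof. by apply/measurable_EFinP; exact: (measurable_int la). Qed.

(** Keeping the index of the largest function, rather than the maximum itself, provides
    the partition on whose pieces a single function is integrated. *)
Fixpoint argmax n (x : T) : nat :=
  if n is n'.+1 then (if h (argmax n' x) x < h n'.+1 x then n'.+1 else argmax n' x)
  else 0%N.

Let F n x := h (argmax n x) x.

Lemma argmax_le n x : (argmax n x <= n)%N.
Proof.
elim: n => //= n ih'; case: ifP => // _; exact: leq_trans ih' _.
Qed.

Let F_S n x : F n.+1 x = Num.max (F n x) (h n.+1 x).
Proof. by rewrite /F/= /Num.max; case: ltP. Qed.

Let F_nd x : {homo F^~ x : m n / (m <= n)%N >-> m <= n}.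
Proof.
apply: homo_leq => [//|y z w|n]; first exact: le_trans.
by rewrite F_S le_max lexx.
Qed.

Let F_ge k x : h k x <= F k x.
Proof. by case: k => [|k]; [rewrite /F/=|rewrite F_S le_max lexx orbT]. Qed.

Let F_ge0 n x : 0 <= F n x.
Proof. by rewrite -(h0 x); apply: le_trans (F_nd x (leq0n n)). Qed.

Let mF n : measurable_fun setT (F n).
Proof.
elim: n => [|n ihn]; first exact: mh.
rewrite (_ : F n.+1 = fun x => Num.max (F n x) (h n.+1 x)).
  exact: measurable_maxr.
by apply/funext => x; exact: F_S.
Qed.

Let margmax n k : measurable [set x | argmax n x = k].
Proof.
elim: n k => [|n ihn] k.
  have [->|/eqP k0] := eqVneq k 0%N; first by rewrite (_ : [set _ | _] = setT)//; apply/seteqP.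
  by rewrite (_ : [set _ | _] = set0)//; apply/seteqP; split => // x /= /esym.
pose A := [set x | F n x < h n.+1 x].
have mA : measurable A.
  have := @measurable_fun_ltr _ _ _ setT _ _ (mF n) (mh n.+1).
  move=> /(_ measurableT [set true] I); rewrite setTI.
  by rewrite (_ : _ @^-1` _ = A)//; apply/seteqP; split.
have -> : [set x | argmax n.+1 x = k] =
    (A `&` [set x | n.+1 = k]) `|` (~` A `&` [set x | argmax n x = k]).
  apply/seteqP; split => x /=; rewrite /A /F/=.
    by case: ifPn => [?|/negP] ?; [left|right].
  by case: ifPn => [Ax|/negP nA] [[]|[]].
apply: measurableU; apply: measurableI => //; last exact: measurableC.
have [->|/eqP k0] := eqVneq n.+1 k.
  by rewrite (_ : [set _ | _] = setT)//; apply/seteqP.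
by rewrite (_ : [set _ | _] = set0)//; apply/seteqP; split.
Qed.

Let trivIset_argmax n : trivIset setT (fun k => [set x | argmax n x = k]).
Proof. by apply/trivIsetP => i j _ _ ij; apply/seteqP; split => x //= [-> /eqP]; rewrite (negbTE ij). Qed.

Let F_cvg x : (F n x)%:E @[n --> \oo] --> Phi x.
Proof.
rewrite (_ : Phi x = ereal_sup (range (fun n => (F n x)%:E))).
  by apply: ereal_nondecreasing_cvgn => m n mn; rewrite lee_fin F_nd.
apply/eqP; rewrite eq_le; apply/andP; split; last first.
  by apply: ge_ereal_sup => _ [n _ <-]; exact: h_le.
rewrite leNgt; apply/negP => sPhi.
have s0 : (0%:E <= ereal_sup (range (fun n => (F n x)%:E)))%E.
  by apply: ereal_sup_ubound; exists 0%N => //; rewrite /F/= h0.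
have sE : ereal_sup (range (fun n => (F n x)%:E)) \is a fin_num.
  by rewrite ge0_fin_numE// (lt_le_trans sPhi)// leey.
move: sPhi; rewrite -(fineK sE) => /h_sup[k]; rewrite ltNge => /negP; apply.
rewrite (le_trans (F_ge k x))// -lee_fin fineK//.
by apply: ereal_sup_ubound; exists k.
Qed.

Let F_sum n x : F n x = \sum_(k < n.+1) \1_[set x | argmax n x = k] x * h k x.
Proof.
rewrite (bigD1 (Ordinal (argmax_le n x : (argmax n x < n.+1)%N)))//= big1 ?addr0.
  by rewrite indicE mem_set// mul1r.
move=> k /eqP kx; rewrite indicE memNset ?mul0r//= => ak; apply: kx.
exact/val_inj.
Qed.

Lemma measurable_sup_integrand : measurable_fun setT Phi.
Proof.
apply: (@emeasurable_fun_cvg _ _ _ _ (fun n x => (F n x)%:E)) => //.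
by move=> n; exact/measurable_EFinP.
Qed.

Lemma sup_integrand_ge0 x : (0 <= Phi x)%E.
Proof. by have := h_le 0%N x; rewrite h0. Qed.

(** Monotone convergence: the integral of a countable supremum is approached by
    choosing one of finitely many functions on each piece of a partition. *)
Lemma sup_integral_le (c : R) :
  (forall n (E : nat -> set T), (forall k, measurable (E k)) -> trivIset setT E ->
    \sum_(k < n) \int[la]_(x in E k `&` D) h k x <= c) ->
  (\int[la]_(x in D) Phi x <= c%:E)%E.
Proof.
move=> Ec.
have cv : (\int[la]_(x in D) (F n x)%:E)%E @[n --> \oo] --> (\int[la]_(x in D) Phi x)%E.
  have -> : (\int[la]_(x in D) Phi x = \int[la]_(x in D) limn (fun n => (F n x)%:E))%E.
    by apply: eq_integral => x _; apply/esym/cvg_lim => //; exact: F_cvg.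
  apply: cvg_monotone_convergence => //.
  - by move=> n; apply/measurable_EFinP; exact: measurable_funTS.
  - by move=> n x _; rewrite lee_fin.
  - by move=> x _ m n mn; rewrite lee_fin F_nd.
apply: (cvge_to_le cv); apply: nearW => n.
have iFD k : la.-integrable setT (EFin \o (fun x => \1_[set x | argmax n x = k] x * h k x)).
  by apply: integrable_bmeasM => //; exact: bmeas_indic.
have FE : (\int[la]_(x in D) (F n x)%:E =
    (\sum_(k < n.+1) \int[la]_(x in [set x | argmax n x = k] `&` D) h k x)%:E)%E.
  under eq_integral do rewrite F_sum -sumEFin.
  rewrite (@integral_sum _ _ _ la D mD _ (fun k : 'I_n.+1 => EFin \o
    (fun x => \1_[set x | argmax n x = k] x * h k x))); last first.
    by move=> k; exact: integrableS (iFD k).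
  rewrite -sumEFin; apply: eq_bigr => k _.
  rewrite -EFin_Rintegral//; last exact: integrableS (iFD k).
  congr (_%:E); rewrite Rintegral_mkcond [RHS]Rintegral_mkcond.
  apply: eq_Rintegral => x _; rewrite !patchE in_setI indicE.
  by do 2 case: (_ \in _); rewrite /= ?mul1r ?mul0r.
rewrite FE lee_fin; exact: (Ec n.+1 _ (margmax n) (@trivIset_argmax n)).
Qed.

End sup_integral.

(** The converse of [sup_integral_le]: on each piece of a partition the supremum
    dominates whichever function was chosen there. *)
Lemma integral_ge_partition {d : measure_display} {T : measurableType d} {R : realType}
    (la : {finite_measure set T -> \bar R}) (D : set T) (h : nat -> T -> R)
    (Phi : T -> \bar R) n (E : nat -> set T) :
  measurable D -> measurable_fun setT Phi -> (forall x, 0 <= Phi x)%E ->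
  (forall k, la.-integrable setT (EFin \o h k)) ->
  (forall k x, ((h k x)%:E <= Phi x)%E) ->
  (forall k, measurable (E k)) -> trivIset setT E ->
  ((\sum_(k < n) \int[la]_(x in E k `&` D) h k x)%:E <= \int[la]_(x in D) Phi x)%E.
Proof.
move=> mD mPhi' Phi0 ih h_le mE tE.
have mPhi A : measurable_fun A Phi by exact: measurable_funTS.
apply: (@le_trans _ _ (\int[la]_(x in \big[setU/set0]_(k < n) (E k `&` D)) Phi x)%E); last first.
  apply: ge0_subset_integral => //.
  - by apply: bigsetU_measurable => k _; exact: measurableI.
  - by move=> x; rewrite -(@bigcup_mkord _ n (fun k => E k `&` D)) => -[k _ []].
rewrite -(big_mkord xpredT (fun k => E k `&` D)) ge0_integral_bigsetU//; last first.
- by apply: trivIset_setIr; exact: sub_trivIset tE.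
- exact: iota_uniq.
- by move=> k; exact: measurableI.
rewrite -sumEFin big_mkord; apply: lee_sum => k _.
have mEk : measurable (E k `&` D) by exact: measurableI.
have ihk : la.-integrable (E k `&` D) (EFin \o h k) by exact: integrableS (ih k).
rewrite EFin_Rintegral// integralE.
rewrite (@le_trans _ _ (\int[la]_(x in E k `&` D) (fun x => (h k x)%:E)^\+ x)%E)//.
  by apply: geeDl; rewrite oppe_le0; exact: integral_ge0.
apply: ge0_le_integral => //.
  by apply: measurable_funepos; exact: (measurable_int la).
move=> x _; rewrite funeposE ge_max; apply/andP; split; first exact: h_le.
exact: Phi0.
Qed.


Section action_density.
Context {R : realType} {m : nat}.
Implicit Types (w : R) (J b : 'rV[R]_m).

Lemma rat_dense (A : set 'rV[R]_m) x : open A -> A x ->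
  exists q : 'rV[rat]_m, A (map_mx ratr q).
Proof.
move=> oA Ax; have /nbhs_ballP[e /= e0 eA] := open_nbhs_nbhs (conj oA Ax).
have [r] := @rat_in_itvoo R 0 e e0.
rewrite in_itv/= ltr0q => /andP[r0 re].
have [q [qx _]] := rat_box_nbhs x r0.
exists q; apply: eA; apply: (@le_ball _ _ _ (ratr r)); first exact: ltW.
exact/ball_sym.
Qed.

(** For [w > 0] the largest value over [b] is [dot J J / (2 * w)], reached at [b = J / w];
    for other [w] the supremum produces exactly the conventions of [A_bulk]. *)
Definition affine_minorant (b : 'rV[R]_m) w J : R := dot b J - dot b b / 2 * w.

Lemma A_bulk_ge b w J : ((affine_minorant b w J)%:E <= A_bulk w J)%E.
Proof.
rewrite /A_bulk /affine_minorant; case: ltP => [w0|w0].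
  rewrite lee_fin ler_pdivlMr ?mulr_gt0//.
  have := dot_ge0 (J - w *: b).
  rewrite !(dotBl, dotBr, dotZl, dotZr) (dotC b J) => ?; nra.
case: ifPn => [/andP[/eqP -> /eqP ->]|_]; last by rewrite leey.
by rewrite dot0r mulr0 subr0.
Qed.

Lemma continuous_affine_minorant w J : continuous (fun b => affine_minorant b w J).
Proof.
have ci (b : 'rV[R]_m) : {for b, continuous (fun b : 'rV[R]_m => b)} by exact: cvg_id.
move=> b; apply: (@continuousB _ _ _ (fun b => dot b J)).
  by apply: continuous_dot => //; exact: cst_continuous.
apply: (@continuousM _ _ (fun b => dot b b / 2) (fun=> w)); last exact: cst_continuous.
apply: (@continuousM _ _ (fun b => dot b b) (fun=> 2^-1)); last exact: cst_continuous.
exact: continuous_dot.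
Qed.

(** The action density is the supremum of the affine minorants [affine_minorant b], and by
    continuity in [b] a countable family of slopes suffices. *)
Lemma A_bulk_sup (m0 : (0 < m)%N) w J (r : R) : (r%:E < A_bulk w J)%E ->
  exists q : 'rV[rat]_m, r < affine_minorant (map_mx ratr q) w J.
Proof.
move=> rA; suff [b rb] : exists b, r < affine_minorant b w J.
  apply: (@rat_dense [set b | r < affine_minorant b w J] b) => //.
  apply: (@open_comp _ _ (fun b => affine_minorant b w J) [set y | r < y]).
    by move=> x _; exact: continuous_affine_minorant.
  exact: open_gt.
move: rA; rewrite /A_bulk; case: (ltP 0 w) => w0.
  rewrite lte_fin => rJ; exists (w^-1 *: J).
  rewrite /affine_minorant !(dotZl, dotZr) (lt_le_trans rJ)// le_eqVlt; apply/orP; left.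
  by apply/eqP; field; rewrite gt_eqF.
case: ifPn => [_|].
  rewrite lte_fin => r0; exists 0.
  by rewrite /affine_minorant !dot0l !mul0r subr0.
rewrite negb_and => wJ _.
have [w_eq0|w_neq0] := eqVneq w 0.
  move: wJ; rewrite w_eq0 eqxx/= => J0.
  exists (((`|r| + 1) / dot J J) *: J).
  rewrite /affine_minorant mulr0 subr0 dotZl divfK ?dot_eq0//.
  by rewrite (le_lt_trans (ler_norm _))// ltrDl.
have {w0 w_neq0}w0 : w < 0 by rewrite lt_neqAle w_neq0.
pose e : 'rV[R]_m := delta_mx 0 (Ordinal m0).
have ee : dot e e = 1.
  rewrite /dot (bigD1 (Ordinal m0))//= big1 ?addr0.
    by rewrite !mxE !eqxx mulr1.
  by move=> i ij; rewrite !mxE eqxx/= (negbTE ij) mulr0.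
pose s := 2 * (`|r| + 1) / (- w) + 1.
have s1 : 1 <= s by rewrite lerDr divr_ge0 ?mulr_ge0 ?addr_ge0// oppr_ge0 ltW.
have sw : s * (- w) > 2 * `|r|.
  have -> : s * (- w) = 2 * (`|r| + 1) + - w by rewrite /s; field; rewrite lt_eqF.
  by lra.
have ssw : s * s / 2 * (- w) > `|r|.
  have : s * (- w) <= s * (s * (- w)) by rewrite ler_peMl// mulr_ge0 ?oppr_ge0 ?(le_trans ler01 s1)// ltW.
  by rewrite [s * (s * _)]mulrA => ?; lra.
have [Je|Je] := leP 0 (dot e J).
  exists (s *: e); rewrite /affine_minorant !(dotZl, dotZr) ee mulr1.
  by have := ler_norm r; have := mulr_ge0 (le_trans ler01 s1) Je; nra.
exists ((- s) *: e); rewrite /affine_minorant !(dotZl, dotZr) ee mulr1.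
have := ler_norm r; have : 0 <= - s * dot e J by nra.
by nra.
Qed.

(** Slope [0] comes first, since [sup_integral_le] wants the first function to vanish. *)
Definition rat_slope (k : nat) : 'rV[R]_m :=
  if k is k'.+1 then
    if unpickle k' is Some q then map_mx ratr (q : 'rV[rat]_m) else 0
  else 0.

Context {d : measure_display} {T : measurableType d}.
Variables (m0 : (0 < m)%N) (la : {finite_measure set T -> \bar R}).
Variables (D : set T) (mD : measurable D) (w : T -> R) (J : T -> 'rV[R]_m).
Hypothesis iw : la.-integrable setT (EFin \o w).
Hypothesis iJ : forall i, la.-integrable setT (EFin \o (fun x => J x 0 i)).

Let idot b A : measurable A -> la.-integrable A (EFin \o (fun x => dot b (J x))).
Proof.
move=> mA; rewrite (_ : _ \o _ = (fun x => \sum_i ((b 0 i)%:E * (J x 0 i)%:E))%E).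
  apply: integrable_sum => // i _; apply: integrableZl => //; exact: integrableS (iJ i).
by apply/funext => x; rewrite /= sumEFin.
Qed.

Let iminorant b A : measurable A ->
  la.-integrable A (EFin \o (fun x => affine_minorant b (w x) (J x))).
Proof.
move=> mA; rewrite (_ : _ \o _ =
    (EFin \o (fun x => dot b (J x))) \- (fun x => (dot b b / 2)%:E * (w x)%:E))%E//.
apply: integrableB => //; first exact: idot.
by apply: integrableZl => //; exact: integrableS iw.
Qed.

Lemma Rintegral_affine_minorant b A : measurable A ->
  \int[la]_(x in A) affine_minorant b (w x) (J x) =
  affine_minorant b (\int[la]_(x in A) w x) (\row_i \int[la]_(x in A) J x 0 i).
Proof.
move=> mA.
have iwA : la.-integrable A (EFin \o w) by exact: integrableS iw.
rewrite /affine_minorant RintegralB//; last 2 first.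
- exact: idot.
- by rewrite (_ : _ \o _ = fun x => (dot b b / 2)%:E * (w x)%:E)%E//; exact: integrableZl.
rewrite RintegralZl//; congr (_ - _).
apply: EFin_inj; rewrite EFin_Rintegral//; last exact: idot.
rewrite (_ : (fun x => _) = (fun x => \sum_i ((b 0 i)%:E * (J x 0 i)%:E))%E); last first.
  by apply/funext => x; rewrite sumEFin.
have iJA i : la.-integrable A (EFin \o (fun x => J x 0 i)) by exact: integrableS (iJ i).
rewrite (@integral_sum _ _ _ la A mA _ (fun i x => (b 0 i)%:E * (J x 0 i)%:E)%E); last first.
  by move=> i; exact: (integrableZl mA (b 0 i) (iJA i)).
rewrite /dot -sumEFin; apply: eq_bigr => i _.
by rewrite mxE EFinM EFin_Rintegral// (integralZl mA (iJA i)).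
Qed.

(** Integrals of [w] and [J] over disjoint sets suffice, since an affine minorant is
    integrated by inserting these integrals. *)
Lemma integral_A_bulk_leP (c : R) :
  (\int[la]_(x in D) A_bulk (w x) (J x) <= c%:E)%E <->
  forall n (E : nat -> set T) (b : nat -> 'rV[R]_m),
    (forall k, measurable (E k)) -> trivIset setT E ->
    \sum_(k < n) affine_minorant (b k) (\int[la]_(x in E k `&` D) w x)
      (\row_i \int[la]_(x in E k `&` D) J x 0 i) <= c.
Proof.
pose h k x := affine_minorant (rat_slope k) (w x) (J x).
have ih k : la.-integrable setT (EFin \o h k) by exact: iminorant.
have h0 x : h 0%N x = 0 by rewrite /h /affine_minorant /= !dot0l !mul0r subr0.
have h_le k x : ((h k x)%:E <= A_bulk (w x) (J x))%E by exact: A_bulk_ge.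
have h_sup x (r : R) : (r%:E < A_bulk (w x) (J x))%E -> exists k, r < h k x.
  by move=> /(A_bulk_sup m0)[q rq]; exists (pickle q).+1; rewrite /h/= pickleK.
split=> [Ac n E b mE tE|Ec].
  rewrite -lee_fin (le_trans _ Ac)//.
  rewrite (_ : \sum_(k < n) _ = \sum_(k < n) \int[la]_(x in E k `&` D)
      affine_minorant (b k) (w x) (J x)); last first.
    by apply: eq_bigr => k _; rewrite Rintegral_affine_minorant//; exact: measurableI.
  apply: (@integral_ge_partition _ _ _ _ _ (fun k x => affine_minorant (b k) (w x) (J x))) => //.
  - exact: measurable_sup_integrand h_sup.
  - by move=> x; exact: sup_integrand_ge0 h_le x.
  - by move=> k; exact: iminorant.
  - by move=> k x; exact: A_bulk_ge.
apply: (sup_integral_le mD ih h0 h_le h_sup) => n E mE tE.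
rewrite (_ : \sum_(k < n) _ = \sum_(k < n) affine_minorant (rat_slope k)
    (\int[la]_(x in E k `&` D) w x) (\row_i \int[la]_(x in E k `&` D) J x 0 i)).
  exact: Ec.
by apply: eq_bigr => k _; rewrite -Rintegral_affine_minorant//; exact: measurableI.
Qed.

End action_density.

(** * The normal field and the tangential gradient *)

Section normal_field.
Context {R : realType} {d : nat}.
Variables (Omega : set 'rV[R]_d) (hOmega : smooth_bounded_domain Omega).
Implicit Types (x v : 'rV[R]_d).

Let oOmega : open Omega. Proof. by case: hOmega. Qed.

Lemma bdryE x : bdry Omega x <-> closure Omega x /\ ~ Omega x.
Proof. by rewrite /bdry (interior_id _).1. Qed.

Lemma closure_split x : closure Omega x -> Omega x \/ bdry Omega x.
Proof. by move=> cx; have [|] := pselect (Omega x); [left|right; apply/bdryE]. Qed.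

Lemma closed_bdry : closed (bdry Omega).
Proof.
rewrite /bdry setDE; apply: closedI; first exact: closed_closure.
exact/open_closedC/open_interior.
Qed.

Lemma compact_closure_domain : compact (closure Omega).
Proof.
case: hOmega => _ _ _ bO _; apply: bounded_closed_compact; last exact: closed_closure.
have [M [Mr MO]] := bO; exists M; split => // y My z cz.
have cB : closed [set z : 'rV[R]_d | `|z| <= y].
  have /continuous_closedP : continuous (fun z : 'rV[R]_d => `|z|) by exact: norm_continuous.
  by move=> /(_ [set r | r <= y]); apply; exact: closed_le.
have sub : Omega `<=` [set z : 'rV[R]_d | `|z| <= y] by move=> u /(MO _ My).
by rewrite ((closure_id _).1 cB); exact: closure_subset cz.
Qed.

Lemma compact_bdry : compact (bdry Omega).
Proof.
by apply: (subclosed_compact closed_bdry compact_closure_domain) => x [].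
Qed.

Lemma compact_Qbulk : compact (Qbulk Omega).
Proof. by apply: compact_setX; [exact: segment_compact|exact: compact_closure_domain]. Qed.

Lemma compact_Qbdry : compact (Qbdry Omega).
Proof. by apply: compact_setX; [exact: segment_compact|exact: compact_bdry]. Qed.

Lemma closed_setX {T U : topologicalType} (A : set T) (B : set U) :
  closed A -> closed B -> closed (A `*` B).
Proof.
move=> cA cB; rewrite (_ : A `*` B = (fst @^-1` A) `&` (snd @^-1` B)); last first.
  by apply/seteqP; split.
by apply: closedI; [move: (@cvg_fst T U)|move: (@cvg_snd T U)] => c;
  apply: preimage_closed => // x _; exact: c.
Qed.

Lemma closed_Qbulk : closed (Qbulk Omega).
Proof. by apply: closed_setX; [exact: itv_closed|exact: closed_closure]. Qed.

Lemma closed_Qbdry : closed (Qbdry Omega).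
Proof. by apply: closed_setX; [exact: itv_closed|exact: closed_bdry]. Qed.

Lemma continuous_row {T : topologicalType} n (F : T -> 'rV[R]_n) (y : T) :
  (forall i, {for y, continuous (fun z => F z 0 i)}) -> {for y, continuous F}.
Proof.
move=> cF A [P Pn PA].
apply: (@filterS _ (nbhs y) _ _ _ _
  (@filter_forall _ _ (fun i z => P 0 i (F z 0 i)) (nbhs y) _ _)).
  by move=> z Pz; apply: PA => i j; rewrite (ord1 i).
by move=> i; apply: (cF i (P 0 i)); exact: Pn.
Qed.

Section defining_function.
Variables (x : 'rV[R]_d) (U : set 'rV[R]_d) (g : 'rV[R]_d -> R).
Hypothesis Ug : local_defining_function Omega x U g.

Lemma defining_C1 : Ck_on 1 U g. Proof. by case: Ug => _ _ /(_ 1%N). Qed.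

Lemma defining_le0 y : closure Omega y -> U y -> g y <= 0.
Proof.
move=> cy Uy; have [oU _ _ gO _] := Ug.
have cg := Ck_on_continuous defining_C1 Uy.
rewrite leNgt; apply/negP => gy.
have : nbhs y (fun z => U z /\ 0 < g z).
  apply: filterI; first exact: open_nbhs_nbhs.
  by apply: (cg [set r | 0 < r]); apply: open_nbhs_nbhs; split; [exact: open_gt|].
by move=> /cy[z [Oz [Uz gz]]]; have := (gO z Uz).1 Oz; rewrite ltNge ltW.
Qed.

Lemma defining_bdry0 : bdry Omega x -> g x = 0.
Proof.
move=> /bdryE[cx nOx]; have [oU Ux _ gO _] := Ug.
apply/eqP; rewrite eq_le defining_le0//= leNgt; apply/negP => gx.
exact/nOx/gO.
Qed.

Lemma defining_derive v y : U y -> 'D_v g y = dot v (grad g y).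
Proof. by move=> Uy; have [oU _ _ _ _] := Ug; exact: (derive_grad _ oU defining_C1). Qed.

Lemma defining_grad_neq0 : grad g x != 0.
Proof.
have [_ Ux _ _ [v]] := Ug; rewrite defining_derive//; apply: contra => /eqP ->.
by rewrite dot0r.
Qed.

Lemma continuous_defining_grad y : U y -> {for y, continuous (grad g)}.
Proof.
move=> Uy; apply: continuous_row => i.
rewrite (_ : (fun z => _) = (fun z => 'D_('e_i) g z)).
  exact: (Ck_on1_continuous_derive defining_C1 Uy).
by apply/funext => z; rewrite mxE.
Qed.

End defining_function.

Lemma dnbhs0_pos (P : set R) : (\forall h \near (0:R)^', P h) ->
  exists2 h : R, 0 < h & P h.
Proof.
rewrite /dnbhs /within /= => /nbhs_ballP[e /= e0 eP].
exists (e / 2); first exact: divr_gt0.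
apply: eP; last by rewrite gt_eqF// divr_gt0.
rewrite /ball/= sub0r normrN gtr0_norm ?divr_gt0//; lra.
Qed.

(** A short step along [v] enters the domain, by the sign of [g1]; hence [g2] is negative
    there too and cannot have increased. *)
Lemma defining_descent x U1 g1 U2 g2 v : bdry Omega x ->
  local_defining_function Omega x U1 g1 ->
  local_defining_function Omega x U2 g2 ->
  'D_v g1 x < 0 -> 'D_v g2 x <= 0.
Proof.
move=> bx l1 l2 D1; rewrite leNgt; apply/negP => D2.
have [oU1 U1x _ gO1 _] := l1; have [oU2 U2x _ gO2 _] := l2.
have d1 : derivable g1 x v := Ck_on1_derivable (defining_C1 l1) U1x.
have d2 : derivable g2 x v := Ck_on1_derivable (defining_C1 l2) U2x.
have c0 : h *: v + x @[h --> (0:R)^'] --> x.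
  have c : {for (0 : R), continuous (fun h : R => h *: v + x)}.
    by apply: continuousD; [exact: scalel_continuous|exact: cst_continuous].
  have := @cvg_within_filter _ _ _ _ _ _ (fun h : R => h != 0) c.
  by rewrite scale0r add0r; exact.
have n1 : \forall h \near (0:R)^', h^-1 *: (g1 (h *: v + x) - g1 x) < 0.
  exact: (cvgr_lt _ d1).
have n2 : \forall h \near (0:R)^', 0 < h^-1 *: (g2 (h *: v + x) - g2 x).
  exact: (cvgr_gt _ d2).
have nU : \forall h \near (0:R)^', (U1 `&` U2) (h *: v + x).
  apply: (c0 (U1 `&` U2)).
  by apply: open_nbhs_nbhs; split; [exact: openI|].
have [h h0 [[n1h n2h] [hU1 hU2]]] := dnbhs0_pos (filterI (filterI n1 n2) nU).
move: n1h n2h; rewrite (defining_bdry0 l1)// (defining_bdry0 l2)// !subr0.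
rewrite !pmulr_rlt0 ?pmulr_rgt0 ?invr_gt0// => /(gO1 _ hU1)/(gO2 _ hU2) g2h.
by rewrite ltNge ltW.
Qed.

(** Test with [u - e *: a], where [u] is the part of [b] orthogonal to [a]: for small [e] its
    product with [b] is positive unless [u = 0]. *)
Lemma halfspace_collinear (a b : 'rV[R]_d) : a != 0 ->
  (forall v, dot v a < 0 -> dot v b <= 0) -> exists2 c : R, 0 <= c & b = c *: a.
Proof.
move=> a0 ab.
have aa : 0 < dot a a by rewrite dot_gt0.
pose c := dot a b / dot a a.
pose u := b - c *: a.
have ua : dot u a = 0.
  by rewrite /u dotBl dotZl /c divfK ?gt_eqF// (dotC b) subrr.
have ub : dot u b = dot u u by rewrite {3}/u dotBr dotZr ua mulr0 subr0.
have uu : dot u u = 0.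
  apply/eqP; rewrite eq_le dot_ge0 andbT leNgt; apply/negP => u0.
  pose e := dot u u / (2 * (`|dot a b| + 1)).
  have e0 : 0 < e by rewrite divr_gt0// mulr_gt0// ltr_wpDl.
  have := ab (u - e *: a).
  rewrite (dotBl u (e *: a) a) (dotBl u (e *: a) b) !dotZl ua ub sub0r oppr_lt0 mulr_gt0// => /(_ isT).
  apply/negP; rewrite -ltNge subr_gt0.
  have eE : e * (2 * (`|dot a b| + 1)) = dot u u by rewrite /e divfK// gt_eqF// mulr_gt0// ltr_wpDl.
  have := ler_norm (dot a b); have := normr_ge0 (dot a b); nra.
have bc : b = c *: a by apply/eqP; rewrite -subr_eq0 -dot_eq0; exact/eqP.
exists c => //; have := ab (- a).
by rewrite !dotNl oppr_lt0 aa => /(_ isT); rewrite oppr_le0 /c => ?; exact: divr_ge0 (ltW aa).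
Qed.

Definition unit_vector (a : 'rV[R]_d) := (Num.sqrt (dot a a))^-1 *: a.

Lemma unit_vector_dot a : a != 0 -> dot (unit_vector a) (unit_vector a) = 1.
Proof.
rewrite -dot_gt0 => a0; rewrite dotZl dotZr mulrA -invfM -expr2 sqr_sqrtr ?ltW//.
by rewrite mulVf// gt_eqF.
Qed.

Lemma unit_vectorZ (c : R) a : 0 < c -> unit_vector (c *: a) = unit_vector a.
Proof.
move=> c0; rewrite /unit_vector dotZl dotZr mulrA -expr2 sqrtrM ?sqr_ge0//.
rewrite sqrtr_sqr gtr0_norm// scalerA invfM mulrAC mulVf ?mul1r//.
by rewrite gt_eqF.
Qed.

(** The outward unit normal; by [normalE] every defining function yields the same one. *)
Definition normal x : 'rV[R]_d :=
  get [set n | exists U g, local_defining_function Omega x U g /\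
                           n = unit_vector (grad g x)].

Lemma normalE x U g : bdry Omega x -> local_defining_function Omega x U g ->
  normal x = unit_vector (grad g x).
Proof.
move=> bx l; rewrite /normal; set P := (X in get X).
have [U' [g' [l' ->]]] : P (get P) by apply: getPex; exists (unit_vector (grad g x)), U, g.
have [_ Ux _ _ _] := l; have [_ Ux' _ _ _] := l'.
have [|c c0 E] := @halfspace_collinear _ (grad g' x) (defining_grad_neq0 l).
  move=> v; rewrite -(defining_derive l)// -(defining_derive l')//.
  exact: (defining_descent bx l l').
rewrite E unit_vectorZ// lt_neqAle c0 andbT eq_sym.
by apply: contraNneq (defining_grad_neq0 l') => c_eq0; rewrite E c_eq0 scale0r.
Qed.

Lemma bdry_defining x : bdry Omega x -> exists U g, local_defining_function Omega x U g.
Proof. by case: hOmega => _ _ _ _; exact. Qed.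

Lemma normal_dot x : bdry Omega x -> dot (normal x) (normal x) = 1.
Proof.
move=> bx; have [U [g l]] := bdry_defining bx.
by rewrite (normalE bx l) unit_vector_dot//; exact: defining_grad_neq0 l.
Qed.

Lemma tangentP x v : bdry Omega x -> tangent Omega x v <-> dot v (normal x) = 0.
Proof.
move=> bx.
have key U g : local_defining_function Omega x U g ->
    ('D_v g x = 0 <-> dot v (normal x) = 0).
  move=> l; have [_ Ux _ _ _] := l.
  rewrite (normalE bx l) (defining_derive l)// dotZr; split => [->|/eqP].
    by rewrite mulr0.
  rewrite mulf_eq0 invr_eq0 sqrtr_eq0 leNgt dot_gt0 (defining_grad_neq0 l)/=.
  by move/eqP.
split=> [[U [g [l /(key _ _ l)]]]//|vn].
by have [U [g l]] := bdry_defining bx; exists U, g; split=> //; exact/(key _ _ l).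
Qed.

Lemma normal_coord_le1 x i : bdry Omega x -> `|normal x 0 i| <= 1.
Proof.
move=> /normal_dot n1; rewrite -(@ler_sqr _ `|_|) ?nnegrE// expr1n real_normK ?num_real//.
rewrite -n1 /dot (bigD1 i)//= -expr2 lerDl; apply: sumr_ge0 => j _.
by rewrite -expr2 sqr_ge0.
Qed.

Lemma continuous_unit_vector (a : 'rV[R]_d) i : a != 0 ->
  {for a, continuous (fun b => unit_vector b 0 i)}.
Proof.
move=> a0.
have ci (b : 'rV[R]_d) : {for b, continuous (fun b : 'rV[R]_d => b)} by exact: cvg_id.
rewrite (_ : (fun b => _) = (fun b => (Num.sqrt (dot b b))^-1 * b 0 i)); last first.
  by apply/funext => b; rewrite mxE.
apply: (@continuousM _ _ (fun b => (Num.sqrt (dot b b))^-1) (fun b => b 0 i)).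
  apply: continuousV; first by rewrite gt_eqF// sqrtr_gt0 dot_gt0.
  apply: (@continuous_comp _ _ _ (fun b => dot b b) Num.sqrt); last exact: sqrt_continuous.
  exact: continuous_dot.
exact: continuous_coord.
Qed.

(** Near a boundary point one defining function serves for all boundary points, and its
    gradient is continuous. *)
Lemma continuous_normal i : {within bdry Omega, continuous (fun x => normal x 0 i)}.
Proof.
apply/subspace_continuousP => x bx.
have [U [g l]] := bdry_defining bx.
have [oU Ux gs gO _] := l.
have g0 := defining_grad_neq0 l.
have cgrad := continuous_defining_grad l.
rewrite /from_subspace (normalE bx l).
have nE : \forall y \near within (bdry Omega) (nbhs x),
    unit_vector (grad g y) 0 i = normal y 0 i.
  have : \forall y \near x, U y /\ 0 < dot (grad g y) (grad g y).
    apply: filterI; first exact: open_nbhs_nbhs.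
    have := continuous_dot (cgrad x Ux) (cgrad x Ux).
    move=> /(_ [set r | 0 < r]); apply.
    by apply: open_nbhs_nbhs; split; [exact: open_gt|rewrite /= dot_gt0].
  rewrite /within /=; apply: filterS => y [Uy gy] by_.
  rewrite (@normalE y U g)//; split => //.
  by exists (grad g y); rewrite (defining_derive l)// gt_eqF.
apply: (cvg_trans (near_eq_cvg nE)).
apply: cvg_within_filter.
apply: (@continuous_comp _ _ _ (grad g) (fun b => unit_vector b 0 i)).
  exact: cgrad.
exact: continuous_unit_vector.
Qed.

(** The tangential gradient is the orthogonal projection of the gradient.  This makes it a
    bounded Borel function along the boundary, which the choice in its definition does
    not show. *)
Lemma tgradE (f : 'rV[R]_d -> R) x : bdry Omega x ->
  (forall w, 'D_w f x = dot w (grad f x)) ->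
  tgrad Omega f x = grad f x - dot (grad f x) (normal x) *: normal x.
Proof.
move=> bx fD; set v := (X in _ = X).
have vP : tangent Omega x v /\ forall w, tangent Omega x w -> dot v w = 'D_w f x.
  split; first by apply/tangentP => //; rewrite /v dotBl dotZl normal_dot// mulr1 subrr.
  move=> w /(tangentP _ bx) wn.
  by rewrite fD /v dotBl dotZl (dotC (normal x) w) wn mulr0 subr0 dotC.
rewrite /tgrad; set P := (X in get X); set u := get P.
have [tu uf] : P u by apply: getPex; exists v.
apply/eqP; rewrite -subr_eq0 -dot_eq0; apply/eqP.
have tuv : tangent Omega x (u - v).
  apply/tangentP => //; rewrite dotBl (tangentP _ bx).1// (tangentP _ bx).1 ?subrr//.
  by case: vP.
by rewrite dotBl uf// vP.2// subrr.
Qed.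

End normal_field.

(** * Action and tangentiality in terms of values on sets *)

Section densities.
Context {disp : measure_display} {T : measurableType disp} {R : realType}.
Variables (nu : {charge set T -> \bar R}) (la : {finite_measure set T -> \bar R}).
Hypothesis nula : nu `<< la.

Let densityE : EFin \o density nu la = 'd nu '/d la.
Proof. by apply/funext => x; rewrite /density/= fineK//; exact: Radon_Nikodym_fin_num. Qed.

Lemma density_integrable : la.-integrable setT (EFin \o density nu la).
Proof. by rewrite densityE; exact: Radon_Nikodym_integrable. Qed.

Lemma density_integral A : measurable A ->
  nu A = (\int[la]_(x in A) (density nu la x)%:E)%E.
Proof. by move=> mA; rewrite (Radon_Nikodym_integral nula mA) -densityE. Qed.

Lemma density_Rintegral A : measurable A ->
  \int[la]_(x in A) density nu la x = fine (nu A).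
Proof. by move=> mA; rewrite density_integral. Qed.

End densities.

Lemma concentrated_onI {disp : measure_display} {T : measurableType disp} {R : realType}
    (nu : {charge set T -> \bar R}) (K A : set T) :
  measurable K -> measurable A -> concentrated_on nu K -> nu (A `&` K) = nu A.
Proof.
move=> mK mA cK; rewrite -[in RHS](setUIDK A K) chargeU; first last.
- by rewrite setDE setIACA setICr setI0.
- exact: measurableD.
- exact: measurableI.
rewrite [X in (_ + X)%E]cK ?adde0//; first exact: measurableD.
by rewrite setDE -setIA setICl setI0.
Qed.

Section row_vectors.
Context {R : realType} {d : nat}.

Lemma dot_row_mx (u v : 'rV[R]_d) (a b : R) :
  dot (row_mx u (const_mx a : 'rV_1)) (row_mx v (const_mx b)) = dot u v + a * b.
Proof.
rewrite /dot big_split_ord/= big_ord1 !row_mxEr !mxE; congr (_ + _).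
by apply: eq_bigr => i _; rewrite !row_mxEl.
Qed.

(** The boundary density is the bulk density in one more dimension, with [kappa * h] as the
    additional momentum; the results on [A_bulk] thus cover both. *)
Lemma A_bdryE (kappa g : R) (J : 'rV[R]_d) (h : R) : kappa != 0 ->
  A_bdry kappa g J h = A_bulk g (row_mx J (const_mx (kappa * h) : 'rV_1)).
Proof.
move=> k0; rewrite /A_bdry /A_bulk dot_row_mx -expr2 exprMn.
case: ifP => // _; congr (if _ then _ else _); congr (_ && _).
rewrite row_mx_eq0; congr (_ && _).
apply/eqP/eqP => [->|/rowP/(_ 0)]; first by rewrite mulr0; apply/rowP => i; rewrite !mxE.
by rewrite !mxE => /eqP; rewrite mulf_eq0 (negbTE k0)/= => /eqP.
Qed.

End row_vectors.

Section evolutions.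
Context {R : realType} {d : nat}.
Variables (hd : (0 < d)%N) (Omega : set 'rV[R]_d).
Hypothesis hOmega : smooth_bounded_domain Omega.
Variables (kappa : R) (hkappa : 0 < kappa).
Implicit Types (mu : @evolution R d).

Lemma measurable_Qbulk : measurable (Qbulk Omega : set (spacetime R d)).
Proof. exact: (@spacetime_closed_measurable R d _ (@closed_Qbulk R d Omega)). Qed.

Lemma measurable_Qbdry : measurable (Qbdry Omega : set (spacetime R d)).
Proof. exact: (@spacetime_closed_measurable R d _ (@closed_Qbdry R d Omega)). Qed.

(** These bounds mention neither densities nor reference measures.  They are what makes the
    action easy to follow through sums, rescalings and images of evolutions. *)
Definition bulk_action_le mu (c : R) := forall n (E : nat -> set (spacetime R d))
    (b : nat -> 'rV[R]_d),
  (forall k, measurable (E k)) -> trivIset setT E ->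
  \sum_(k < n) affine_minorant (b k) (fine (evo_omega mu (E k)))
    (\row_i fine (evo_F mu i (E k))) <= c.

Definition bdry_action_le mu (c : R) := forall n (E : nat -> set (spacetime R d))
    (b : nat -> 'rV[R]_d) (a : nat -> R),
  (forall k, measurable (E k)) -> trivIset setT E ->
  \sum_(k < n) (affine_minorant (b k) (fine (evo_gamma mu (E k)))
    (\row_i fine (evo_G mu i (E k))) +
    (kappa * a k * fine (evo_f mu (E k)) - a k ^+ 2 / 2 * fine (evo_gamma mu (E k)))) <= c.

Lemma In_map_enum (I : finType) (T : Type) (f : I -> T) i : List.In (f i) [seq f j | j <- enum I].
Proof.
have : i \in enum I by rewrite mem_enum.
elim: (enum I) => //= j s ih; rewrite inE => /orP[/eqP ->|/ih]; first by left.
by right.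
Qed.

Lemma bulk_action_leP mu (c : R) : admissible Omega mu ->
  let la := variations (evo_omega mu :: [seq evo_F mu i | i <- enum 'I_d]) in
  (\int[la]_(p in Qbulk Omega)
      A_bulk (density (evo_omega mu) la p) (vdensity (evo_F mu) la p) <= c%:E)%E <->
  bulk_action_le mu c.
Proof.
move=> [co cF _ _ _] la.
have do_ : evo_omega mu `<< la by apply: variations_dominates; left.
have dF i : evo_F mu i `<< la by apply: variations_dominates; right; exact: In_map_enum.
rewrite (@integral_A_bulk_leP _ _ _ _ hd la _ measurable_Qbulk); last 2 first.
- exact: density_integrable.
- move=> i; rewrite (_ : _ \o _ = EFin \o density (evo_F mu i) la).
    exact: density_integrable.
  by apply/funext => x; rewrite /= mxE.
have E (A : set (spacetime R d)) : measurable A ->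
    \int[la]_(x in A `&` Qbulk Omega) density (evo_omega mu) la x = fine (evo_omega mu A).
  move=> mA; rewrite density_Rintegral//; last by apply: measurableI => //; exact: measurable_Qbulk.
  by rewrite concentrated_onI//; exact: measurable_Qbulk.
have EF i (A : set (spacetime R d)) : measurable A ->
    \int[la]_(x in A `&` Qbulk Omega) vdensity (evo_F mu) la x 0 i = fine (evo_F mu i A).
  move=> mA; under eq_Rintegral do rewrite mxE.
  rewrite density_Rintegral//; last by apply: measurableI => //; exact: measurable_Qbulk.
  by rewrite concentrated_onI//; exact: measurable_Qbulk.
have S n (F : nat -> set (spacetime R d)) (b : nat -> 'rV[R]_d) : (forall k, measurable (F k)) ->
   \sum_(k < n) affine_minorant (b k)
      (\int[la]_(x in F k `&` Qbulk Omega) density (evo_omega mu) la x)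
      (\row_i \int[la]_(x in F k `&` Qbulk Omega) vdensity (evo_F mu) la x 0 i) =
   \sum_(k < n) affine_minorant (b k) (fine (evo_omega mu (F k)))
      (\row_i fine (evo_F mu i (F k))).
  move=> mF; apply: eq_bigr => k _; rewrite E//; congr affine_minorant.
  by apply/rowP => i; rewrite !mxE EF.
split=> H n F b mF tF; first by rewrite -S//; exact: H.
by rewrite S//; exact: H.
Qed.

Lemma bdry_action_leP mu (c : R) : admissible Omega mu ->
  let la := variations [:: evo_gamma mu, evo_f mu & [seq evo_G mu i | i <- enum 'I_d]] in
  (\int[la]_(p in Qbdry Omega)
      A_bdry kappa (density (evo_gamma mu) la p) (vdensity (evo_G mu) la p)
        (density (evo_f mu) la p) <= c%:E)%E <->
  bdry_action_le mu c.
Proof.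
move=> [_ _ cg [cG _] cf] la.
have dg : evo_gamma mu `<< la by apply: variations_dominates; left.
have df : evo_f mu `<< la by apply: variations_dominates; right; left.
have dG i : evo_G mu i `<< la.
  by apply: variations_dominates; do 2 right; exact: In_map_enum.
pose J p : 'rV[R]_(d + 1) := row_mx (vdensity (evo_G mu) la p)
  (const_mx (kappa * density (evo_f mu) la p) : 'rV_1).
rewrite (_ : (\int[la]_(p in _) _)%E = (\int[la]_(p in Qbdry Omega)
    A_bulk (density (evo_gamma mu) la p) (J p))%E); last first.
  by apply: eq_integral => p _; rewrite A_bdryE ?gt_eqF.
have Jl i p : J p 0 (lshift 1 i) = density (evo_G mu i) la p by rewrite row_mxEl mxE.
have Jr p : J p 0 (rshift d 0) = kappa * density (evo_f mu) la p by rewrite row_mxEr mxE.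
rewrite (@integral_A_bulk_leP _ _ _ _ _ la _ measurable_Qbdry); last 3 first.
- by rewrite addn1.
- exact: density_integrable.
- move=> i; case: (split_ordP i) => j ->.
    rewrite (_ : _ \o _ = EFin \o density (evo_G mu j) la).
      exact: density_integrable.
    by apply/funext => x; rewrite /= Jl.
  rewrite (_ : _ \o _ = (fun x => kappa%:E * (EFin \o density (evo_f mu) la) x)%E).
    by apply: integrableZl => //; exact: density_integrable.
  by apply/funext => x; rewrite (ord1 j) /= Jr.
have E (nu : {charge set (spacetime R d) -> \bar R}) (A : set (spacetime R d)) : nu `<< la ->
    concentrated_on nu (Qbdry Omega) -> measurable A ->
    \int[la]_(x in A `&` Qbdry Omega) density nu la x = fine (nu A).
  move=> dn cn mA; rewrite density_Rintegral//; last by apply: measurableI => //; exact: measurable_Qbdry.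
  by rewrite concentrated_onI//; exact: measurable_Qbdry.
have EJ (A : set (spacetime R d)) : measurable A ->
    (\row_i \int[la]_(x in A `&` Qbdry Omega) J x 0 i) =
    row_mx (\row_i fine (evo_G mu i A)) (const_mx (kappa * fine (evo_f mu A)) : 'rV_1).
  move=> mA; have mAQ : measurable (A `&` Qbdry Omega) by apply: measurableI => //; exact: measurable_Qbdry.
  apply/rowP => i; rewrite mxE; case: (split_ordP i) => j ->.
    by rewrite row_mxEl mxE; under eq_Rintegral do rewrite Jl; rewrite E.
  rewrite (ord1 j) row_mxEr mxE; under eq_Rintegral do rewrite Jr.
  rewrite RintegralZl ?E//; apply: integrableS (density_integrable df) => //.
have S (b : 'rV[R]_d) (a : R) (A : set (spacetime R d)) : measurable A ->
   affine_minorant (row_mx b (const_mx a : 'rV_1))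
      (\int[la]_(x in A `&` Qbdry Omega) density (evo_gamma mu) la x)
      (\row_i \int[la]_(x in A `&` Qbdry Omega) J x 0 i) =
   affine_minorant b (fine (evo_gamma mu A)) (\row_i fine (evo_G mu i A)) +
     (kappa * a * fine (evo_f mu A) - a ^+ 2 / 2 * fine (evo_gamma mu A)).
  by move=> mA; rewrite E// EJ// /affine_minorant !dot_row_mx; ring.
split=> H n F b.
  move=> a mF tF; have := H n F (fun k => row_mx (b k) (const_mx (a k) : 'rV_1)) mF tF.
  by under eq_bigr => k _ do rewrite S//.
move=> mF tF; have := H n F (lsubmx \o b) (fun k => b k 0 (rshift d 0)) mF tF.
under eq_bigr => k _ do rewrite -S//.
rewrite (_ : \sum_(k < n) _ = \sum_(k < n) affine_minorant (b k)
    (\int[la]_(x in F k `&` Qbdry Omega) density (evo_gamma mu) la x)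
      (\row_i \int[la]_(x in F k `&` Qbdry Omega) J x 0 i))//.
apply: eq_bigr => k _; congr affine_minorant.
rewrite -[RHS](hsubmxK (b k)); congr row_mx.
by apply/rowP => i; rewrite !mxE (ord1 i).
Qed.

Lemma A_bulk_ge0 (w : R) (J : 'rV[R]_d) : (0 <= A_bulk w J)%E.
Proof.
rewrite /A_bulk; case: ifP => w0; last by case: ifP.
by rewrite lee_fin divr_ge0 ?dot_ge0// mulr_ge0// ltW.
Qed.

Lemma A_bdry_ge0 (g : R) (J : 'rV[R]_d) h : (0 <= A_bdry kappa g J h)%E.
Proof.
rewrite /A_bdry; case: ifP => w0; last by case: ifP.
rewrite lee_fin; apply: divr_ge0; last by rewrite mulr_ge0// ltW.
by rewrite addr_ge0 ?dot_ge0// mulr_ge0 ?sqr_ge0.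
Qed.

Lemma action_ge0 mu : (0 <= action Omega kappa mu)%E.
Proof.
by apply: adde_ge0; apply: integral_ge0 => p _; [exact: A_bulk_ge0|exact: A_bdry_ge0].
Qed.

Lemma action_leP mu (c : R) : admissible Omega mu ->
  (action Omega kappa mu <= c%:E)%E <->
  exists c1 c2 : R, [/\ bulk_action_le mu c1, bdry_action_le mu c2 & c1 + c2 <= c].
Proof.
move=> adm; rewrite /action; set I1 := (X in (X + _)%E); set I2 := (X in (_ + X)%E).
have I10 : (0 <= I1)%E by apply: integral_ge0 => p _; exact: A_bulk_ge0.
have I20 : (0 <= I2)%E by apply: integral_ge0 => p _; exact: A_bdry_ge0.
split=> [Ic|[c1 [c2 [/(bulk_action_leP _ adm) b1 /(bdry_action_leP _ adm) b2 cc]]]].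
  have I1f : I1 \is a fin_num.
    rewrite ge0_fin_numE// (le_lt_trans _ (ltry c))//.
    by apply: le_trans Ic; rewrite leeDl.
  have I2f : I2 \is a fin_num.
    rewrite ge0_fin_numE// (le_lt_trans _ (ltry c))//.
    by apply: le_trans Ic; rewrite leeDr.
  exists (fine I1), (fine I2); split.
  - by apply/(bulk_action_leP _ adm); rewrite fineK.
  - by apply/(bdry_action_leP _ adm); rewrite fineK.
  - by rewrite -lee_fin EFinD !fineK.
by rewrite (le_trans (leeD b1 b2))// -EFinD lee_fin.
Qed.

(** Extended by zero off the boundary, where the normal is not determined. *)
Definition normal_coord i (p : R * 'rV[R]_d) : R :=
  ((fun q => normal Omega q.2 0 i) \_ (Qbdry Omega)) p.

Lemma bmeas_normal_coord i : bmeas (normal_coord i : spacetime R d -> R).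
Proof.
apply: (@bmeas_restrict _ (spacetime R d) _ _ _ 1); first exact: measurable_Qbdry.
  apply: (within_continuous_borel_real (D := Qbdry Omega)); first exact: closed_Qbdry.
  apply/subspace_continuousP => -[t x] [/= t01 bx].
  have /subspace_continuousP/(_ x bx) := @continuous_normal _ _ _ hOmega i.
  move=> cn A /cn; rewrite /from_subspace /= /within /=.
  have c : {for (t, x), continuous (snd : R * 'rV[R]_d -> 'rV[R]_d)} by exact: cvg_snd.
  move=> nA.
  have c2 : nbhs (t, x) [set q : R * 'rV[R]_d | bdry Omega q.2 -> A (normal Omega q.2 0 i)].
    exact: (c _ nA).
  by apply: (@filterS _ (nbhs (t, x)) _ _ _ _ c2) => -[s y] yA [_ by_]; exact: yA.
by move=> [t x] [_ bx]; exact: normal_coord_le1.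
Qed.

(** Tangentiality, which is stated with densities, says that the normal component of the
    vector measure vanishes.  In this form it passes to sums and images. *)
Lemma tangentialP (nu : 'I_d -> {charge set (spacetime R d) -> \bar R}) :
  tangential Omega nu <-> forall E : set (spacetime R d), measurable E ->
    \sum_i cint (nu i) (fun p => \1_E p * normal_coord i p) = 0.
Proof.
rewrite /tangential; set la := variations _.
have dn i : nu i `<< la by apply: variations_dominates; exact: In_map_enum.
pose h (p : spacetime R d) := \sum_i normal_coord i p * density (nu i) la p.
have ihi i : la.-integrable setT (EFin \o (fun p => normal_coord i p * density (nu i) la p)).
  by apply: integrable_bmeasM; [exact: bmeas_normal_coord|exact: density_integrable].
have ih : la.-integrable setT (EFin \o h).
  rewrite (_ : _ \o _ = (fun p => \sum_i (normal_coord i p * density (nu i) la p)%:E)%E).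
    by apply: integrable_sum => // i _; exact: ihi.
  by apply/funext => p; rewrite /= sumEFin.
have hE p : Qbdry Omega p -> h p = dot (vdensity nu la p) (normal Omega p.2).
  move=> Qp; apply: eq_bigr => i _; rewrite mxE mulrC; congr (_ * _).
  by rewrite /normal_coord patchE mem_set.
have h0 p : ~ Qbdry Omega p -> h p = 0.
  move=> Qp; apply: big1 => i _.
  by rewrite /normal_coord patchE memNset// mul0r.
have SE (E : set (spacetime R d)) : measurable E -> \sum_i cint (nu i) (fun p => \1_E p * normal_coord i p) =
    \int[la]_(p in E) h p.
  move=> mE; apply: EFin_inj; rewrite EFin_Rintegral//; last exact: integrableS ih.
  rewrite (_ : (fun p => (h p)%:E) =
      (fun p => \sum_i (normal_coord i p * density (nu i) la p)%:E)%E); last first.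
    by apply/funext => p; rewrite sumEFin.
  rewrite (@integral_sum _ _ _ la E mE _
    (fun i p => (normal_coord i p * density (nu i) la p)%:E)); last first.
    by move=> i; exact: integrableS (ihi i).
  rewrite -sumEFin; apply: eq_bigr => i _.
  rewrite -EFin_Rintegral//; last exact: integrableS (ihi i).
  rewrite (@cint_density _ _ _ (nu i) la (density (nu i) la)); last 3 first.
  - exact: density_integrable.
  - exact: density_integral.
  - by apply: bmeasM; [exact: bmeas_indic|exact: bmeas_normal_coord].
  congr (_%:E); rewrite -[RHS](Rintegral_indic la)//.
  by apply: eq_Rintegral => p _; rewrite mulrA.
have tanE : {ae la, forall p : spacetime R d, Qbdry Omega p ->
      tangent Omega p.2 (vdensity nu la p)} <-> {ae la, forall p, h p = 0}.
  split; apply: filterS => p.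
    move=> tp; have [Qp|] := pselect (Qbdry Omega p); last exact: h0.
    by rewrite hE//; apply/tangentP; [exact: hOmega|case: Qp|exact: tp].
  move=> hp Qp; apply/tangentP; [exact: hOmega|by case: Qp|].
  by rewrite -hE.
rewrite tanE; split=> [ae0 E mE|E0].
  rewrite SE// /Rintegral (ae_eq_integral (cst 0%E)) ?integral0//.
  - by apply: measurable_funTS; exact: (measurable_int la).
  - by apply: filterS ae0 => p -> .
have : ae_eq la setT (EFin \o h) (cst 0%E).
  apply: integral_ae_eq => // E _ mE.
  by rewrite integral0 -EFin_Rintegral//; [rewrite -SE// E0|exact: integrableS ih].
by apply: filterS => p /(_ I) [].
Qed.

End evolutions.

Section charge_operations.
Context {d1 d2 : measure_display} {T1 : measurableType d1}
  {T2 : measurableType d2} {R : realType}.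
Variables (nu : {charge set T1 -> \bar R}) (S : T1 -> T2).
Hypothesis mS : measurable_fun setT S.

Definition cpush : {charge set T2 -> \bar R}.
Proof. by refine (pushforward nu S). Defined.

Lemma cpushE A : cpush A = nu (S @^-1` A). Proof. by []. Qed.

Lemma cint_cpush (f : T2 -> R) : bmeas f -> cint cpush f = cint nu (fun x => f (S x)).
Proof. by move=> bf; apply: cint_pushforward. Qed.

End charge_operations.

Section induced.
Context {d1 d2 : measure_display} {T1 : measurableType d1}
  {T2 : measurableType d2} {R : realType}.
Variables (m : {finite_measure set T1 -> \bar R}) (h : T1 -> R) (S : T1 -> T2).
Hypotheses (bh : bmeas h) (mS : measurable_fun setT S).

(** All explicit evolutions below consist of such charges. *)
Definition cdensity : {charge set T2 -> \bar R} :=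
  cpush (induced_charge (bmeas_integrable m bh)) mS.

Lemma cint_cdensity (f : T2 -> R) : bmeas f ->
  cint cdensity f = \int[m]_x (f (S x) * h x).
Proof.
move=> bf; rewrite cint_cpush//.
rewrite (@cint_density _ _ _ (induced_charge (bmeas_integrable m bh)) m h)//.
  exact: bmeas_integrable.
exact: bmeas_comp.
Qed.

Lemma cdensity_concentrated (K : set T2) : measurable K ->
  (forall x, ~ K (S x) -> h x = 0) -> concentrated_on cdensity K.
Proof.
move=> mK hK A mA AK; rewrite /cdensity cpushE /induced_charge.
apply: integral0_eq => x /= Ax; rewrite hK// => Kx.
have : (A `&` K) (S x) by [].
by rewrite AK.
Qed.

End induced.

(** * Evolutions between endpoints: superposition and change of time *)

Section paths.
Context {R : realType} {d : nat}.
Variables (Omega : set 'rV[R]_d).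
Hypothesis hOmega : smooth_bounded_domain Omega.
Variables (kappa : R).
Implicit Types (mu : @evolution R d) (phi psi : R * 'rV[R]_d -> R).

Definition on_bulk (f : R * 'rV[R]_d -> R) : spacetime R d -> R := f \_ (Qbulk Omega).
Definition on_bdry (f : R * 'rV[R]_d -> R) : spacetime R d -> R := f \_ (Qbdry Omega).

Lemma on_bulkE f p : Qbulk Omega p -> on_bulk f p = f p.
Proof. by move=> Qp; rewrite /on_bulk patchE mem_set. Qed.

Lemma on_bdryE f p : Qbdry Omega p -> on_bdry f p = f p.
Proof. by move=> Qp; rewrite /on_bdry patchE mem_set. Qed.

Lemma continuous_compact_bounded {V : topologicalType} (f : V -> R) (K : set V) :
  continuous f -> compact K -> exists M, forall x, K x -> `|f x| <= M.
Proof.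
move=> cf cK; have [->|/set0P K0] := eqVneq K set0; first by exists 0.
have [|c _ cM] := @compact_EVT_max V R (fun x => `|f x|) K K0 cK.
  apply: continuous_subspaceT => x.
  by apply: (@continuous_comp _ _ _ f (fun r => `|r|)); [exact: cf|exact: norm_continuous].
by exists `|f c| => x Kx; apply: cM; exact: mem_set.
Qed.

Lemma bmeas_on_bulk f : continuous f -> bmeas (on_bulk f).
Proof.
move=> cf; have [M fM] := continuous_compact_bounded cf (compact_Qbulk hOmega).
apply: (bmeas_restrict (measurable_Qbulk Omega) _ fM).
by apply: measurable_funTS; exact: continuous_borel_real.
Qed.

Lemma bmeas_on_bdry f : continuous f -> bmeas (on_bdry f).
Proof.
move=> cf; have [M fM] := continuous_compact_bounded cf (compact_Qbdry hOmega).
apply: (bmeas_restrict (measurable_Qbdry Omega) _ fM).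
by apply: measurable_funTS; exact: continuous_borel_real.
Qed.

Definition grad_coord phi i (p : R * 'rV[R]_d) : R :=
  grad (fun x => phi (p.1, x)) p.2 0 i.
Definition tgrad_coord phi i (p : R * 'rV[R]_d) : R :=
  tgrad Omega (fun x => phi (p.1, x)) p.2 0 i.

(** In coordinates that are visibly measurable. *)
Lemma on_bdry_tgradE psi i p : C1 psi ->
  on_bdry (tgrad_coord psi i) p = on_bdry (grad_coord psi i) p -
    (\sum_j on_bdry (grad_coord psi j) p * normal_coord Omega j p) * normal_coord Omega i p.
Proof.
move=> c1; have [Qp|nQp] := pselect (Qbdry Omega p); last first.
  by rewrite /on_bdry /normal_coord !patchE memNset// mulr0 subr0.
rewrite !on_bdryE// /tgrad_coord tgradE//; last 2 first.
- by case: Qp.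
- by move=> w; apply: (derive_grad _ openT) => //; exact: C1_slice.
rewrite mxE [in RHS]/normal_coord patchE mem_set// !mxE; congr (_ - _ * _).
  by rewrite /grad_coord mxE.
by apply: eq_bigr => j _; rewrite on_bdryE// /normal_coord patchE mem_set.
Qed.

Lemma bmeas_on_bdry_grad psi i : C1 psi -> bmeas (on_bdry (grad_coord psi i)).
Proof. by move=> c1; apply: bmeas_on_bdry; exact: C1_continuous_grad. Qed.

Lemma bmeas_on_bdry_tgrad psi i : C1 psi -> bmeas (on_bdry (tgrad_coord psi i)).
Proof.
move=> c1; rewrite (_ : on_bdry _ = fun p => on_bdry (grad_coord psi i) p -
    (\sum_j on_bdry (grad_coord psi j) p * normal_coord Omega j p) * normal_coord Omega i p).
  apply: bmeasB; first exact: bmeas_on_bdry_grad.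
  apply: bmeasM; last exact: bmeas_normal_coord.
  by apply: bmeas_sum => j _; apply: bmeasM;
    [exact: bmeas_on_bdry_grad|exact: bmeas_normal_coord].
by apply/funext => p; exact: on_bdry_tgradE.
Qed.

Lemma C1_continuous phi : C1 phi -> continuous phi.
Proof. by case/C1P. Qed.

Lemma bmeas_on_bulk_grad phi i : C1 phi -> bmeas (on_bulk (grad_coord phi i)).
Proof. by move=> c1; apply: bmeas_on_bulk; exact: C1_continuous_grad. Qed.

Definition bulk_lhs mu phi : R :=
  cint (evo_omega mu) (on_bulk (partial_t phi))
  + \sum_i cint (evo_F mu i) (on_bulk (grad_coord phi i))
  - cint (evo_f mu) (on_bdry phi).

Definition bdry_lhs mu psi : R :=
  cint (evo_gamma mu) (on_bdry (partial_t psi))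
  + \sum_i cint (evo_G mu i) (on_bdry (tgrad_coord psi i))
  + cint (evo_f mu) (on_bdry psi).

Lemma bulk_lhsE mu phi : bulk_lhs mu phi =
  cintegral (evo_omega mu) (Qbulk Omega) (partial_t phi)
    + vintegral (evo_F mu) (Qbulk Omega) (fun p => grad (fun x => phi (p.1, x)) p.2)
    - cintegral (evo_f mu) (Qbdry Omega) phi.
Proof.
rewrite /bulk_lhs /vintegral !cintegralE; congr (_ + _ - _).
by apply: eq_bigr => i _; rewrite cintegralE.
Qed.

Lemma bdry_lhsE mu psi : bdry_lhs mu psi =
  cintegral (evo_gamma mu) (Qbdry Omega) (partial_t psi)
    + vintegral (evo_G mu) (Qbdry Omega)
        (fun p => tgrad Omega (fun x => psi (p.1, x)) p.2)
    + cintegral (evo_f mu) (Qbdry Omega) psi.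
Proof.
rewrite /bdry_lhs /vintegral !cintegralE; congr (_ + _ + _).
by apply: eq_bigr => i _; rewrite cintegralE.
Qed.

Definition evo_add mu1 mu2 := {|
  evo_omega := cadd (evo_omega mu1) (evo_omega mu2);
  evo_F := fun i => cadd (evo_F mu1 i) (evo_F mu2 i);
  evo_gamma := cadd (evo_gamma mu1) (evo_gamma mu2);
  evo_G := fun i => cadd (evo_G mu1 i) (evo_G mu2 i);
  evo_f := cadd (evo_f mu1) (evo_f mu2) |}.

Lemma concentrated_cadd {disp : measure_display} {T : measurableType disp}
    (n1 n2 : {charge set T -> \bar R}) K :
  concentrated_on n1 K -> concentrated_on n2 K -> concentrated_on (cadd n1 n2) K.
Proof. by move=> c1 c2 A mA AK; rewrite /cadd/= c1// c2// adde0. Qed.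

Lemma evo_add_admissible mu1 mu2 : admissible Omega mu1 -> admissible Omega mu2 ->
  admissible Omega (evo_add mu1 mu2).
Proof.
move=> [w1 F1 g1 [G1 t1] f1] [w2 F2 g2 [G2 t2] f2]; split=> /=.
- exact: concentrated_cadd.
- by move=> i; exact: concentrated_cadd.
- exact: concentrated_cadd.
- split; first by move=> i; exact: concentrated_cadd.
  apply/(tangentialP hOmega) => E mE.
  rewrite (eq_bigr (fun i => cint (evo_G mu1 i) (fun p => \1_E p * normal_coord Omega i p) +
      cint (evo_G mu2 i) (fun p => \1_E p * normal_coord Omega i p))); last first.
    move=> i _; rewrite cint_cadd//.
    by apply: bmeasM; [exact: bmeas_indic|exact: bmeas_normal_coord].
  rewrite big_split/=.
  by rewrite (tangentialP hOmega _).1// (tangentialP hOmega _).1// addr0.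
- exact: concentrated_cadd.
Qed.

Lemma bulk_lhs_add mu1 mu2 phi : C1 phi ->
  bulk_lhs (evo_add mu1 mu2) phi = bulk_lhs mu1 phi + bulk_lhs mu2 phi.
Proof.
move=> c1; rewrite /bulk_lhs/= !cint_cadd; last 2 first.
- by apply: bmeas_on_bdry; exact: C1_continuous.
- by apply: bmeas_on_bulk; exact: C1_continuous_partial_t.
rewrite (eq_bigr (fun i => cint (evo_F mu1 i) (on_bulk (grad_coord phi i)) +
    cint (evo_F mu2 i) (on_bulk (grad_coord phi i)))); last first.
  by move=> i _; rewrite cint_cadd//; exact: bmeas_on_bulk_grad.
by rewrite big_split/=; ring.
Qed.

Lemma bdry_lhs_add mu1 mu2 psi : C1 psi ->
  bdry_lhs (evo_add mu1 mu2) psi = bdry_lhs mu1 psi + bdry_lhs mu2 psi.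
Proof.
move=> c1; rewrite /bdry_lhs/= !cint_cadd; last 2 first.
- by apply: bmeas_on_bdry; exact: C1_continuous.
- by apply: bmeas_on_bdry; exact: C1_continuous_partial_t.
rewrite (eq_bigr (fun i => cint (evo_G mu1 i) (on_bdry (tgrad_coord psi i)) +
    cint (evo_G mu2 i) (on_bdry (tgrad_coord psi i)))); last first.
  by move=> i _; rewrite cint_cadd//; exact: bmeas_on_bdry_tgrad.
by rewrite big_split/=; ring.
Qed.

Lemma affine_minorantD (b J1 J2 : 'rV[R]_d) w1 w2 :
  affine_minorant b (w1 + w2) (J1 + J2) = affine_minorant b w1 J1 + affine_minorant b w2 J2.
Proof. by rewrite /affine_minorant dotDr; ring. Qed.

Lemma fine_cadd {disp : measure_display} {T : measurableType disp}
    (n1 n2 : {charge set T -> \bar R}) A : measurable A ->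
  fine (cadd n1 n2 A) = fine (n1 A) + fine (n2 A).
Proof. by move=> mA; rewrite /cadd fineD// fin_num_measure. Qed.

Lemma fine_cscale {disp : measure_display} {T : measurableType disp}
    (a : R) (n1 : {charge set T -> \bar R}) A : measurable A ->
  fine (cscale a n1 A) = a * fine (n1 A).
Proof. by move=> mA; rewrite /cscale fineM// fin_num_measure. Qed.

Lemma bulk_action_add mu1 mu2 c1 c2 : bulk_action_le mu1 c1 -> bulk_action_le mu2 c2 ->
  bulk_action_le (evo_add mu1 mu2) (c1 + c2).
Proof.
move=> b1 b2 n E b mE tE; apply: le_trans (lerD (b1 n E b mE tE) (b2 n E b mE tE)).
rewrite -big_split/= le_eqVlt; apply/orP; left; apply/eqP/eq_bigr => k _.
rewrite -affine_minorantD fine_cadd//; congr affine_minorant.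
by apply/rowP => i; rewrite !mxE fine_cadd.
Qed.

Lemma bdry_action_add mu1 mu2 c1 c2 :
  bdry_action_le kappa mu1 c1 -> bdry_action_le kappa mu2 c2 ->
  bdry_action_le kappa (evo_add mu1 mu2) (c1 + c2).
Proof.
move=> b1 b2 n E b a mE tE; apply: le_trans (lerD (b1 n E b a mE tE) (b2 n E b a mE tE)).
rewrite -big_split/= le_eqVlt; apply/orP; left; apply/eqP/eq_bigr => k _.
rewrite !fine_cadd// (_ : \row_i _ = (\row_i fine (evo_G mu1 i (E k))) +
  (\row_i fine (evo_G mu2 i (E k)))); last first.
  by apply/rowP => i; rewrite !mxE fine_cadd.
by rewrite affine_minorantD; ring.
Qed.

Lemma measurable_time_map t0 b :
  measurable_fun setT (time_map t0 b : spacetime R d -> spacetime R d).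
Proof. by apply: continuous_borel; exact: continuous_time_map. Qed.

(** Image under the change of time [t |-> t0 + s * a * t], where [s] is a sign and [a > 0].
    Masses get the factor [a] by which time is scaled; fluxes carry a velocity, whose
    factor [s / a] leaves [s]. *)
Definition evo_time t0 (s a : R) mu := {|
  evo_omega := cscale a (cpush (evo_omega mu) (measurable_time_map t0 (s * a)));
  evo_F := fun i => cscale s (cpush (evo_F mu i) (measurable_time_map t0 (s * a)));
  evo_gamma := cscale a (cpush (evo_gamma mu) (measurable_time_map t0 (s * a)));
  evo_G := fun i => cscale s (cpush (evo_G mu i) (measurable_time_map t0 (s * a)));
  evo_f := cscale s (cpush (evo_f mu) (measurable_time_map t0 (s * a))) |}.

Section time_change.
Variables (t0 s a : R) (mu : @evolution R d).
Hypotheses (s1 : s * s = 1) (a0 : 0 < a).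
Hypothesis t01 : forall t, 0 <= t <= 1 -> 0 <= t0 + s * a * t <= 1.
Hypothesis adm : admissible Omega mu.
Local Notation S := (time_map t0 (s * a)).

Let s_neq0 : s != 0.
Proof. by apply: contra_eqN s1 => /eqP ->; rewrite mul0r eq_sym oner_eq0. Qed.

Let SQ (K : set 'rV[R]_d) p : (`[0, 1] `*` K) p -> (`[0, 1] `*` K) (S p).
Proof. by move=> [p01 Kp]; split => //; move: p01 => /=; rewrite !in_itv/=; exact: t01. Qed.

Let conc (nu : {charge set (spacetime R d) -> \bar R}) (K : set 'rV[R]_d) c :
  concentrated_on nu (`[0, 1] `*` K) ->
  concentrated_on (cscale c (cpush nu (measurable_time_map t0 (s * a)))) (`[0, 1] `*` K).
Proof.
move=> cn A mA AK; rewrite /cscale/= /pushforward cn ?mule0//.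
  by rewrite -[X in measurable X]setTI; exact: measurable_time_map.
rewrite -subset0 => p [Ap /SQ Kp].
have : (A `&` (`[0, 1] `*` K)) (S p) by [].
by rewrite AK.
Qed.

Let cint_time (nu : {charge set (spacetime R d) -> \bar R}) (K : set 'rV[R]_d) c
    (g h : spacetime R d -> R) :
  measurable (`[0, 1] `*` K : set (spacetime R d)) ->
  concentrated_on nu (`[0, 1] `*` K) -> bmeas g -> bmeas h ->
  (forall p, (`[0, 1] `*` K) p -> g (S p) = h p) ->
  cint (cscale c (cpush nu (measurable_time_map t0 (s * a)))) g = c * cint nu h.
Proof.
move=> mK cK bg bh gh; rewrite cint_cscale// cint_cpush//; congr (_ * _).
apply: (concentrated_on_cint mK cK) => //.
  by apply: (bmeas_comp _ bg); exact: measurable_time_map.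
by move=> p /set_mem; exact: gh.
Qed.

Lemma evo_time_admissible : admissible Omega (evo_time t0 s a mu).
Proof.
have [w1 F1 g1 [G1 t1] f1] := adm; split=> /=.
- exact: conc.
- by move=> i; exact: conc.
- exact: conc.
- split; first by move=> i; exact: conc.
  apply/(tangentialP hOmega) => E mE.
  have mSE : measurable (S @^-1` E : set (spacetime R d)).
    by rewrite -[X in measurable X]setTI; exact: measurable_time_map.
  rewrite (eq_bigr (fun i => s * cint (evo_G mu i)
      (fun p => \1_(S @^-1` E) p * normal_coord Omega i p))).
    by rewrite -mulr_sumr (tangentialP hOmega _).1// mulr0.
  move=> i _; apply: cint_time => //.
  + exact: measurable_Qbdry.
  + exact: G1.
  + by apply: bmeasM; [exact: bmeas_indic|exact: bmeas_normal_coord].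
  + by apply: bmeasM; [exact: bmeas_indic|exact: bmeas_normal_coord].
  + move=> p Qp; rewrite /normal_coord !patchE.
    by rewrite (mem_set (SQ Qp : Qbdry Omega (S p))) (mem_set (Qp : Qbdry Omega p)).
- exact: conc.
Qed.

Let cint_time_partial_t (nu : {charge set (spacetime R d) -> \bar R}) (K : set 'rV[R]_d) phi :
  compact (`[0, 1] `*` K : set (R * 'rV[R]_d)) -> measurable (`[0, 1] `*` K : set (spacetime R d)) ->
  concentrated_on nu (`[0, 1] `*` K) -> C1 phi ->
  cint (cscale a (cpush nu (measurable_time_map t0 (s * a))))
    ((partial_t phi \_ (`[0, 1] `*` K)) : spacetime R d -> R) =
  s * cint nu ((partial_t (fun p => phi (S p)) \_ (`[0, 1] `*` K)) : spacetime R d -> R).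
Proof.
move=> kK mK cK c1; have bp psi : C1 psi ->
    bmeas ((partial_t psi \_ (`[0, 1] `*` K)) : spacetime R d -> R).
  move=> /C1_continuous_partial_t cp; have [M pM] := continuous_compact_bounded cp kK.
  by apply: (bmeas_restrict mK _ pM); apply: measurable_funTS; exact: continuous_borel_real.
have c1S := C1_time_map t0 (s * a) c1.
rewrite (@cint_time _ K a _ (fun p => (s * a)^-1 *
    (partial_t (fun p => phi (S p)) \_ (`[0, 1] `*` K)) p)) //; first last.
- move=> p Qp; rewrite !patchE (mem_set Qp) (mem_set (SQ Qp)) partial_t_time_map// mulKf//.
  by rewrite mulf_neq0 ?s_neq0// gt_eqF.
- by apply: bmeasZ; exact: bp.
- exact: bp.
rewrite cintZ; last exact: bp.
rewrite mulrA; congr (_ * _); rewrite invfM mulrCA divff ?gt_eqF// mulr1.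
by apply: (mulfI s_neq0); rewrite mulfV ?s_neq0.
Qed.

Lemma bulk_lhs_time phi : C1 phi ->
  bulk_lhs (evo_time t0 s a mu) phi = s * bulk_lhs mu (fun p => phi (S p)).
Proof.
move=> c1; have c1S := C1_time_map t0 (s * a) c1.
have [w1 F1 g1 [G1 t1] f1] := adm.
rewrite /bulk_lhs/= mulrBr mulrDr; congr (_ + _ - _).
- by apply: cint_time_partial_t => //; [exact: compact_Qbulk|exact: measurable_Qbulk].
- rewrite [RHS]mulr_sumr; apply: eq_bigr => i _; apply: cint_time => //.
  + exact: measurable_Qbulk.
  + exact: F1.
  + exact: bmeas_on_bulk_grad.
  + exact: bmeas_on_bulk_grad.
  + by move=> p Qp; rewrite !on_bulkE//; exact: SQ.
- apply: cint_time => //.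
  + exact: measurable_Qbdry.
  + exact: f1.
  + by apply: bmeas_on_bdry; exact: C1_continuous.
  + by apply: bmeas_on_bdry; exact: C1_continuous.
  + by move=> p Qp; rewrite !on_bdryE//; exact: SQ.
Qed.

Lemma bdry_lhs_time psi : C1 psi ->
  bdry_lhs (evo_time t0 s a mu) psi = s * bdry_lhs mu (fun p => psi (S p)).
Proof.
move=> c1; have c1S := C1_time_map t0 (s * a) c1.
have [w1 F1 g1 [G1 t1] f1] := adm.
rewrite /bdry_lhs/= mulrDr mulrDr; congr (_ + _ + _).
- by apply: cint_time_partial_t => //; [exact: compact_Qbdry|exact: measurable_Qbdry].
- rewrite [RHS]mulr_sumr; apply: eq_bigr => i _; apply: cint_time => //.
  + exact: measurable_Qbdry.
  + exact: G1.
  + exact: bmeas_on_bdry_tgrad.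
  + exact: bmeas_on_bdry_tgrad.
  + by move=> p Qp; rewrite !on_bdryE//; exact: SQ.
- apply: cint_time => //.
  + exact: measurable_Qbdry.
  + exact: f1.
  + by apply: bmeas_on_bdry; exact: C1_continuous.
  + by apply: bmeas_on_bdry; exact: C1_continuous.
  + by move=> p Qp; rewrite !on_bdryE//; exact: SQ.
Qed.

Let mpre (E : nat -> set (spacetime R d)) : (forall k, measurable (E k)) ->
  forall k, measurable (S @^-1` E k : set (spacetime R d)).
Proof. by move=> mE k; rewrite -[X in measurable X]setTI; exact: measurable_time_map. Qed.

Let tpre (E : nat -> set (spacetime R d)) : trivIset setT E ->
  trivIset setT (fun k => S @^-1` E k : set (spacetime R d)).
Proof. by move=> tE i j _ _ [p [Ei Ej]]; apply: tE => //; exists (S p). Qed.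

(** Compressing the time to a fraction [a] divides the action by [a]: in the set-wise
    bounds, multiply the slopes by [s * a]. *)
Lemma bulk_action_time c : bulk_action_le mu c ->
  bulk_action_le (evo_time t0 s a mu) (c / a).
Proof.
move=> bc n E b mE tE; rewrite ler_pdivlMr// mulr_suml.
apply: le_trans (bc n _ (fun k => (s * a) *: b k) (mpre mE) (@tpre _ tE)).
rewrite le_eqVlt; apply/orP; left; apply/eqP/eq_bigr => k _.
rewrite fine_cscale// (_ : \row_i _ = s *: (\row_i fine (evo_F mu i (S @^-1` E k)))); last first.
  by apply/rowP => i; rewrite !mxE fine_cscale.
rewrite /affine_minorant dotZr !dotZl dotZr /=.
have -> : s * a * (s * a * dot (b k) (b k)) = s * s * (a * a * dot (b k) (b k)) by ring.
by rewrite s1; ring.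
Qed.

Lemma bdry_action_time c : bdry_action_le kappa mu c ->
  bdry_action_le kappa (evo_time t0 s a mu) (c / a).
Proof.
move=> bc n E b r mE tE; rewrite ler_pdivlMr// mulr_suml.
apply: le_trans (bc n _ (fun k => (s * a) *: b k) (fun k => (s * a) * r k) (mpre mE) (@tpre _ tE)).
rewrite le_eqVlt; apply/orP; left; apply/eqP/eq_bigr => k _.
rewrite !fine_cscale// (_ : \row_i _ = s *: (\row_i fine (evo_G mu i (S @^-1` E k)))); last first.
  by apply/rowP => i; rewrite !mxE fine_cscale.
rewrite /affine_minorant dotZr !dotZl dotZr /=.
have -> : s * a * (s * a * dot (b k) (b k)) = s * s * (a * a * dot (b k) (b k)) by ring.
have -> : (s * a * r k) ^+ 2 = s * s * (a * r k) ^+ 2 by ring.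
by rewrite s1; ring.
Qed.

End time_change.

(** The measures at the end times enter the continuity equations only through their
    integrals.  Working with these functionals allows endpoints, such as Dirac masses of
    arbitrary weight, that are not configurations. *)
Definition endpoint := ((('rV[R]_d -> R) -> R) * (('rV[R]_d -> R) -> R))%type.
Implicit Types e : endpoint.

Definition connects mu e0 e1 := forall phi, C1 phi ->
  bulk_lhs mu phi = e1.1 (fun x => phi (1, x)) - e0.1 (fun x => phi (0, x)) /\
  bdry_lhs mu phi = e1.2 (fun x => phi (1, x)) - e0.2 (fun x => phi (0, x)).

(** The squared distance of two configurations is the infimum of the [c] for which they are
    linked; [c1] and [c2] bound the bulk part and the boundary part of the action. *)
Definition linked (c : R) e0 e1 := exists mu (c1 c2 : R),
  [/\ admissible Omega mu, bulk_action_le mu c1, bdry_action_le kappa mu c2,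
      c1 + c2 <= c & connects mu e0 e1].

Definition endpoint_add e e' : endpoint := (fun u => e.1 u + e'.1 u, fun u => e.2 u + e'.2 u).

Lemma linked_add c c' e0 e1 e0' e1' : linked c e0 e1 -> linked c' e0' e1' ->
  linked (c + c') (endpoint_add e0 e0') (endpoint_add e1 e1').
Proof.
move=> [mu [c1 [c2 [adm b1 b2 cc con]]]] [mu' [c1' [c2' [adm' b1' b2' cc' con']]]].
exists (evo_add mu mu'), (c1 + c1'), (c2 + c2'); split.
- exact: evo_add_admissible.
- exact: bulk_action_add.
- exact: bdry_action_add.
- by rewrite addrACA lerD.
- move=> phi c1phi; rewrite bulk_lhs_add// bdry_lhs_add//.
  have [-> ->] := con phi c1phi; have [-> ->] := con' phi c1phi.
  by split; rewrite /=; ring.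
Qed.

Lemma linked_sym c e0 e1 : linked c e0 e1 -> linked c e1 e0.
Proof.
move=> [mu [c1 [c2 [adm b1 b2 cc con]]]].
have t01 (t : R) : 0 <= t <= 1 -> 0 <= 1 + (-1) * 1 * t <= 1 by lra.
have s1 : (-1 : R) * (-1) = 1 by ring.
exists (evo_time 1 (-1) 1 mu), c1, c2; split => //.
- exact: evo_time_admissible.
- by rewrite -[c1]divr1; apply: bulk_action_time.
- by rewrite -[c2]divr1; apply: bdry_action_time.
- move=> phi c1phi; rewrite bulk_lhs_time// bdry_lhs_time//.
  have [-> ->] := con _ (C1_time_map 1 (-1 * 1) c1phi).
  rewrite /time_map/= !(mulr1, mulr0, addr0, subrr).
  by split; ring.
Qed.

(** Run the first evolution during the time [tau] and the second one during the rest. *)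
Lemma linked_trans c c' e0 e1 e2 (tau : R) : 0 < tau < 1 ->
  linked c e0 e1 -> linked c' e1 e2 -> linked (c / tau + c' / (1 - tau)) e0 e2.
Proof.
move=> /andP[tau0 tau1].
move=> [mu [c1 [c2 [adm b1 b2 cc con]]]] [mu' [c1' [c2' [adm' b1' b2' cc' con']]]].
have tau1' : 0 < 1 - tau by rewrite subr_gt0.
have t01 (t : R) : 0 <= t <= 1 -> 0 <= 0 + 1 * tau * t <= 1 by nra.
have t01' (t : R) : 0 <= t <= 1 -> 0 <= tau + 1 * (1 - tau) * t <= 1 by nra.
have s1 : (1 : R) * 1 = 1 by ring.
exists (evo_add (evo_time 0 1 tau mu) (evo_time tau 1 (1 - tau) mu')),
  (c1 / tau + c1' / (1 - tau)), (c2 / tau + c2' / (1 - tau)); split => //.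
- by apply: evo_add_admissible; exact: evo_time_admissible.
- by apply: bulk_action_add; exact: bulk_action_time.
- by apply: bdry_action_add; exact: bdry_action_time.
- by rewrite addrACA -!mulrDl lerD// ler_pM2r// invr_gt0.
- move=> phi c1phi; rewrite bulk_lhs_add// bdry_lhs_add// !bulk_lhs_time// !bdry_lhs_time//.
  have [-> ->] := con _ (C1_time_map 0 (1 * tau) c1phi).
  have [-> ->] := con' _ (C1_time_map tau (1 * (1 - tau)) c1phi).
  rewrite /time_map/= !(mul1r, mulr1, mulr0, addr0, add0r).
  have -> : tau + (1 - tau) = 1 by ring.
  by split; ring.
Qed.

End paths.

(** * Lebesgue measure in time and a finite measure in space *)

Section time_integral.
Context {R : realType}.
Local Notation mR := (measurableTypeR R).

(** The uniform distribution is a finite measure on the whole line, so that its product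
    with a finite measure in space is again a finite measure on a full product. *)
Definition leb01 : {finite_measure set mR -> \bar R} := uniform_prob (@ltr01 R).

Lemma leb01_itv (f : mR -> R) : bmeas f ->
  \int[leb01]_t f t = \int[@lebesgue_measure R]_(t in `[0, 1]) f t.
Proof.
have fi (g : mR -> R) : bmeas g ->
    (@lebesgue_measure R).-integrable `[0, 1] (EFin \o g).
  move=> [mg [M gM]]; apply: measurable_bounded_integrable => //.
  - by rewrite [X in (X < _)%E]lebesgue_measure_itv/= lte_fin ltr01 -EFinB ltry.
  - exact: measurable_funTS.
  - exists M; split; first exact: num_real.
    by move=> y My x _; exact: le_trans (gM x) (ltW My).
apply: (@bounded_linear_eq _ mR R (fun g => \int[leb01]_t g t)).
  exact: bounded_linear_Rintegral.
  split.
  - by move=> g h bg bh; rewrite RintegralD//; exact: fi.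
  - by move=> c g bg; rewrite RintegralZl//; exact: fi.
  - exists 1 => g M bg gM; rewrite mul1r (le_trans (le_normr_Rintegral _ _))//; first exact: fi.
    apply: (@le_trans _ _ (\int[@lebesgue_measure R]_(t in `[0, 1]) M)).
      apply: le_Rintegral => //; first exact: (integrable_norm (fi _ bg)).
      exact: (fi _ (bmeas_cst M)).
    by rewrite Rintegral_cst//= [X in fine X]lebesgue_measure_itv/= lte_fin ltr01 -EFinB/= subr0 mulr1.
move=> A mA; rewrite /Rintegral; congr fine.
have := @integral_uniform R 0 1 ltr01 (fun x => (\1_A x)%:E).
rewrite subr0 invr1 mul1e; apply => //.
by apply/measurable_EFinP; exact: measurable_indic.
Qed.

Lemma leb01_FTC (u u' : R -> R) : (forall t, is_derive t (1 : R) u (u' t)) ->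
  continuous u' -> \int[@lebesgue_measure R]_(t in `[0, 1]) u' t = u 1 - u 0.
Proof.
move=> du cu'.
have cu t : {for t, continuous u}.
  by apply/differentiable_continuous/derivable1_diffP.
rewrite /Rintegral (@continuous_FTC2 R u' u 0 1 ltr01)//.
- exact: continuous_subspaceT.
- split.
  + by move=> t _; exact: ex_derive.
  + exact/cvg_at_right_filter/cu.
  + exact/cvg_at_left_filter/cu.
- by move=> t _; rewrite derive1E derive_val.
Qed.

End time_integral.

Section base_measure.
Context {R : realType} {d : nat}.
Local Notation mR := (measurableTypeR R).

(** Space-time carries the Borel sets of the product topology, whereas a product measure
    lives on the product of the two Borel sigma-algebras; the identity is measurable
    because open sets are countable unions of products. *)
Lemma measurable_to_spacetimeR : measurable_fun setT
  ((fun p => p) : (mR * space R d)%type -> spacetime R d).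
Proof.
apply: (@measurability _ _ (mR * space R d)%type (spacetime R d) setT (fun p => p)
  (@open (R * 'rV[R]_d)%type)) => // _ [A oA <-].
rewrite setTI preimage_id (open_bigcup_rat_cyl oA).
apply: bigcup_measurable_count => c _; apply: measurableX.
  exact: (@measurable_ball R _ _).
by apply: space_open_measurable; exact: open_rat_box.
Qed.

Variable m : {finite_measure set space R d -> \bar R}.

Let base_product_fin : fin_num_fun (leb01 \x m)%E.
Proof.
move=> A mA; rewrite ge0_fin_numE//.
apply: (@le_lt_trans _ _ ((leb01 \x m) setT)%E).
  by apply: le_measure; rewrite ?inE.
rewrite -setXTT product_measure1E//.
by rewrite -ge0_fin_numE ?mule_ge0// fin_numM// fin_num_measure.
Qed.

Definition base_product : {finite_measure set (mR * space R d)%type -> \bar R} :=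
  HB.pack (leb01 \x m)%E (Measure_isFinite.Build _ _ _ (leb01 \x m)%E base_product_fin).

(** Carried over to the Borel sets of space-time, where evolutions live. *)
Definition base : set (spacetime R d) -> \bar R :=
  pushforward base_product ((fun p => p) : (mR * space R d)%type -> spacetime R d).

Let base0 : base set0 = 0%E.
Proof. by rewrite /base /pushforward preimage_set0 measure0. Qed.
Let base_ge0 A : (0 <= base A)%E.
Proof. exact: (measure_ge0 base_product). Qed.
Let mpre (A : set (spacetime R d)) : measurable A ->
  measurable ((fun p => p) @^-1` A : set (mR * space R d)%type).
Proof. by move=> mA; rewrite -[X in measurable X]setTI; exact: measurable_to_spacetimeR. Qed.
Let base_sigma : semi_sigma_additive base.
Proof.
move=> F mF tF mUF; rewrite /base /pushforward.
apply: (@measure_semi_sigma_additive _ _ _ base_product F) => //.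
- by move=> n; exact: mpre (mF n).
- exact: mpre mUF.
Qed.

HB.instance Definition _ := isMeasure.Build _ _ _ base base0 base_ge0 base_sigma.

Let base_fin : fin_num_fun base.
Proof. by move=> A mA; apply: fin_num_measure; exact: mpre. Qed.

HB.instance Definition _ := Measure_isFinite.Build _ _ _ base base_fin.

Lemma bmeas_section (f : spacetime R d -> R) x : bmeas f -> bmeas (fun t : mR => f (t, x)).
Proof.
move=> [mf [M fM]]; split; last by exists M.
apply: (measurableT_comp mf).
apply: (measurableT_comp measurable_to_spacetimeR).
exact: measurable_pair2.
Qed.

(** Fubini: integrate in time first, where test functions are integrated back from their
    derivative. *)
Lemma base_integral (f : spacetime R d -> R) (H : space R d -> R) : bmeas f ->
  (forall x, \int[@lebesgue_measure R]_(t in `[0, 1]) f (t, x) = H x) ->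
  \int[base]_p f p = \int[m]_x H x.
Proof.
move=> bf fH.
pose g : (mR * space R d)%type -> R := fun p => f p.
have bg : bmeas g by apply: (bmeas_comp _ bf); exact: measurable_to_spacetimeR.
have -> : \int[base]_p f p = \int[base_product]_p g p.
  apply: (bounded_linear_eq (L2 := fun f : spacetime R d -> R =>
      \int[base_product]_p f p)) bf.
  - exact: bounded_linear_Rintegral.
  - have [D Z [C B]] := @bounded_linear_Rintegral _ _ R base_product.
    have cmp (u : spacetime R d -> R) : bmeas u -> bmeas (u : (mR * space R d)%type -> R).
      by move=> bu; apply: (bmeas_comp _ bu); exact: measurable_to_spacetimeR.
    split.
    + by move=> u v bu bv; apply: D; exact: cmp.
    + by move=> c u bu; apply: Z; exact: cmp.
    + by exists C => u M bu uM; apply: B => //; exact: cmp.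
  - move=> A mA; rewrite /Rintegral; congr fine.
    rewrite (@integral_indic _ _ R base)// setIT.
    by rewrite (@integral_indic _ _ R base_product)// ?setIT//; exact: mpre.
rewrite /Rintegral; congr fine.
rewrite -[LHS](integral21_prod_meas1 (bmeas_integrable base_product bg)).
apply: eq_integral => x _; rewrite /fubini_G -fH -leb01_itv; last exact: bmeas_section.
by rewrite EFin_Rintegral//; apply: bmeas_integrable; exact: bmeas_section.
Qed.

(** This turns a pointwise bound on the integrand into a bound on the action. *)
Lemma sum_disjoint_le (n : nat) (E : nat -> set (spacetime R d))
    (X : nat -> spacetime R d -> R) (C : R) : 0 <= C ->
  (forall k, measurable (E k)) -> trivIset setT E -> (forall k, bmeas (X k)) ->
  (forall k p, X k p <= C) ->
  \sum_(k < n) \int[base]_(p in E k) X k p <= C * fine (base setT).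
Proof.
move=> C0 mE tE bX XC.
apply: (@le_trans _ _ (\sum_(k < n) C * fine (base (E k)))).
  apply: ler_sum => k _; rewrite -Rintegral_cst//.
  apply: le_Rintegral => //; first exact: integrableS (bmeas_integrable _ (bX k)).
  exact: integrableS (bmeas_integrable _ (bmeas_cst C)).
rewrite -mulr_sumr ler_wpM2l//.
rewrite -lee_fin -sumEFin fineK ?fin_num_measure//.
rewrite (eq_bigr (fun k : 'I_n => base (E k))); last first.
  by move=> k _; rewrite fineK// fin_num_measure.
rewrite -(@measure_semi_additive _ _ _ base E n)//.
- by apply: le_measure; rewrite ?inE//; exact: bigsetU_measurable.
- exact: bigsetU_measurable.
Qed.

End base_measure.

(** * Two explicit evolutions: motion along segments and exchange at the boundary *)

Section building_blocks.
Context {R : realType} {d : nat}.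
Variables (Omega : set 'rV[R]_d).
Hypothesis hOmega : smooth_bounded_domain Omega.
Variables (kappa : R).
Variable m : {finite_measure set space R d -> \bar R}.

(** The factor [`[0, 1]] concentrates on the closed time interval the charges built from
    the base measure. *)
Definition cylinder (K : set 'rV[R]_d) : set (spacetime R d) := `[0, 1] `*` K.

Lemma cylinder_measurable (K : set 'rV[R]_d) : measurable (K : set (space R d)) ->
  measurable (cylinder K).
Proof.
move=> mK.
rewrite (_ : cylinder K = (`[0, 1] `*` setT) `&` (snd @^-1` K)); last first.
  by apply/seteqP; split => -[t x] /=; [move=> [? ?]|move=> [[? _] ?]].
apply: measurableI.
  by apply: spacetime_closed_measurable; apply: closed_setX; [exact: interval_closed|exact: closedT].
have : measurable_fun setT (snd : spacetime R d -> space R d).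
  by apply: continuous_borel => p; exact: cvg_snd.
by move=> /(_ measurableT _ mK); rewrite setTI.
Qed.

(** Both explicit evolutions satisfy the continuity equations through this formula: the
    left-hand sides integrate the derivative of a function of time. *)
Lemma base_FTC (K : set 'rV[R]_d) (g : spacetime R d -> R) (u : 'rV[R]_d -> R -> R) :
  measurable (K : set (space R d)) -> bmeas (g \_ (cylinder K)) ->
  (forall x t, K x -> is_derive t (1 : R) (u x) (g (t, x))) ->
  (forall x, K x -> continuous (fun t => g (t, x))) ->
  \int[base m]_p (g \_ (cylinder K)) p = \int[m]_(x in K) (u x 1 - u x 0).
Proof.
move=> mK bg du cg; rewrite (Rintegral_mkcond m K); apply: base_integral => // x.
have [Kx|nKx] := pselect (K x); last first.
  rewrite patchE memNset//.
  rewrite (eq_Rintegral _ (g := fun=> 0)); first by rewrite Rintegral_cst// mul0r.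
  by move=> t _; rewrite patchE memNset// => -[].
rewrite patchE mem_set// -(leb01_FTC (du x ^~ Kx) (cg x Kx)).
by apply: eq_Rintegral => t /set_mem t01; rewrite patchE mem_set.
Qed.

Lemma continuous_integrable_on (K : set 'rV[R]_d) (f : 'rV[R]_d -> R) (M : R) :
  measurable (K : set (space R d)) -> continuous f -> (forall x, K x -> `|f x| <= M) ->
  m.-integrable (K : set (space R d)) (EFin \o f).
Proof.
move=> mK cf fM; apply: measurable_bounded_integrable => //.
- by rewrite -ge0_fin_numE// fin_num_measure.
- by apply: measurable_funTS; exact: continuous_borel_real.
- by exists M; split; [exact: num_real|move=> y My x /fM /le_trans; apply; exact: ltW].
Qed.

Lemma affine_minorant_Rintegral (la : {finite_measure set spacetime R d -> \bar R}) A b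
    (w : spacetime R d -> R) (J : 'I_d -> spacetime R d -> R) : measurable A ->
  bmeas w -> (forall i, bmeas (J i)) ->
  affine_minorant b (\int[la]_(p in A) w p) (\row_i \int[la]_(p in A) J i p) =
  \int[la]_(p in A) affine_minorant b (w p) (\row_i J i p).
Proof.
move=> mA bw bJ.
rewrite (Rintegral_affine_minorant (bmeas_integrable la bw) _ b mA).
  congr affine_minorant; apply/rowP => i; rewrite !mxE.
  by apply: eq_Rintegral => p _; rewrite mxE.
by move=> i; under eq_fun do rewrite mxE; exact: bmeas_integrable.
Qed.

Section bulk_move.
Variables (K : set 'rV[R]_d) (X V : 'rV[R]_d -> 'rV[R]_d) (D : R).
Hypotheses (mK : measurable (K : set (space R d))) (cX : continuous X)
  (cV : continuous V) (D0 : 0 <= D).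
Hypothesis VK : forall z t, K z -> 0 <= t <= 1 -> closure Omega (t *: V z + X z).
Hypothesis VD : forall z, K z -> dot (V z) (V z) <= D.

Let Q : set (spacetime R d) := cylinder K.
Let mQ : measurable Q. Proof. exact: cylinder_measurable. Qed.

Let eta (p : R * 'rV[R]_d) : R * 'rV[R]_d := (p.1, p.1 *: V p.2 + X p.2).

Let cV2 : continuous (fun p : R * 'rV[R]_d => V p.2).
Proof. by move=> p; apply: (@continuous_comp _ _ _ snd V); [exact: cvg_snd|exact: cV]. Qed.

Let ceta : continuous eta.
Proof.
move=> p; apply: continuous_pair; first exact: cvg_fst.
apply: cvgD; last by apply: (@continuous_comp _ _ _ snd X); [exact: cvg_snd|exact: cX].
by apply: cvgZ; [exact: cvg_fst|exact: cV2].
Qed.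

Let meta : measurable_fun setT (eta : spacetime R d -> spacetime R d).
Proof. exact: continuous_borel. Qed.

Let one : spacetime R d -> R := (fun=> 1 : R) \_ Q.
Let vel i : spacetime R d -> R := (fun p => V p.2 0 i) \_ Q.

Let b_one : bmeas one.
Proof.
apply: (bmeas_restrict (M := 1)) => //.
by move=> x _; rewrite normr1.
Qed.

Let b_vel i : bmeas (vel i).
Proof.
apply: (bmeas_restrict (M := 1 + D)) => //.
  apply: measurable_funTS; apply: continuous_borel_real => p.
  by apply: (@continuous_comp _ _ _ (fun p : R * 'rV[R]_d => V p.2) (fun v => v 0 i));
    [exact: cV2|exact: continuous_coord].
move=> [t z] [_ Kz] /=; have := VD Kz.
have : `|V z 0 i| ^+ 2 <= dot (V z) (V z).
  rewrite real_normK ?num_real// /dot (bigD1 i)//= -expr2 lerDl.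
  by apply: sumr_ge0 => j _; rewrite -expr2 sqr_ge0.
by have := normr_ge0 (V z 0 i); nra.
Qed.

Let Qeta p : Q p -> Qbulk Omega (eta p).
Proof. by move: p => [t z] [/= t01 Kz]; split => //=; apply: VK => //; move: t01; rewrite in_itv. Qed.

Let move_evo : @evolution R d := {|
  evo_omega := cdensity (base m) b_one meta;
  evo_F := fun i => cdensity (base m) (b_vel i) meta;
  evo_gamma := czero; evo_G := fun=> czero; evo_f := czero |}.

Let czero_conc (L : set (spacetime R d)) : concentrated_on (@czero _ (spacetime R d) R) L.
Proof. by []. Qed.

Let move_adm : admissible Omega move_evo.
Proof.
have off (g : spacetime R d -> R) p : ~ Qbulk Omega (eta p) -> (g \_ Q) p = 0.
  by move=> nQ; rewrite patchE memNset// => /Qeta.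
split.
- exact: (cdensity_concentrated (base m) b_one meta (@measurable_Qbulk R d Omega) (off _)).
- move=> i.
  exact: (cdensity_concentrated (base m) (b_vel i) meta (@measurable_Qbulk R d Omega) (off _)).
- exact: czero_conc.
- split => [i|]; first exact: czero_conc.
  apply/(tangentialP hOmega) => E mE; apply: big1 => i _.
  by rewrite cint_czero//; apply: bmeasM; [exact: bmeas_indic|exact: bmeas_normal_coord].
- exact: czero_conc.
Qed.

Let move_bulk : bulk_action_le move_evo (D / 2 * fine (base m setT)).
Proof.
move=> n E b mE tE.
have mpre k : measurable (eta @^-1` E k : set (spacetime R d)).
  by rewrite -[X in measurable X]setTI; exact: meta.
pose Y k p := affine_minorant (b k) (one p) (\row_i vel i p).
rewrite (eq_bigr (fun k : 'I_n => \int[base m]_(p in eta @^-1` E k) Y k p)); last first.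
  by move=> k _; rewrite -affine_minorant_Rintegral.
apply: (@sum_disjoint_le _ _ _ _ (fun k => eta @^-1` E k)) => //.
- by rewrite divr_ge0.
- by move=> i j _ _ [p [Ei Ej]]; apply: tE => //; exists (eta p).
- move=> k; apply: bmeasB; last by apply: bmeasZ; exact: b_one.
  by apply: bmeas_sum => i _; apply: bmeasZ; under eq_fun do rewrite mxE; exact: b_vel.
- move=> k p; rewrite /Y; have [Qp|nQp] := pselect (Q p); last first.
    rewrite /one patchE memNset// (_ : \row_i _ = 0) /affine_minorant.
      by rewrite dot0r mulr0 subr0 divr_ge0.
    by apply/rowP => i; rewrite !mxE /vel patchE memNset.
  rewrite /one patchE mem_set// (_ : \row_i _ = V p.2); last first.
    by apply/rowP => i; rewrite !mxE /vel patchE mem_set.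
  rewrite /affine_minorant/= mulr1.
  have := dot_ge0 (b k - V p.2); have := VD Qp.2.
  by rewrite dotBl !dotBr (dotC (V p.2) (b k)); lra.
Qed.

(** The mass of [m] in [K] leaves the points [X z] at constant velocity [V z].  For [V = 0]
    the evolution is static and costs nothing; for constant [X] a point mass moves. *)
Lemma linked_move :
  linked Omega kappa (D / 2 * fine (base m setT))
    (fun u => \int[m]_(z in K) u (X z), fun=> 0)
    (fun u => \int[m]_(z in K) u (V z + X z), fun=> 0).
Proof.
exists move_evo, (D / 2 * fine (base m setT)), 0; split => //.
- move=> n E b a mE tE; rewrite big1// => k _ /=; rewrite (_ : \row_i _ = 0).
    by rewrite /affine_minorant dot0r/= !mulr0 !subr0 addr0.
  by apply/rowP => i; rewrite !mxE.
- by rewrite addr0.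
move=> phi c1; split; last first.
  rewrite /bdry_lhs/= !cint_czero ?big1 ?addr0 ?subr0//.
  + by move=> i _; rewrite cint_czero//; exact: bmeas_on_bdry_tgrad.
  + by apply: bmeas_on_bdry => //; exact: C1_continuous.
  + by apply: bmeas_on_bdry => //; exact: C1_continuous_partial_t.
have bpt : bmeas (on_bulk Omega (partial_t phi)).
  by apply: bmeas_on_bulk => //; exact: C1_continuous_partial_t.
have bgr i : bmeas (on_bulk Omega (grad_coord phi i)) by exact: bmeas_on_bulk_grad.
have cmp (f : spacetime R d -> R) : bmeas f -> bmeas (fun p : spacetime R d => f (eta p)).
  exact: bmeas_comp.
have [LD LZ _] := bounded_linear_Rintegral (R := R) (base m).
rewrite /bulk_lhs/= cint_czero ?subr0; last first.
  by apply: bmeas_on_bdry => //; exact: C1_continuous.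
rewrite cint_cdensity//.
under eq_bigr => i _ do rewrite cint_cdensity//.
rewrite -(@bounded_linear_sum _ _ _ (fun f => \int[base m]_p f p)); last 2 first.
- exact: bounded_linear_Rintegral.
- by move=> i _; apply: bmeasM => //; apply: cmp; exact: bgr.
rewrite -LD; last 2 first.
- by apply: bmeasM => //; exact: cmp.
- by apply: bmeas_sum => i _; apply: bmeasM => //; apply: cmp; exact: bgr.
pose g (p : R * 'rV[R]_d) := 'D_((1, V p.2) : R * 'rV[R]_d) phi (eta p).
have gE : (fun p => on_bulk Omega (partial_t phi) (eta p) * one p +
    \sum_i on_bulk Omega (grad_coord phi i) (eta p) * vel i p) = g \_ Q.
  apply/funext => p; have [Qp|nQp] := pselect (Q p); last first.
    rewrite /one /vel !patchE memNset// mulr0 add0r big1// => i _.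
    by rewrite patchE memNset// mulr0.
  rewrite on_bulkE; last exact: Qeta.
  rewrite /one !patchE mem_set//= mulr1 /g C1_derive_pair// mul1r; congr (_ + _).
  apply: eq_bigr => i _; rewrite on_bulkE; last exact: Qeta.
  by rewrite /vel patchE mem_set// mulrC.
rewrite (_ : (\int[base m]_p _) = \int[base m]_p (g \_ Q) p); last first.
  by apply: eq_Rintegral => p _; rewrite -gE.
have [fc fd fD] := (C1P phi).1 c1.
have bg : bmeas (g \_ (cylinder K)).
  rewrite -[cylinder K]/Q -gE; apply: bmeasD.
    by apply: bmeasM => //; exact: cmp.
  by apply: bmeas_sum => i _; apply: bmeasM => //; apply: cmp; exact: bgr.
have dg z t : K z -> is_derive t (1 : R) (fun t => phi (t, t *: V z + X z)) (g (t, z)).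
  move=> Kz; have := @is_derive_line _ _ phi (0, X z) (1, V z) t.
  rewrite (_ : (fun h : R => _) = (fun t => phi (t, t *: V z + X z))); last first.
    apply/funext => s; congr phi; congr pair.
    by rewrite /= addr0 /GRing.scale/= mulr1.
  rewrite (_ : t *: _ + _ = eta (t, z)); last first.
    by congr pair; rewrite /= addr0 /GRing.scale/= mulr1.
  by apply; exact: fd.
have cg z : K z -> continuous (fun t => g (t, z)).
  move=> Kz t; rewrite /g/=.
  apply: (@continuous_comp _ _ _ (fun t => eta (t, z)) ('D_((1, V z) : R * 'rV[R]_d) phi)).
    apply: (@continuous_comp _ _ _ (fun t => (t, z)) eta); last exact: ceta.
    by apply: continuous_pair; [exact: cvg_id|exact: cst_continuous].
  exact: fD.
rewrite (base_FTC mK bg dg cg).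
have [M fM] := continuous_compact_bounded fc (compact_Qbulk hOmega).
have int_at (t : R) : 0 <= t <= 1 ->
    m.-integrable (K : set (space R d)) (EFin \o (fun z => phi (eta (t, z)))).
  move=> t01; apply: (continuous_integrable_on (M := M)) => //.
    move=> z; apply: (@continuous_comp _ _ _ (fun z => eta (t, z)) phi); last exact: fc.
    apply: (@continuous_comp _ _ _ (fun z : 'rV[R]_d => (t, z)) eta); last exact: ceta.
    by apply: continuous_pair; [exact: cst_continuous|exact: cvg_id].
  by move=> z Kz; apply: fM; apply: (Qeta (p := (t, z))); split => //=; rewrite in_itv.
rewrite RintegralB//; last 2 first.
- by apply: (int_at 1); rewrite ler01 lexx.
- by apply: (int_at 0); rewrite ler01 lexx.
congr (_ - _); apply: eq_Rintegral => z _; first by rewrite scale1r.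
by rewrite scale0r add0r.
Qed.

End bulk_move.

Section exchange.
Variables (alpha alpha' : R -> R) (C : R).
Hypotheses (dalpha : forall t, is_derive t (1 : R) alpha (alpha' t)).
Hypotheses (calpha' : continuous alpha') (C0 : 0 <= C).
Hypothesis alpha01 : forall t, 0 <= t <= 1 -> 0 <= alpha t <= 1.
Hypothesis alphaC : forall t, 0 <= t <= 1 -> alpha' t ^+ 2 <= C * alpha t.

Let K := bdry Omega.
Let Q : set (spacetime R d) := cylinder K.
Let mK : measurable (K : set (space R d)).
Proof. by apply: space_closed_measurable; exact: closed_bdry. Qed.
Let mQ : measurable Q. Proof. exact: cylinder_measurable. Qed.

Let calpha : continuous alpha.
Proof.
move=> t; apply/differentiable_continuous/derivable1_diffP.
by have := dalpha t; exact: @ex_derive.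
Qed.

Let lift_t (u : R -> R) : continuous u -> continuous (fun p : R * 'rV[R]_d => u p.1).
Proof. by move=> cu p; apply: (@continuous_comp _ _ _ fst u); [exact: cvg_fst|exact: cu]. Qed.

Let prof (u : R -> R) : spacetime R d -> R := on_bdry Omega (fun p => u p.1).

Let b_prof u : continuous u -> bmeas (prof u).
Proof. by move=> cu; apply: bmeas_on_bdry => //; exact: lift_t. Qed.

Let cbeta : continuous (fun t => 1 - alpha t).
Proof. by move=> t; apply: cvgB; [exact: cvg_cst|exact: calpha]. Qed.

Let mid : measurable_fun setT (id : spacetime R d -> spacetime R d).
Proof. exact: measurable_id. Qed.

Let exch_evo : @evolution R d := {|
  evo_omega := cdensity (base m) (b_prof cbeta) mid;
  evo_F := fun=> czero;
  evo_gamma := cdensity (base m) (b_prof calpha) mid;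
  evo_G := fun=> czero;
  evo_f := cdensity (base m) (b_prof calpha') mid |}.

Let czero_conc (L : set (spacetime R d)) : concentrated_on (@czero _ (spacetime R d) R) L.
Proof. by []. Qed.

Let exch_adm : admissible Omega exch_evo.
Proof.
have off u p : ~ Qbdry Omega p -> prof u p = 0.
  by move=> nQ; rewrite /prof /on_bdry patchE memNset.
have off' u p : ~ Qbulk Omega p -> prof u p = 0.
  by move=> nQ; apply: off => -[t01 [cx _]]; apply: nQ.
split.
- exact: (cdensity_concentrated (base m) (b_prof cbeta) mid (@measurable_Qbulk R d Omega) (off' _)).
- by move=> i; exact: czero_conc.
- exact: (cdensity_concentrated (base m) (b_prof calpha) mid (@measurable_Qbdry R d Omega) (off _)).
- split => [i|]; first exact: czero_conc.
  apply/(tangentialP hOmega) => E mE; apply: big1 => i _.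
  by rewrite cint_czero//; apply: bmeasM; [exact: bmeas_indic|exact: bmeas_normal_coord].
- exact: (cdensity_concentrated (base m) (b_prof calpha') mid (@measurable_Qbdry R d Omega) (off _)).
Qed.

Let dot_czero b (E : set (spacetime R d)) :
  dot b (\row_(i < d) fine ((czero : {charge set (spacetime R d) -> \bar R}) E)) = 0.
Proof. by rewrite (_ : \row_i _ = 0) ?dot0r//; apply/rowP => i; rewrite !mxE. Qed.

Let exch_bulk : bulk_action_le exch_evo 0.
Proof.
move=> n E b mE tE; apply: sumr_le0 => k _.
rewrite /affine_minorant dot_czero sub0r oppr_le0 mulr_ge0//; first by rewrite divr_ge0 ?dot_ge0.
apply: Rintegral_ge0 => p Ep.
rewrite /prof /on_bdry patchE; case: ifPn => [/set_mem [p01 _]|_]//.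
rewrite subr_ge0; have := alpha01 (t := p.1).
by move: p01; rewrite /= in_itv/= => p01 /(_ p01) /andP[].
Qed.

Let exch_bdry : bdry_action_le kappa exch_evo (kappa ^+ 2 * C / 2 * fine (base m setT)).
Proof.
move=> n E b a mE tE.
have bX k : bmeas (fun p => kappa * a k * prof alpha' p - a k ^+ 2 / 2 * prof alpha p).
  by apply: bmeasB; apply: bmeasZ; exact: b_prof.
have XE (k : 'I_n) : kappa * a k * fine (evo_f exch_evo (E k))
      - a k ^+ 2 / 2 * fine (evo_gamma exch_evo (E k)) =
    \int[base m]_(p in E k) (kappa * a k * prof alpha' p - a k ^+ 2 / 2 * prof alpha p).
  rewrite [in RHS]RintegralB//; last 2 first.
  - by apply: (integrableS _ _ _ (bmeas_integrable (base m) (bmeasZ _ (b_prof calpha')))).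
  - by apply: (integrableS _ _ _ (bmeas_integrable (base m) (bmeasZ _ (b_prof calpha)))).
  rewrite !RintegralZl//.
  - by apply: (integrableS _ _ _ (bmeas_integrable (base m) (b_prof calpha))).
  - by apply: (integrableS _ _ _ (bmeas_integrable (base m) (b_prof calpha'))).
apply: (@le_trans _ _ (\sum_(k < n) \int[base m]_(p in E k)
    (kappa * a k * prof alpha' p - a k ^+ 2 / 2 * prof alpha p))).
  apply: ler_sum => k _; rewrite XE gerDr /affine_minorant dot_czero sub0r oppr_le0.
  rewrite mulr_ge0//; first by rewrite divr_ge0 ?dot_ge0.
  apply: Rintegral_ge0 => p Ep.
  rewrite /prof /on_bdry patchE; case: ifPn => [/set_mem [p01 _]|_]//.
  have := alpha01 (t := p.1).
  by move: p01; rewrite /= in_itv/= => p01 /(_ p01) /andP[].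
apply: (sum_disjoint_le _ _ _ mE tE bX).
  by rewrite divr_ge0// mulr_ge0// sqr_ge0.
move=> k p; rewrite /prof /on_bdry !patchE; case: ifPn => [/set_mem [p01 _]|_]; last first.
  by rewrite !mulr0 subr0 divr_ge0// mulr_ge0// sqr_ge0.
have {}p01 : 0 <= p.1 <= 1 by move: p01; rewrite /= in_itv.
have /andP[a0 _] := alpha01 p01; have aC := alphaC p01.
rewrite /=; have [a00|ap] := eqVneq (alpha p.1) 0.
  have -> : alpha' p.1 = 0.
    by apply/eqP; rewrite -sqrf_eq0 eq_le sqr_ge0 andbT; rewrite a00 mulr0 in aC.
  by rewrite a00 !mulr0 subr0 divr_ge0// mulr_ge0// sqr_ge0.
have ap0 : 0 < alpha p.1 by rewrite lt_neqAle eq_sym ap.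
rewrite -(ler_pM2l ap0).
have := sqr_ge0 (kappa * alpha' p.1 - a k * alpha p.1).
have : kappa ^+ 2 * alpha' p.1 ^+ 2 <= kappa ^+ 2 * (C * alpha p.1).
  by rewrite ler_wpM2l// sqr_ge0.
lra.
Qed.

(** The mass on the boundary stays in place; [alpha t] is the share that is boundary mass at
    time [t], the rest counting as bulk mass.  The bound on [alpha'] by the square root of
    [alpha] is what keeps the action finite when [alpha] reaches zero. *)
Lemma linked_exchange :
  linked Omega kappa (kappa ^+ 2 * C / 2 * fine (base m setT))
    (fun u => (1 - alpha 0) * \int[m]_(z in bdry Omega) u z,
     fun u => alpha 0 * \int[m]_(z in bdry Omega) u z)
    (fun u => (1 - alpha 1) * \int[m]_(z in bdry Omega) u z,
     fun u => alpha 1 * \int[m]_(z in bdry Omega) u z).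
Proof.
exists exch_evo, 0, (kappa ^+ 2 * C / 2 * fine (base m setT)); split; rewrite ?add0r//.
move=> phi c1.
have [fc fd fD] := (C1P phi).1 c1.
have [M fM] := continuous_compact_bounded fc (compact_Qbdry hOmega).
have int_at (t : R) : 0 <= t <= 1 ->
    m.-integrable (K : set (space R d)) (EFin \o (fun z => phi (t, z))).
  move=> t01; apply: (continuous_integrable_on (M := M)) => //.
    move=> z; apply: (@continuous_comp _ _ _ (fun z => (t, z)) phi); last exact: fc.
    by apply: continuous_pair; [exact: cst_continuous|exact: cvg_id].
  by move=> z Kz; apply: fM; split => //=; rewrite in_itv.
have t0 : 0 <= (0 : R) <= 1 by rewrite lexx ler01.
have t1 : 0 <= (1 : R) <= 1 by rewrite lexx ler01.
have bpt : bmeas (on_bdry Omega (partial_t phi)).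
  by apply: bmeas_on_bdry => //; exact: C1_continuous_partial_t.
have bphi : bmeas (on_bdry Omega phi) by exact: bmeas_on_bdry.
have [LD LZ _] := bounded_linear_Rintegral (R := R) (base m).
have cslice (u : R * 'rV[R]_d -> R) z : continuous u -> continuous (fun t => u (t, z)).
  move=> cu t; apply: (@continuous_comp _ _ _ (fun t => (t, z)) u); last exact: cu.
  by apply: continuous_pair; [exact: cvg_id|exact: cst_continuous].
have dslice z t : is_derive t (1 : R) (fun t => phi (t, z)) (partial_t phi (t, z)).
  have := @is_derive_line _ _ phi (0, z) (1, 0) t.
  rewrite (_ : (fun h : R => _) = (fun t => phi (t, z))); last first.
    apply/funext => s; congr phi; congr pair; last by rewrite /= scaler0 add0r.
    by rewrite /= addr0 /GRing.scale/= mulr1.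
  rewrite (_ : t *: _ + _ = (t, z)).
    by apply; exact: fd.
  congr pair; last by rewrite /= scaler0 add0r.
  by rewrite /= addr0 /GRing.scale/= mulr1.
(* Both equations are instances of the product rule for [phi * u] in time. *)
have key (u u' : R -> R) : continuous u -> continuous u' ->
    (forall t, is_derive t (1 : R) u (u' t)) ->
    \int[base m]_p (on_bdry Omega (partial_t phi) p * prof u p) +
    \int[base m]_p (on_bdry Omega phi p * prof u' p) =
    u 1 * \int[m]_(z in K) phi (1, z) - u 0 * \int[m]_(z in K) phi (0, z).
  move=> cu cu' du; rewrite -LD; last 2 first.
  - by apply: bmeasM => //; exact: b_prof.
  - by apply: bmeasM => //; exact: b_prof.
  pose g (p : R * 'rV[R]_d) := partial_t phi p * u p.1 + phi p * u' p.1.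
  have cg : continuous g.
    move=> p; apply: cvgD; apply: cvgM; try exact: lift_t; try exact: fc.
    exact: C1_continuous_partial_t.
  rewrite (_ : (fun p => _) = on_bdry Omega g); last first.
    apply/funext => p; rewrite /prof /on_bdry !patchE; case: ifPn => // _.
    by rewrite !mulr0 addr0.
  have dg z t : K z -> is_derive t (1 : R) (fun t => phi (t, z) * u t) (g (t, z)).
    move=> Kz; have dp := dslice z t; have du' := du t.
    rewrite (_ : g _ = phi (t, z) *: u' t + u t *: partial_t phi (t, z)).
      exact: is_deriveM.
    by rewrite /g /GRing.scale/=; ring.
  rewrite (base_FTC mK (bmeas_on_bdry hOmega cg) dg); last by move=> z Kz; exact: cslice.
  rewrite RintegralB//.
  + by rewrite !RintegralZr//; [rewrite mulrC; congr (_ - _); rewrite mulrC|exact: int_at|exact: int_at].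
  + rewrite (_ : _ \o _ = (fun z => (phi (1, z))%:E * (u 1)%:E)%E) //.
    by apply: integrableZr => //; exact: int_at.
  + rewrite (_ : _ \o _ = (fun z => (phi (0, z))%:E * (u 0)%:E)%E) //.
    by apply: integrableZr => //; exact: int_at.
split.
- have bb : bmeas (on_bulk Omega (partial_t phi)).
    by apply: bmeas_on_bulk => //; exact: C1_continuous_partial_t.
  rewrite /bulk_lhs/= cint_cdensity// cint_cdensity// big1 ?addr0; last first.
    by move=> i _; rewrite cint_czero//; exact: bmeas_on_bulk_grad.
  have cN : continuous (fun t => - alpha' t) by move=> t; apply: cvgN; exact: calpha'.
  have dN t : is_derive t (1 : R) (fun t => 1 - alpha t) (- alpha' t).
    have dt := dalpha t; rewrite -[X in is_derive _ _ _ X]add0r.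
    have d1 : is_derive t (1 : R) (cst (1 : R)) 0 by exact: is_derive_cst.
    exact: (is_deriveB d1 dt).
  have := key _ _ cbeta cN dN.
  rewrite (_ : (fun p => on_bdry Omega phi p * prof _ p) =
      (fun p => (-1) * (on_bdry Omega phi p * prof alpha' p))); last first.
    apply/funext => p; rewrite /prof /on_bdry !patchE; case: ifPn => _; last by rewrite !mulr0.
    by ring.
  rewrite LZ; last by apply: bmeasM => //; exact: b_prof.
  rewrite mulN1r => <-; congr (_ - _); apply: eq_Rintegral => p _.
  rewrite /prof /on_bulk /on_bdry !patchE; case: ifPn => [pQ|nQ].
    by case: ifPn => // _; rewrite [LHS]mulr0 [RHS]mulr0.
  rewrite [in RHS]ifF ?[RHS]mul0r ?[LHS]mul0r//; apply/negbTE; apply: contraNN nQ.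
  by rewrite !inE => -[t01 [cx _]].
- rewrite /bdry_lhs/= cint_cdensity// cint_cdensity// big1 ?addr0; last first.
    by move=> i _; rewrite cint_czero//; exact: bmeas_on_bdry_tgrad.
  exact: key.
Qed.

End exchange.

End building_blocks.

(** * Finite cost between any two configurations *)

Section segments.
Context {R : realType} {d : nat}.
Variables (Omega : set 'rV[R]_d).
Hypothesis hOmega : smooth_bounded_domain Omega.

Let oOmega : open Omega. Proof. by case: hOmega. Qed.

Lemma ball_segment (x z y : 'rV[R]_d) (e t : R) : 0 <= t <= 1 ->
  ball x e z -> ball x e y -> ball x e (t *: (y - z) + z).
Proof.
move=> /andP[t0 t1]; rewrite -!ball_normE /= => xz xy.
have -> : x - (t *: (y - z) + z) = (1 - t) *: (x - z) + t *: (x - y).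
  by apply/rowP => i; rewrite !mxE; ring.
apply: le_lt_trans (ler_normD _ _) _; rewrite !normrZ (ger0_norm t0) ger0_norm ?subr_ge0//.
have [->|t_neq1] := eqVneq t 1; first by rewrite subrr mul0r add0r mul1r.
have : 0 < 1 - t by rewrite subr_gt0 lt_neqAle t_neq1.
nra.
Qed.

Definition star_shaped_at (x : 'rV[R]_d) := exists U y, [/\ open U, U x, Omega y &
  forall z t, U z -> closure Omega z -> 0 <= t <= 1 -> closure Omega (t *: (y - z) + z)].

Lemma star_shaped_interior x : Omega x -> star_shaped_at x.
Proof.
move=> Ox; have /nbhs_ballP[e /= e0 eO] := open_nbhs_nbhs (conj oOmega Ox).
exists (ball x e), x; split => //; [exact: ball_open|exact: ballxx|].
move=> z t xz _ t01; apply: subset_closure; apply: eO; apply: ball_segment => //.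
exact: ballxx.
Qed.

(** Let [w] point into the domain at [x].  For a small [s], all segments from closure points
    close to [x] to [y = s *: w + x] have directions close to [w], along which the defining
    function decreases near [x]. *)
Lemma star_shaped_bdry x : bdry Omega x -> star_shaped_at x.
Proof.
move=> bx; have [U0 [g l]] := bdry_defining hOmega bx.
have [oU Ux gs gO _] := l.
have g0 := defining_grad_neq0 l.
pose w := - grad g x.
have : \forall p \near (w, x), U0 p.2 /\ dot p.1 (grad g p.2) < 0.
  apply: filterI.
    have c : {for (w, x), continuous (snd : 'rV[R]_d * 'rV[R]_d -> 'rV[R]_d)} by exact: cvg_snd.
    exact: (c U0 (open_nbhs_nbhs (conj oU Ux))).
  have c : {for (w, x), continuous (fun p : 'rV[R]_d * 'rV[R]_d => dot p.1 (grad g p.2))}.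
    apply: continuous_dot; first exact: cvg_fst.
    apply: (@continuous_comp _ _ _ snd (grad g)); first exact: cvg_snd.
    exact: (continuous_defining_grad l (y := x)).
  apply: (c [set r | r < 0]); apply: open_nbhs_nbhs; split; first exact: open_lt.
  by rewrite /= dotNl oppr_lt0 dot_gt0.
move=> /nbhs_ballP[r /= r0 rP].
have near_x (w' z : 'rV[R]_d) : `|w - w'| < r -> `|x - z| < r -> U0 z /\ dot w' (grad g z) < 0.
  by move=> h1 h2; apply: (rP (w', z)); split; rewrite -ball_normE.
pose N := `|w| + r; have N0 : 0 < N by rewrite ltr_wpDl.
(* segments of length [s * N] stay within [r / 2] of their origin *)
pose s := r / (2 * (N + 1)).
have s0 : 0 < s by rewrite divr_gt0// mulr_gt0// addr_gt0.
have sE : s * (2 * (N + 1)) = r by rewrite divfK// gt_eqF// mulr_gt0// addr_gt0.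
have sN : s * N < r / 2 by nra.
have s1 : s < 1 / 2.
  have rN : r <= N by rewrite /N lerDr.
  nra.
pose y := s *: w + x.
have seg z t : `|x - z| < s * r -> closure Omega z -> 0 < t <= 1 -> Omega (t *: (y - z) + z).
  move=> xz cz /andP[t0 t1].
  pose w' := w + s^-1 *: (x - z).
  have yz : y - z = s *: w'.
    by rewrite /y /w' scalerDr scalerA divff ?gt_eqF// scale1r addrA.
  have ww : `|w - w'| < r.
    rewrite /w' opprD addrA subrr add0r normrN normrZ gtr0_norm ?invr_gt0//.
    by rewrite mulrC ltr_pdivrMr// mulrC.
  have Nw : `|w'| < N.
    rewrite -[w'](subrK w); apply: le_lt_trans (ler_normD _ _) _.
    by rewrite /N addrC ltrD2l -opprB normrN.
  have onU c : `|c| <= `|t * s| -> `|x - (c *: w' + z)| < r.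
    move=> ct; rewrite opprD addrCA addrC; apply: le_lt_trans (ler_normD _ _) _.
    rewrite normrN normrZ.
    have cs : `|c| <= s.
      by apply: le_trans ct _; rewrite normrM !gtr0_norm//; nra.
    have : `|c| * `|w'| <= s * N by rewrite ler_pM// ltW.
    have : s * r < r / 2 by nra.
    by lra.
  rewrite yz scalerA; set h := t * s.
  have h0 : 0 < h by rewrite mulr_gt0.
  have [c ch] : exists2 c : R, `|c| <= `|h| & g (h *: w' + z) - g z = 'D_w' g (c *: w' + z) * h.
    apply: line_MVT => c ch; have [Uc _] := near_x _ _ ww (onU c ch).
    exact: (Ck_on1_derivable (defining_C1 l)).
  have [Uc Dc] := near_x _ _ ww (onU c ch).
  have [Uh _] := near_x _ _ ww (onU h (lexx _)).
  have [Uz _] : U0 z /\ dot w (grad g z) < 0.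
    apply: near_x; first by rewrite subrr normr0.
    by apply: lt_trans xz _; nra.
  rewrite (defining_derive l)// => E.
  apply/(gO _ Uh); have := defining_le0 l cz Uz.
  have : dot w' (grad g (c *: w' + z)) * h < 0 by rewrite pmulr_llt0.
  by rewrite -E; lra.
have cx : closure Omega x by case: bx.
exists (ball x (s * r)), y; split.
- exact: ball_open.
- by apply: ballxx; rewrite mulr_gt0.
- have := seg x 1; rewrite subrr normr0 mulr_gt0// scale1r subrK; apply => //.
  by rewrite ltr01 lexx.
- move=> z t; rewrite -ball_normE/= => xz cz /andP[t0 t1].
  have [->|t_neq0] := eqVneq t 0; first by rewrite scale0r add0r.
  by apply: subset_closure; apply: seg => //; rewrite lt_neqAle eq_sym t_neq0 t0.
Qed.

(** The part of [A] where [P] holds and the part where it fails are both open. *)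
Lemma connected_spread (A P : set 'rV[R]_d) y0 : open A -> connected A -> A y0 -> P y0 ->
  (forall y y' e, ball y e `<=` A -> ball y e y' -> P y <-> P y') -> A `<=` P.
Proof.
move=> oA cA Ay0 Py0 spread.
have ballA y : A y -> exists2 e : R, 0 < e & ball y e `<=` A.
  by move=> Ay; have /nbhs_ballP := open_nbhs_nbhs (conj oA Ay).
have open_of (Q : set 'rV[R]_d) : (forall y y' e, ball y e `<=` A -> ball y e y' -> Q y -> Q y') ->
    open (A `&` Q).
  move=> sQ; rewrite openE => y [Ay Qy]; have [e e0 eA] := ballA y Ay.
  apply/nbhs_ballP; exists e => // y' yy'; split; first exact: eA.
  exact: (sQ y y' e).
rewrite -(_ : A `&` P = A) => [|]; first exact: subIsetr.
apply: cA.
- by exists y0.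
- exists (A `&` P); last by rewrite setIA setIid.
  by apply: open_of => y y' e eA yy' Py; apply/(spread y y' e).
- exists (~` (A `&` ~` P)).
    apply: open_closedC; apply: open_of => y y' e eA yy' nPy Py'; apply: nPy.
    by apply/(spread y y' e).
  apply/seteqP; split=> y [Ay Py]; split => //; first by move=> [].
  by apply: contrapT => nPy; apply: Py.
Qed.

End segments.

Section finite_distance.
Context {R : realType} {d : nat}.
Variables (Omega : set 'rV[R]_d).
Hypothesis hOmega : smooth_bounded_domain Omega.
Variables (kappa : R).
Implicit Types (m : {finite_measure set space R d -> \bar R}) (e : @endpoint R d).
Local Notation linked := (linked Omega kappa).

(** Endpoints are compared on slices of test functions only, which are continuous. *)
Lemma linked_ext c e0 e1 e0' e1' :
  (forall u, continuous u -> e0.1 u = e0'.1 u /\ e0.2 u = e0'.2 u) ->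
  (forall u, continuous u -> e1.1 u = e1'.1 u /\ e1.2 u = e1'.2 u) ->
  linked c e0 e1 -> linked c e0' e1'.
Proof.
move=> E0 E1 [mu [c1 [c2 [adm b1 b2 cc con]]]]; exists mu, c1, c2; split => //.
move=> phi c1phi; have [-> ->] := con phi c1phi.
have cphi t : continuous (fun x => phi (t, x)).
  move=> x; apply: (@continuous_comp _ _ _ (fun x : 'rV[R]_d => (t, x)) phi).
    by apply: continuous_pair; [exact: cst_continuous|exact: cvg_id].
  exact: C1_continuous.
by have [-> ->] := E0 _ (cphi 0); have [-> ->] := E1 _ (cphi 1).
Qed.

Lemma linked_chain c c' e0 e1 e2 : linked c e0 e1 -> linked c' e1 e2 ->
  exists c'', linked c'' e0 e2.
Proof.
by move=> l l'; eexists; apply: (@linked_trans _ _ _ hOmega _ _ _ _ _ _ (1 / 2) _ l l'); lra.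
Qed.

Definition point_end y (a : R) : @endpoint R d := (fun u => u y * a, fun=> 0).

Lemma point_join m K y y' : measurable (K : set (space R d)) ->
  (forall t, 0 <= t <= 1 -> closure Omega (t *: (y' - y) + y)) ->
  exists c, linked c (point_end y (fine (m K))) (point_end y' (fine (m K))).
Proof.
move=> mK seg; have cX : continuous (cst y : 'rV[R]_d -> 'rV[R]_d) by exact: cst_continuous.
have cV : continuous (cst (y' - y) : 'rV[R]_d -> 'rV[R]_d) by exact: cst_continuous.
eexists; apply: (linked_ext _ _ (linked_move hOmega kappa m mK cX cV (dot_ge0 (y' - y)) _ _)) => //.
- by move=> u cu; split => //=; rewrite Rintegral_cst.
- by move=> u cu; split => //=; rewrite subrK Rintegral_cst.
- by move=> z t _; exact: seg.
Qed.

Lemma points_joined m K y0 y : measurable (K : set (space R d)) -> Omega y0 -> Omega y ->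
  exists c, linked c (point_end y0 (fine (m K))) (point_end y (fine (m K))).
Proof.
move=> mK Oy0; have [_ oO cO _ _] := hOmega.
have step z z' (e : R) : ball z e `<=` Omega -> ball z e z' ->
    exists c, linked c (point_end z (fine (m K))) (point_end z' (fine (m K))).
  move=> eO zz'; apply: point_join => // t t01.
  apply: subset_closure; apply: eO; apply: ball_segment => //.
  by apply: ballxx; move: zz'; rewrite -ball_normE /=; exact: le_lt_trans.
apply: (@connected_spread R d Omega
  (fun y => exists c, linked c (point_end y0 (fine (m K))) (point_end y (fine (m K)))) y0) => //.
  by apply: point_join => // t _; rewrite subrr scaler0 add0r; exact: subset_closure.
move=> z z' e eO zz'; have [c lc] := step z z' e eO zz'.
split=> -[c' lc']; first exact: linked_chain lc' lc.
exact: linked_chain lc' (linked_sym hOmega lc).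
Qed.

Lemma continuous_integrable_closure m (K : set 'rV[R]_d) u : measurable (K : set (space R d)) ->
  K `<=` closure Omega -> continuous u -> m.-integrable (K : set (space R d)) (EFin \o u).
Proof.
move=> mK KO cu.
have [M uM] := continuous_compact_bounded cu (compact_closure_domain hOmega).
by apply: (continuous_integrable_on m mK cu (M := M)) => x /KO; exact: uM.
Qed.

Definition part_end m K : @endpoint R d := (fun u => \int[m]_(z in K) u z, fun=> 0).

(** Cover the domain by finitely many sets that see an interior point along segments, and
    peel off the part of [K] in the first of them: this part moves to its interior point
    and from there to [y0]. *)
Lemma linked_to_point m K y0 : Omega y0 -> measurable (K : set (space R d)) ->
  K `<=` closure Omega -> exists c, linked c (part_end m K) (point_end y0 (fine (m K))).
Proof.
move=> Oy0.
have st x : closure Omega x -> star_shaped_at Omega x.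
  by case/(closure_split hOmega); [exact: star_shaped_interior|exact: star_shaped_bdry].
have /choice[U /choice[y Uy]] : forall x, exists U y, closure Omega x ->
    [/\ open U, U x, Omega y &
    forall z t, U z -> closure Omega z -> 0 <= t <= 1 -> closure Omega (t *: (y - z) + z)].
  move=> x; have [/st[U [y H]]|nx] := pselect (closure Omega x); first by exists U, y.
  by exists set0, 0.
have := compact_closure_domain hOmega; rewrite compact_cover.
move=> /(_ _ (closure Omega) U)[].
- by move=> x /Uy[].
- by move=> x cx; exists x => //; case: (Uy x cx).
move=> D Dcl cov mK KO.
have {cov} KU z : K z -> exists2 x, x \in finmap.enum_fset D & U x z.
  by move=> /KO/cov[x /= xD Uz]; exists x.
have {}Dcl x : x \in finmap.enum_fset D -> closure Omega x by move=> /Dcl; rewrite inE.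
elim: (finmap.enum_fset D) K mK KO Dcl KU => [|x s ih] K mK KO scl KU.
  have K0 : K = set0 by rewrite -subset0 => z /KU[].
  have [c l] := points_joined m measurable0 Oy0 Oy0.
  exists c; apply: linked_ext l => u cu; split => //=; rewrite K0 ?Rintegral_set0 measure0/=.
    by rewrite mulr0.
  by [].
have [oU Ux Oy Uy2] := Uy x (scl x (mem_head _ _)).
have mU : measurable (U x : set (space R d)) by exact: space_open_measurable.
pose K1 := K `&` U x; pose K2 := K `\` U x.
have mK1 : measurable (K1 : set (space R d)) by exact: measurableI.
have mK2 : measurable (K2 : set (space R d)) by exact: measurableD.
have K1O : K1 `<=` closure Omega by move=> z [/KO].
have K2O : K2 `<=` closure Omega by move=> z [/KO].
have [c2 l2] : exists c, linked c (part_end m K2) (point_end y0 (fine (m K2))).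
  apply: ih => //; first by move=> z zs; apply: scl; rewrite inE zs orbT.
  move=> z [/KU[x']]; rewrite inE => /predU1P[->//|xs] Uz _; by exists x'.
have [c1 l1] : exists c, linked c (part_end m K1) (point_end (y x) (fine (m K1))).
  have cX : continuous (fun z : 'rV[R]_d => z) by move=> z; exact: cvg_id.
  have cV : continuous (fun z : 'rV[R]_d => y x - z).
    by move=> z; apply: (@continuousB _ _ _ (cst (y x)) id); [exact: cst_continuous|exact: cvg_id].
  have cVV : continuous (fun z : 'rV[R]_d => dot (y x - z) (y x - z)).
    by move=> z; exact: (continuous_dot (cV z) (cV z)).
  have [M VM] := continuous_compact_bounded cVV (compact_closure_domain hOmega).
  eexists; apply: (linked_ext _ _ (linked_move hOmega kappa m mK1 cX cV (normr_ge0 M) _ _)) => //.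
  - move=> u cu; split => //=; rewrite -Rintegral_cst//.
    by apply: eq_Rintegral => z _; rewrite subrK.
  - by move=> z t [Kz Uz] t01; apply: Uy2 => //; exact: KO.
  - move=> z [Kz Uz]; apply: le_trans (ler_norm _) _; apply: le_trans (VM z (KO z Kz)) _.
    exact: ler_norm.
have [c3 l3] := points_joined m mK1 Oy Oy0.
have [c4 l4] := linked_chain l1 l3.
exists (c4 + c2); apply: linked_ext (linked_add hOmega l4 l2).
- move=> u cu; split => /=; last by rewrite addr0.
  rewrite -Rintegral_setU//.
  + by rewrite /K1 /K2 setUIDK.
  + by rewrite /K1 /K2 setUIDK; exact: continuous_integrable_closure.
  + by apply/disj_set2P; rewrite /K1 /K2 setDE setIACA setICr setI0.
- move=> u cu; split => /=; last by rewrite addr0.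
  rewrite -mulrDr -fineD ?fin_num_measure// -measureU//.
  + by rewrite /K1 /K2 setUIDK.
  + by rewrite /K1 /K2 setDE setIACA setICr setI0.
Qed.

Definition rho_end (rho : Poplus Omega) : @endpoint R d :=
  (fun u => \int[bulk_part rho]_(z in closure Omega) u z,
   fun u => \int[bdry_part rho]_(z in bdry Omega) u z).

Let mcl : measurable (closure Omega : set (space R d)).
Proof. by apply: space_closed_measurable; exact: closed_closure. Qed.

Let mbd : measurable (bdry Omega : set (space R d)).
Proof. by apply: space_closed_measurable; exact: closed_bdry. Qed.

Lemma bulk_static m : linked 0 (part_end m (closure Omega)) (part_end m (closure Omega)).
Proof.
have cX : continuous (fun z : 'rV[R]_d => z) by move=> z; exact: cvg_id.
have cV : continuous (cst 0 : 'rV[R]_d -> 'rV[R]_d) by exact: cst_continuous.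
have V1 z t : closure Omega z -> 0 <= t <= 1 -> closure Omega (t *: (0 : 'rV[R]_d) + z).
  by move=> Oz _; rewrite scaler0 add0r.
have V2 z : closure Omega z -> dot (0 : 'rV[R]_d) 0 <= 0 by rewrite dot0r.
have := linked_move hOmega kappa m mcl cX cV (lexx 0) V1 V2.
rewrite !mul0r; apply: linked_ext => // u cu; split => //=.
by apply: eq_Rintegral => z _; rewrite add0r.
Qed.

Definition bdry_end m : @endpoint R d := (fun=> 0, fun u => \int[m]_(z in bdry Omega) u z).

Lemma bdry_static m : linked 0 (bdry_end m) (bdry_end m).
Proof.
have d1 t : is_derive t (1 : R) (cst (1 : R)) 0 by exact: is_derive_cst.
have c0 : continuous (cst 0 : R -> R) by exact: cst_continuous.
have a01 (t : R) : 0 <= t <= 1 -> 0 <= cst (1 : R) t <= 1 by rewrite /= ler01 lexx.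
have aC (t : R) : 0 <= t <= 1 -> (cst (0 : R) t) ^+ 2 <= 0 * cst (1 : R) t.
  by rewrite /= expr0n/= mul0r.
have := linked_exchange hOmega kappa m d1 c0 (lexx 0) a01 aC.
by rewrite mulr0 !mul0r; apply: linked_ext => u cu; split => /=; rewrite ?subrr ?mul0r ?mul1r.
Qed.

(** Let the boundary mass decay like [(1 - t) ^+ 2]: the square of its speed is four times
    the mass left, so that the cost stays finite although all mass is gone at the end. *)
Lemma bdry_release m : exists c, linked c (bdry_end m) (part_end m (bdry Omega)).
Proof.
have da t : is_derive t (1 : R) (fun t => (1 - t) ^+ 2) (2 * (t - 1)).
  have d0 : is_derive t (1 : R) (cst (1 : R)) 0 by exact: is_derive_cst.
  have di : is_derive t (1 : R) (id : R -> R) 1 by exact: is_derive_id.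
  have d1 : is_derive t (1 : R) (fun t : R => 1 - t) (0 - 1) by exact: (is_deriveB d0 di).
  have := is_deriveX 2 d1.
  rewrite [X in is_derive _ _ _ X -> _](_ : _ = 2 * (t - 1)); last first.
    by rewrite /GRing.scale/= expr1; ring.
  by rewrite (_ : (fun t : R => 1 - t) ^+ 2 = (fun t => (1 - t) ^+ 2))//; apply/funext => s; rewrite fctE.
have ca : continuous (fun t : R => 2 * (t - 1)).
  by move=> t; apply: cvgM; [exact: cvg_cst|apply: cvgB; [exact: cvg_id|exact: cvg_cst]].
have C4 : 0 <= 4 :> R by [].
have a01 (t : R) : 0 <= t <= 1 -> 0 <= (1 - t) ^+ 2 <= 1 by nra.
have aC (t : R) : 0 <= t <= 1 -> (2 * (t - 1)) ^+ 2 <= 4 * (1 - t) ^+ 2 by nra.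
eexists; apply: linked_ext (linked_exchange hOmega kappa m da ca C4 a01 aC).
- by move=> u cu; split => /=; rewrite subr0 expr1n ?subrr ?mul0r ?mul1r.
- by move=> u cu; split => /=; rewrite subrr expr0n/= ?subr0 ?mul0r ?mul1r.
Qed.

Lemma linked_static (rho : Poplus Omega) : linked 0 (rho_end rho) (rho_end rho).
Proof.
rewrite -[0]addr0.
apply: linked_ext (linked_add hOmega (bulk_static (bulk_part rho)) (bdry_static (bdry_part rho))).
- by move=> u _; split; rewrite /= ?addr0 ?add0r.
- by move=> u _; split; rewrite /= ?addr0 ?add0r.
Qed.

Lemma mass_split (rho : Poplus Omega) :
  fine (bulk_part rho (closure Omega)) + fine (bdry_part rho (bdry Omega)) = 1.
Proof.
rewrite -fineD ?fin_num_measure//.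
have conc (nu : {finite_measure set space R d -> \bar R}) K : measurable (K : set (space R d)) ->
    concentrated_on nu K -> nu K = nu setT.
  move=> mK cK; rewrite -(setUv K) measureU// ?setICr//; last exact: measurableC.
  by rewrite [X in (_ + X)%E](cK (~` K)) ?adde0//; [exact: measurableC|rewrite setICl].
rewrite (conc _ _ mcl (bulk_part_concentrated rho)) (conc _ _ mbd (bdry_part_concentrated rho)).
by have := total_mass rho; rewrite /measure_add/= /msum !big_ord_recl big_ord0/= adde0 => ->.
Qed.

Lemma linked_hub (rho : Poplus Omega) y0 : Omega y0 ->
  exists c, linked c (rho_end rho) (point_end y0 1).
Proof.
move=> Oy0.
have [c1 l1] := bdry_release (bdry_part rho).
have [c2 l2] := linked_to_point (bulk_part rho) Oy0 mcl (@subset_refl _ _).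
have [c3 l3] := linked_to_point (bdry_part rho) Oy0 mbd (@subIsetl _ _ _).
have [c l] := linked_chain (linked_add hOmega (bulk_static (bulk_part rho)) l1) (linked_add hOmega l2 l3).
exists c; apply: linked_ext l => u cu; split; rewrite /= ?addr0 ?add0r//.
by rewrite -mulrDr mass_split.
Qed.

(** Both configurations can be brought to the same point mass in the domain. *)
Lemma linked_any (rho sigma : Poplus Omega) : exists c, linked c (rho_end rho) (rho_end sigma).
Proof.
have [[y0 Oy0] _ _ _ _] := hOmega.
have [c l] := linked_hub rho Oy0; have [c' l'] := linked_hub sigma Oy0.
exact: linked_chain l (linked_sym hOmega l').
Qed.

End finite_distance.

(** * Functions of class C^1 determine finite measures *)

Section C1_closure.
Context {R : realType} {V : normedModType R}.
Implicit Types (f g S : V -> R) (x v : V).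

(** One-variable differentiation rules apply along lines; this brings their results back to
    directional derivatives. *)
Lemma derive_of_line f x v (L : R) :
  is_derive (0 : R) (1 : R) (fun h : R => f (h *: v + x)) L ->
  derivable f x v /\ 'D_v f x = L.
Proof.
move=> [d1 d2]; have dd : derivable f x v by exact/derivable1P.
split => //; have := @is_derive_line _ _ f x v 0.
by rewrite scale0r add0r => /(_ dd) [_ <-]; rewrite d2.
Qed.

Lemma C1_cst (c : R) : C1 (cst c : V -> R).
Proof.
apply/C1P; split.
- exact: cst_continuous.
- by move=> x v; exact: derivable_cst.
- move=> v; rewrite (_ : 'D_v _ = cst 0); first exact: cst_continuous.
  by apply/funext => x; exact: derive_cst.
Qed.

Lemma C1_add f g : C1 f -> C1 g -> C1 (fun x => f x + g x).
Proof.
move=> /C1P[cf df Df] /C1P[cg dg Dg]; apply/C1P; split.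
- by move=> x; apply: cvgD; [exact: cf|exact: cg].
- by move=> x v; apply: derivableD.
- move=> v; rewrite (_ : 'D_v _ = fun x => 'D_v f x + 'D_v g x).
    by move=> x; apply: cvgD; [exact: Df|exact: Dg].
  by apply/funext => x; exact: deriveD.
Qed.

Lemma C1_sum (I : Type) (s : seq I) (F : I -> V -> R) : (forall i, C1 (F i)) ->
  C1 (fun x => \sum_(i <- s) F i x).
Proof.
move=> cF; elim: s => [|i s ih].
  by rewrite (_ : (fun x => _) = cst 0); [exact: C1_cst|apply/funext => x; rewrite big_nil].
rewrite (_ : (fun x => _) = fun x => F i x + \sum_(j <- s) F j x); first exact: C1_add.
by apply/funext => x; rewrite big_cons.
Qed.

Lemma C1_comp (h h' : R -> R) S : (forall t, is_derive t (1 : R) h (h' t)) ->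
  continuous h' -> C1 S -> C1 (fun x => h (S x)).
Proof.
move=> dh ch' /C1P[cS dS DS].
have ch : continuous h.
  by move=> t; apply/differentiable_continuous/derivable1_diffP; case: (dh t).
have D x v : derivable (fun x => h (S x)) x v /\
    'D_v (fun x => h (S x)) x = h' (S x) * 'D_v S x.
  apply: derive_of_line.
  have d0 : is_derive (0 : R) (1 : R) (fun s : R => S (s *: v + x)) ('D_v S x).
    by have := @is_derive_line _ _ S x v 0; rewrite scale0r add0r; apply.
  have d1 : is_derive (S (0 *: v + x)) (1 : R) h (h' (S x)).
    by rewrite scale0r add0r; exact: dh.
  exact: (is_derive1_comp d1 d0).
apply/C1P; split.
- by move=> x; apply: (@continuous_comp _ _ _ S h); [exact: cS|exact: ch].
- by move=> x v; case: (D x v).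
- move=> v; rewrite (_ : 'D_v _ = fun x => h' (S x) * 'D_v S x).
    move=> x; apply: cvgM; last exact: DS.
    by apply: (@continuous_comp _ _ _ S h'); [exact: cS|exact: ch'].
  by apply/funext => x; case: (D x v).
Qed.

End C1_closure.

Section C1_examples.
Context {R : realType} {d : nat}.

Lemma C1_linear {V : normedModType R} (f : V -> R) : continuous f ->
  (forall (h : R) v x, f (h *: v + x) = h * f v + f x) -> C1 f.
Proof.
move=> cf lf.
have D x v : derivable f x v /\ 'D_v f x = f v.
  apply: derive_of_line.
  rewrite (_ : (fun h : R => _) = (fun h : R => f v * h + f x)); last first.
    by apply/funext => h; rewrite lf mulrC.
  have d1 : is_derive (0 : R) (1 : R) (fun h : R => f v *: h) (f v *: (1 : R)).
    exact: is_deriveZ.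
  have d2 : is_derive (0 : R) (1 : R) (cst (f x) : R -> R) 0 by exact: is_derive_cst.
  have := is_deriveD d1 d2; rewrite addr0 /GRing.scale/= mulr1.
  exact.
apply/C1P; split => //; first by move=> x v; case: (D x v).
move=> v; rewrite (_ : 'D_v _ = cst (f v)); first exact: cst_continuous.
by apply/funext => x; case: (D x v).
Qed.

Lemma C1_coord (i : 'I_d) : C1 (fun x : 'rV[R]_d => x 0 i).
Proof.
by apply: C1_linear => [|h v x]; [exact: continuous_coord|rewrite !mxE].
Qed.

Lemma C1_fst : C1 (fst : R * 'rV[R]_d -> R).
Proof. by apply: C1_linear => // p; exact: cvg_fst. Qed.

Lemma C1_snd (u : 'rV[R]_d -> R) : C1 u -> C1 (fun p : R * 'rV[R]_d => u p.2).
Proof. by apply: (@C1_affine _ _ _ snd snd) => // p; exact: cvg_snd. Qed.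

End C1_examples.

Section determination.
Context {R : realType} {d : nat}.

(** A smooth approximation of the indicator of [orthant a]: it tends to [1] where all
    coordinates exceed those of [a], and to [0] where some coordinate does not. *)
Definition soft_orthant (a : 'rV[R]_d) (n : nat) (x : 'rV[R]_d) : R :=
  expR (- \sum_i expR (n%:R - n%:R ^+ 2 * (x 0 i - a 0 i))).

Lemma C1_soft_orthant a n : C1 (soft_orthant a n).
Proof.
pose h (t : R) := expR (- t).
have dh t : is_derive t (1 : R) h (- h t).
  have dN : is_derive t (1 : R) (fun t : R => - t) (- 1).
    exact: (is_deriveN (is_derive_id t 1)).
  have dE : is_derive ((fun t : R => - t) t) (1 : R) expR (expR (- t)) by exact: is_derive_expR.
  by have := is_derive1_comp dE dN; rewrite mulrN1.
have ch : continuous h.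
  move=> t; apply: (@continuous_comp _ _ _ (fun t : R => - t) expR).
    exact: oppr_continuous.
  exact: continuous_expR.
have cNh : continuous (fun t => - h t) by move=> t; apply: cvgN; exact: ch.
pose l i (t : R) := n%:R - n%:R ^+ 2 * (t - a 0 i).
have dl i t : is_derive t (1 : R) (l i) (- n%:R ^+ 2).
  have d1 : is_derive t (1 : R) (fun t : R => (- n%:R ^+ 2) *: t) ((- n%:R ^+ 2) *: (1 : R)).
    exact: is_deriveZ.
  have d2 : is_derive t (1 : R) (cst (n%:R + n%:R ^+ 2 * a 0 i) : R -> R) 0 by exact: is_derive_cst.
  have := is_deriveD d1 d2; rewrite addr0 /GRing.scale/= mulr1.
  rewrite (_ : _ + _ = l i)//.
  by apply/funext => s; rewrite /l fctE/=; ring.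
have dg i t : is_derive t (1 : R) (fun t => expR (l i t)) (- n%:R ^+ 2 * expR (l i t)).
  have dE : is_derive (l i t) (1 : R) expR (expR (l i t)) by exact: is_derive_expR.
  by have := is_derive1_comp dE (dl i t); rewrite mulrC.
have ce i : continuous (fun t => expR (l i t)).
  by move=> t; apply/differentiable_continuous/derivable1_diffP; case: (dg i t).
have cg i : continuous (fun t => - n%:R ^+ 2 * expR (l i t)).
  by move=> t; apply: cvgM; [exact: cvg_cst|exact: ce].
have cS : C1 (fun x : 'rV[R]_d => \sum_i expR (l i (x 0 i))).
  by apply: C1_sum => i; exact: (C1_comp (dg i) (cg i) (C1_coord i)).
exact: (C1_comp dh cNh cS).
Qed.

Lemma soft_orthant_ge0 a n x : 0 <= soft_orthant a n x.
Proof. exact: expR_ge0. Qed.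

Lemma soft_orthant_le1 a n x : soft_orthant a n x <= 1.
Proof.
rewrite -expR0 ler_expR oppr_le0; apply: sumr_ge0 => i _; exact: expR_ge0.
Qed.

Lemma soft_orthant_cvg a x : soft_orthant a ^~ x @ \oo --> (\1_(orthant a) x : R).
Proof.
have small (n : nat) (t : R) : t <= - n%:R -> expR t <= harmonic n.
  move=> tn; apply: (@le_trans _ _ (expR (- n%:R))); first by rewrite ler_expR.
  rewrite expRN /harmonic lef_pV2 ?posrE ?expR_gt0//.
  by rewrite -natr1 addrC; exact: expR_ge1Dx.
have [xa|xa] := pselect (orthant a x).
  rewrite indicE mem_set//.
  have term i : expR (n%:R - n%:R ^+ 2 * (x 0 i - a 0 i)) @[n --> \oo] --> (0 : R).
    apply: (@squeeze_cvgr _ _ _ _ (cst 0) (@harmonic R)).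
    + have d0 : 0 < x 0 i - a 0 i by rewrite subr_gt0; exact: xa.
      exists (Num.truncn (2 / (x 0 i - a 0 i))).+1 => // n /= nk.
      rewrite expR_ge0/=; apply: small.
      have : 2 / (x 0 i - a 0 i) < n%:R.
        by apply: lt_le_trans (truncnS_gt _) _; rewrite ler_nat.
      rewrite ltr_pdivrMr// => n2.
      have n0 : 0 <= n%:R :> R by [].
      nra.
    + exact: cvg_cst.
    + exact: cvg_harmonic.
  have S0 : - \sum_i expR (n%:R - n%:R ^+ 2 * (x 0 i - a 0 i)) @[n --> \oo] --> (0 : R).
    rewrite -[X in _ --> X]oppr0; apply: cvgN.
    elim: (index_enum _) => [|i s ih].
      by under eq_fun do rewrite big_nil; exact: cvg_cst.
    under eq_fun do rewrite big_cons.
    by have := cvgD (term i) ih; rewrite addr0; exact.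
  rewrite [X in _ --> X](_ : _ = expR 0 :> R); last by rewrite expR0.
  have c0 : {for 0, continuous (@expR R)} by exact: continuous_expR.
  exact: (cvg_comp _ _ S0 c0).
rewrite indicE memNset//.
have [i xi] : exists i, x 0 i <= a 0 i.
  by apply: contrapT => ne; apply: xa => i; rewrite ltNge; apply/negP => xi; apply: ne; exists i.
apply: (@squeeze_cvgr _ _ _ _ (cst 0) (@harmonic R)).
- apply: nearW => n; rewrite soft_orthant_ge0/=; apply: small.
  rewrite lerN2 (bigD1 i)//= -[leLHS]addr0 lerD//; last first.
    by apply: sumr_ge0 => j _; exact: expR_ge0.
  have n0 : 0 <= n%:R :> R by [].
  apply: le_trans (expR_ge1Dx _).
  have : 0 <= n%:R ^+ 2 * (a 0 i - x 0 i) by rewrite mulr_ge0 ?sqr_ge0// subr_ge0.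
  lra.
- exact: cvg_cst.
- exact: cvg_harmonic.
Qed.

(** By dominated convergence along [soft_orthant], both measures agree on orthants. *)
Lemma eq_measure_C1 (m1 m2 : {finite_measure set space R d -> \bar R}) (K : set 'rV[R]_d) :
  closed K -> concentrated_on m1 K -> concentrated_on m2 K ->
  (forall u, C1 u -> \int[m1]_(x in K) u x = \int[m2]_(x in K) u x) ->
  forall A : set (space R d), measurable A -> m1 A = m2 A.
Proof.
move=> cK c1 c2 m12; apply: eq_measure_orthant => a.
have mK : measurable (K : set (space R d)) by exact: space_closed_measurable.
have mO : measurable (orthant a : set (space R d)).
  by apply: space_open_measurable; exact: open_orthant.
have cont n : continuous (soft_orthant a n) by have /C1P[] := C1_soft_orthant a n.
have key (m : {finite_measure set space R d -> \bar R}) : concentrated_on m K ->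
    (fun n => (\int[m]_(x in K) soft_orthant a n x)%:E) @ \oo --> m (orthant a).
  move=> cm.
  have int n : m.-integrable K (EFin \o soft_orthant a n).
    apply: (continuous_integrable_on m mK (cont n) (M := 1)) => x _.
    by rewrite ger0_norm ?soft_orthant_ge0// soft_orthant_le1.
  have [] := @dominated_convergence _ _ _ m K mK (fun n => EFin \o soft_orthant a n)
    (EFin \o \1_(orthant a)) (cst 1%E).
  - by move=> n; exact: (measurable_int m).
  - by apply/measurable_EFinP; apply: measurable_funTS; exact: measurable_indic.
  - apply: aeW => x Kx; apply: cvg_EFin; last exact: soft_orthant_cvg.
    by apply: nearW => n.
  - have c1' : continuous (cst 1 : 'rV[R]_d -> R) by exact: cst_continuous.
    by apply: (continuous_integrable_on m mK c1' (M := 1)) => x _; rewrite /= normr1.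
  - apply: aeW => x n Kx /=; rewrite lee_fin.
    by rewrite ger0_norm ?soft_orthant_ge0// soft_orthant_le1.
  - move=> _ _; rewrite integral_indic//.
    suff E : m (orthant a) = m (orthant a `&` K).
      rewrite E (_ : (fun n => (\int[m]_(x in K) soft_orthant a n x)%:E) =
        (fun n => \int[m]_(x in K) (EFin \o soft_orthant a n) x)%E); first exact.
      by apply/funext => n; rewrite EFin_Rintegral.
    rewrite -[in LHS](setUIDK (orthant a) K) measureU//; first last.
    - by rewrite setDE setIACA setICr setI0.
    - exact: measurableD.
    - exact: measurableI.
    rewrite [X in (_ + X)%E]cm ?adde0//; first exact: measurableD.
    by rewrite setDE -setIA setICl setI0.
have := key m1 c1; have := key m2 c2.
rewrite (_ : (fun n => (\int[m1]_(x in K) soft_orthant a n x)%:E) =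
  (fun n => (\int[m2]_(x in K) soft_orthant a n x)%:E)); last first.
  by apply/funext => n; rewrite m12//; exact: C1_soft_orthant.
by move=> h2 h1; exact: (cvg_unique _ h1 h2).
Qed.

End determination.

(** * Vanishing cost *)

Section total_variation.
Context {disp : measure_display} {T : measurableType disp} {R : realType}.

Lemma cint_le_hahn (nu : {charge set T -> \bar R}) : exists P N : set T,
  [/\ measurable P, measurable N, P `|` N = setT, P `&` N = set0 &
   forall f (B : R), bmeas f -> (forall x, `|f x| <= B) ->
     `|cint nu f| <= B * (fine (nu P) - fine (nu N))].
Proof.
set P := (proj1_sig (hahn_spec nu)).1; set N := (proj1_sig (hahn_spec nu)).2.
have [[mP Ppos] [mN Nneg] PUN PIN] := proj2_sig (hahn_spec nu).
exists P, N; split => // f B bf fB.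
have bd (m : {finite_measure set T -> \bar R}) : `|\int[m]_x f x| <= B * fine (m setT).
  rewrite -Rintegral_cst//; apply: le_trans (le_normr_Rintegral _ _) _ => //.
    exact: bmeas_integrable.
  apply: le_Rintegral => //.
    exact: integrable_norm (bmeas_integrable _ bf).
  exact: bmeas_integrable (bmeas_cst B).
rewrite cintE mulrBr; apply: le_trans (ler_normB _ _) _.
apply: le_trans (lerD (bd _) (bd _)) _.
have Ep : jordan_pos (proj2_sig (hahn_spec nu)) setT = nu P.
  by rewrite jordan_posE cjordan_posE /crestr0 mem_set// /crestr setTI.
have En : jordan_neg (proj2_sig (hahn_spec nu)) setT = (- nu N)%E.
  by rewrite jordan_negE cjordan_negE /crestr0 mem_set// /crestr setTI.
have E : B * fine (jordan_pos (proj2_sig (hahn_spec nu)) setT) +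
    B * fine (jordan_neg (proj2_sig (hahn_spec nu)) setT) = B * fine (nu P) - B * fine (nu N).
  by rewrite Ep En fineN mulrN.
by rewrite -E.
Qed.

End total_variation.

Section rigidity.
Context {R : realType} {d : nat}.
Variables (hd : (0 < d)%N) (Omega : set 'rV[R]_d).
Hypothesis hOmega : smooth_bounded_domain Omega.
Variables (kappa : R) (hkappa : 0 < kappa).
Implicit Types (mu : @evolution R d).

Lemma dot_delta (a : R) i (v : 'rV[R]_d) : dot (a *: delta_mx 0 i) v = a * v 0 i.
Proof.
rewrite dotZl /dot (bigD1 i)//= big1 ?addr0; last first.
  by move=> j ji; rewrite mxE (negbTE ji) andbF mul0r.
by rewrite mxE !eqxx mul1r.
Qed.

Lemma dot_delta2 (a : R) (i : 'I_d) : dot (a *: delta_mx 0 i) (a *: delta_mx 0 i) = a ^+ 2.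
Proof. by rewrite dot_delta !mxE !eqxx mulr1. Qed.

Lemma action_bound_ge0 mu c : bulk_action_le mu c -> 0 <= c.
Proof.
move=> /(_ 0%N (fun=> set0) (fun=> 0)); rewrite big_ord0; apply=> // i j _ _.
by rewrite setI0 => -[].
Qed.

Lemma bdry_action_bound_ge0 mu c : bdry_action_le kappa mu c -> 0 <= c.
Proof.
move=> /(_ 0%N (fun=> set0) (fun=> 0) (fun=> 0)); rewrite big_ord0; apply=> // i j _ _.
by rewrite setI0 => -[].
Qed.

(** Adding the inequalities for [M] and [- M] cancels the momentum and leaves
    [- M ^+ 2 * w <= 2 * c] for all [M]. *)
Lemma square_growth (w c J : R) :
  (forall M : R, M * J - M ^+ 2 / 2 * w <= c) -> 0 <= w.
Proof.
move=> H; have c0 : 0 <= c by have := H 0; rewrite expr0n/= !mul0r subr0.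
rewrite leNgt; apply/negP => w0.
pose M := 1 + (c + 1) / - w.
have M1 : 1 <= M by rewrite lerDl divr_ge0 ?oppr_ge0 ?ltW// ltr_wpDl.
have Mw : M * - w = - w + (c + 1) by rewrite mulrDl mul1r divfK// oppr_eq0 lt_eqF.
have := H M; have := H (- M); rewrite sqrrN => h1 h2.
have : M ^+ 2 * - w <= 2 * c by lra.
have : M * - w <= M ^+ 2 * - w.
  by rewrite expr2 -mulrA ler_peMl//; nra.
nra.
Qed.

Lemma mass_ge0 mu c A : measurable A -> bulk_action_le mu c -> 0 <= fine (evo_omega mu A).
Proof.
move=> mA bc; pose i := Ordinal hd.
apply: (@square_growth _ c (fine (evo_F mu i A))) => M.
have := bc 1%N (bigcup2 A set0) (fun=> M *: delta_mx 0 i).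
rewrite big_ord1 /affine_minorant dot_delta2 dot_delta mxE /=; apply.
- by case=> [|[|k]]//=.
- by rewrite -trivIset_bigcup2 setI0.
Qed.

Lemma bdry_mass_ge0 mu c A : measurable A -> bdry_action_le kappa mu c ->
  0 <= fine (evo_gamma mu A).
Proof.
move=> mA bc; pose i := Ordinal hd.
apply: (@square_growth _ c (fine (evo_G mu i A))) => M.
have := bc 1%N (bigcup2 A set0) (fun=> M *: delta_mx 0 i) (fun=> 0).
rewrite big_ord1 /affine_minorant dot_delta2 dot_delta mxE /=.
rewrite expr0n/= !(mulr0, mul0r) subr0 addr0; apply.
- by case=> [|[|k]]//=.
- by rewrite -trivIset_bigcup2 setI0.
Qed.

(** The hypothesis is the action tested with the slope [M] on one Hahn set of [nu] and [- M]
    on the other.  For a small action [c] and bounded mass, [M = Num.sqrt c] shows that the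
    total variation is of order [Num.sqrt c]. *)
Lemma variation_le (nu w : {charge set (spacetime R d) -> \bar R}) (a c M : R) : 0 < a -> 0 < M ->
  (forall E : nat -> set (spacetime R d), (forall k, measurable (E k)) -> trivIset setT E ->
    a * M * fine (nu (E 0%N)) - M ^+ 2 / 2 * fine (w (E 0%N)) +
    (a * - M * fine (nu (E 1%N)) - M ^+ 2 / 2 * fine (w (E 1%N))) <= c) ->
  forall f B, bmeas f -> (forall x, `|f x| <= B) ->
  `|cint nu f| <= B * ((c + M ^+ 2 / 2 * fine (w setT)) / (a * M)).
Proof.
move=> a0 M0 bc f B bf fB; have [P [N [mP mN PUN PIN H]]] := cint_le_hahn nu.
have B0 : 0 <= B by exact: le_trans (normr_ge0 _) (fB point).
apply: le_trans (H f B bf fB) _; rewrite ler_wpM2l// ler_pdivlMr ?mulr_gt0//.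
have -> : fine (w setT) = fine (w P) + fine (w N).
  by rewrite -PUN chargeU// fineD// fin_num_measure.
have := bc (bigcup2 P N) _ _; rewrite /= -trivIset_bigcup2 => bnd.
have := bnd _ PIN; have mE k : measurable (bigcup2 P N k) by case: k => [|[|k]]/=.
by move=> /(_ mE); lra.
Qed.

Let slope (M : R) (k : nat) : R := if k == 0%N then M else - M.

Lemma flux_le mu c i (M : R) : 0 < M -> bulk_action_le mu c ->
  forall f B, bmeas f -> (forall x, `|f x| <= B) ->
  `|cint (evo_F mu i) f| <= B * ((c + M ^+ 2 / 2 * fine (evo_omega mu setT)) / M).
Proof.
move=> M0 bc f B bf fB; rewrite -[X in _ / X]mul1r.
apply: variation_le => // E mE tE.
have := bc 2%N E (fun k => slope M k *: delta_mx 0 i) mE tE.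
rewrite !big_ord_recl big_ord0 /affine_minorant !dot_delta2 !dot_delta !mxE /slope /= sqrrN.
by lra.
Qed.

Lemma bdry_flux_le mu c i (M : R) : 0 < M -> bdry_action_le kappa mu c ->
  forall f B, bmeas f -> (forall x, `|f x| <= B) ->
  `|cint (evo_G mu i) f| <= B * ((c + M ^+ 2 / 2 * fine (evo_gamma mu setT)) / M).
Proof.
move=> M0 bc f B bf fB; rewrite -[X in _ / X]mul1r.
apply: variation_le => // E mE tE.
have := bc 2%N E (fun k => slope M k *: delta_mx 0 i) (fun=> 0) mE tE.
rewrite !big_ord_recl big_ord0 /affine_minorant !dot_delta2 !dot_delta !mxE /slope /= sqrrN.
by rewrite expr0n/=; lra.
Qed.

Lemma exchange_le mu c (M : R) : 0 < M -> bdry_action_le kappa mu c ->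
  forall f B, bmeas f -> (forall x, `|f x| <= B) ->
  `|cint (evo_f mu) f| <= B * ((c + M ^+ 2 / 2 * fine (evo_gamma mu setT)) / (kappa * M)).
Proof.
move=> M0 bc f B bf fB; apply: variation_le => // E mE tE.
have := bc 2%N E (fun=> 0) (slope M) mE tE.
rewrite !big_ord_recl big_ord0 /affine_minorant !dot0l /slope /= sqrrN.
by lra.
Qed.

Lemma partial_t_fst p : partial_t (fst : R * 'rV[R]_d -> R) p = 1.
Proof.
apply: (proj2 (@derive_of_line _ _ (fst : R * 'rV[R]_d -> R) p (1, 0) 1 _)).
rewrite (_ : (fun h : R => _) = (fun h : R => h + p.1)); last first.
  by apply/funext => h; rewrite /= /GRing.scale/= mulr1.
have d1 : is_derive (0 : R) (1 : R) (id : R -> R) 1 by exact: is_derive_id.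
have d2 : is_derive (0 : R) (1 : R) (cst p.1 : R -> R) 0 by exact: is_derive_cst.
by have := is_deriveD d1 d2; rewrite addr0; exact.
Qed.

Lemma partial_t_snd (u : 'rV[R]_d -> R) p : partial_t (fun q => u q.2) p = 0.
Proof.
apply: (proj2 (@derive_of_line _ _ (fun q : R * 'rV[R]_d => u q.2) p (1, 0) 0 _)).
rewrite (_ : (fun h : R => _) = cst (u p.2)); first exact: is_derive_cst.
by apply/funext => h; rewrite /= scaler0 add0r.
Qed.

Lemma grad_coord_fst i p : grad_coord (fst : R * 'rV[R]_d -> R) i p = 0.
Proof. by rewrite /grad_coord mxE; exact: derive_cst. Qed.

Section small_action.
Variables (rho sigma : Poplus Omega) (mu : @evolution R d) (c1 c2 c : R).
Hypotheses (adm : admissible Omega mu) (b1 : bulk_action_le mu c1)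
  (b2 : bdry_action_le kappa mu c2) (c12 : c1 + c2 <= c) (c0 : 0 < c).
Hypothesis con : connects Omega mu (rho_end rho) (rho_end sigma).

Lemma bulk_mass : cint (evo_omega mu) (on_bulk Omega (fun=> 1)) = fine (evo_omega mu setT).
Proof.
have [co _ _ _ _] := adm.
have -> : on_bulk Omega (fun=> 1) = \1_(Qbulk Omega).
  by apply/funext => p; rewrite /on_bulk patchE indicE; case: (_ \in _).
rewrite cint_indic; last exact: measurable_Qbulk.
by rewrite -(concentrated_onI _ measurableT co) ?setTI//; exact: measurable_Qbulk.
Qed.

Lemma bdry_mass : cint (evo_gamma mu) (on_bdry Omega (fun=> 1)) = fine (evo_gamma mu setT).
Proof.
have [_ _ cg _ _] := adm.
have -> : on_bdry Omega (fun=> 1) = \1_(Qbdry Omega).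
  by apply/funext => p; rewrite /on_bdry patchE indicE; case: (_ \in _).
rewrite cint_indic; last exact: measurable_Qbdry.
by rewrite -(concentrated_onI _ measurableT cg) ?setTI//; exact: measurable_Qbdry.
Qed.

(** Use the test function [t] in both equations: in their sum the exchange term cancels and
    the mass of the final configuration remains. *)
Lemma mass_conservation : fine (evo_omega mu setT) + fine (evo_gamma mu setT) = 1.
Proof.
have [] := con (@C1_fst R d).
rewrite /bulk_lhs /bdry_lhs.
rewrite (_ : on_bulk Omega (partial_t fst) = on_bulk Omega (fun=> 1)); last first.
  by apply/funext => p; rewrite /on_bulk !patchE partial_t_fst.
rewrite (_ : on_bdry Omega (partial_t fst) = on_bdry Omega (fun=> 1)); last first.
  by apply/funext => p; rewrite /on_bdry !patchE partial_t_fst.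
rewrite bulk_mass bdry_mass big1 ?addr0; last first.
  move=> i _; rewrite (_ : on_bulk _ _ = fun=> 0 * 0).
    by rewrite cintZ ?mul0r//; exact: bmeas_cst.
  apply/funext => p; rewrite /on_bulk patchE grad_coord_fst mulr0.
  by case: ifP.
rewrite big1 ?addr0; last first.
  move=> i _; rewrite (_ : on_bdry _ _ = fun=> 0 * 0).
    by rewrite cintZ ?mul0r//; exact: bmeas_cst.
  have g0 j p : on_bdry Omega (grad_coord fst j) p = 0.
    by rewrite /on_bdry patchE grad_coord_fst; case: ifP.
  apply/funext => p; rewrite (on_bdry_tgradE hOmega)//; last exact: C1_fst.
  by rewrite g0 big1 ?mul0r ?subr0// => j _; rewrite g0 mul0r.
have mcl : measurable (closure Omega : set (space R d)).
  by apply: space_closed_measurable; exact: closed_closure.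
have mbd : measurable (bdry Omega : set (space R d)).
  by apply: space_closed_measurable; exact: closed_bdry.
rewrite /rho_end/= !Rintegral_cst//.
rewrite !mul0r !mul1r !subr0 => h1 h2.
have : fine (bulk_part sigma (closure Omega)) + fine (bdry_part sigma (bdry Omega)) = 1.
  exact: mass_split.
lra.
Qed.

Let c1c : c1 <= c.
Proof. by have := bdry_action_bound_ge0 b2; move: c12; lra. Qed.

Let c2c : c2 <= c.
Proof. by have := action_bound_ge0 b1; move: c12; lra. Qed.

Let mass_le1 : fine (evo_omega mu setT) <= 1 /\ fine (evo_gamma mu setT) <= 1.
Proof.
have := mass_ge0 measurableT b1; have := bdry_mass_ge0 measurableT b2.
by have := mass_conservation; lra.
Qed.

Let s0 : 0 < Num.sqrt c. Proof. by rewrite sqrtr_gt0. Qed.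

Let tv_le x w : x <= c -> w <= 1 -> (x + Num.sqrt c ^+ 2 / 2 * w) / Num.sqrt c <= 2 * Num.sqrt c.
Proof.
move=> xc w1; rewrite ler_pdivrMr// (_ : 2 * _ * _ = 2 * Num.sqrt c ^+ 2); last by ring.
rewrite sqr_sqrtr ?ltW//.
have : c / 2 * w <= c / 2 * 1 by rewrite ler_wpM2l// divr_ge0// ltW.
by move: (c / 2 * w) => z; move: c0 xc; lra.
Qed.

Let exchange_tv g B : bmeas g -> (forall p, `|g p| <= B) ->
  `|cint (evo_f mu) g| <= B * (2 * Num.sqrt c / kappa).
Proof.
move=> bg gB; have B0 : 0 <= B by exact: le_trans (normr_ge0 _) (gB point).
apply: le_trans (exchange_le s0 b2 bg gB) _; rewrite ler_wpM2l//.
rewrite invfM mulrCA mulrC ler_pM2r ?invr_gt0//; apply: tv_le => //.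
by case: mass_le1.
Qed.

(** For a test function that does not depend on time the continuity equation expresses the
    change of its integral by the fluxes alone, which are of order [Num.sqrt c]. *)
Lemma bulk_change u (B : R) : C1 u ->
  (forall i p, `|on_bulk Omega (grad_coord (fun q => u q.2) i) p| <= B) ->
  (forall p, `|on_bdry Omega (fun q => u q.2) p| <= B) ->
  `|(rho_end sigma).1 u - (rho_end rho).1 u| <= (d%:R * B * 2 + B * (2 / kappa)) * Num.sqrt c.
Proof.
move=> c1u gB uB; have c1s := C1_snd c1u.
have B0 : 0 <= B by exact: le_trans (normr_ge0 _) (uB point).
have [<- _] := con c1s; rewrite /bulk_lhs.
rewrite (_ : on_bulk Omega (partial_t _) = fun=> 0 * 0); last first.
  apply/funext => p; rewrite /on_bulk patchE partial_t_snd mulr0.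
  by case: ifP.
rewrite cintZ ?mul0r ?add0r; last exact: bmeas_cst.
apply: le_trans (ler_normB _ _) _; rewrite mulrDl; apply: lerD; last first.
  rewrite -mulrA -[2 / kappa * _]mulrAC; apply: exchange_tv => //.
  by apply: bmeas_on_bdry => //; exact: C1_continuous.
apply: le_trans (ler_norm_sum _ _ _) _.
have -> : d%:R * B * 2 * Num.sqrt c = \sum_(i < d) B * (2 * Num.sqrt c).
  by rewrite sumr_const card_ord -mulr_natl; ring.
apply: ler_sum => i _.
apply: le_trans (flux_le i s0 b1 (bmeas_on_bulk_grad hOmega i c1s) (gB i)) _.
rewrite ler_wpM2l//; apply: tv_le => //.
by case: mass_le1.
Qed.

Lemma bdry_change u (B : R) : C1 u ->
  (forall i p, `|on_bdry Omega (tgrad_coord Omega (fun q => u q.2) i) p| <= B) ->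
  (forall p, `|on_bdry Omega (fun q => u q.2) p| <= B) ->
  `|(rho_end sigma).2 u - (rho_end rho).2 u| <= (d%:R * B * 2 + B * (2 / kappa)) * Num.sqrt c.
Proof.
move=> c1u gB uB; have c1s := C1_snd c1u.
have B0 : 0 <= B by exact: le_trans (normr_ge0 _) (uB point).
have [_ <-] := con c1s; rewrite /bdry_lhs.
rewrite (_ : on_bdry Omega (partial_t _) = fun=> 0 * 0); last first.
  apply/funext => p; rewrite /on_bdry patchE partial_t_snd mulr0.
  by case: ifP.
rewrite cintZ ?mul0r ?add0r; last exact: bmeas_cst.
apply: le_trans (ler_normD _ _) _; rewrite mulrDl; apply: lerD; last first.
  rewrite -mulrA -[2 / kappa * _]mulrAC; apply: exchange_tv => //.
  by apply: bmeas_on_bdry => //; exact: C1_continuous.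
apply: le_trans (ler_norm_sum _ _ _) _.
have -> : d%:R * B * 2 * Num.sqrt c = \sum_(i < d) B * (2 * Num.sqrt c).
  by rewrite sumr_const card_ord -mulr_natl; ring.
apply: ler_sum => i _.
apply: le_trans (bdry_flux_le i s0 b2 (bmeas_on_bdry_tgrad hOmega i c1s) (gB i)) _.
rewrite ler_wpM2l//; apply: tv_le => //.
by case: mass_le1.
Qed.

End small_action.

Lemma common_bound (I : finType) (T : Type) (F : I -> T -> R) :
  (forall i, exists M : R, forall x, `|F i x| <= M) -> exists M : R, forall i x, `|F i x| <= M.
Proof.
move=> /choice[M FM]; exists (\sum_i `|M i|) => i x.
apply: le_trans (FM i x) _; apply: le_trans (ler_norm _) _.
by rewrite (bigD1 i)//= lerDl; apply: sumr_ge0.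
Qed.

Lemma small_cost_eq0 (x K : R) :
  (forall c, 0 < c -> `|x| <= K * Num.sqrt c) -> x = 0.
Proof.
move=> H; apply/eqP; rewrite -normr_le0; apply/ler_addgt0Pr => e e0; rewrite add0r.
have K0 : 0 < `|K| + 1 by rewrite ltr_wpDl.
have e1 : 0 < e / (`|K| + 1) by rewrite divr_gt0.
have := H ((e / (`|K| + 1)) ^+ 2); rewrite exprn_gt0// sqrtr_sqr (gtr0_norm e1) => /(_ isT).
move=> /le_trans; apply; rewrite mulrA ler_pdivrMr// mulrC ler_wpM2l// ?ltW//.
by have := ler_norm K; lra.
Qed.

(** The constants in [bulk_change] and [bdry_change] depend on the test function only. *)
Lemma rigidity (rho sigma : Poplus Omega) :
  (forall c, 0 < c -> linked Omega kappa c (rho_end rho) (rho_end sigma)) ->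
  eq_Poplus rho sigma.
Proof.
move=> lk.
have key u : C1 u -> (rho_end rho).1 u = (rho_end sigma).1 u /\
    (rho_end rho).2 u = (rho_end sigma).2 u.
  move=> c1u; have c1s := C1_snd c1u.
  have [B1 gB1] := common_bound (fun i => proj2 (bmeas_on_bulk_grad hOmega i c1s)).
  have [B2 gB2] := common_bound (fun i => proj2 (bmeas_on_bdry_tgrad hOmega i c1s)).
  have [B3 uB3] := proj2 (bmeas_on_bdry hOmega (C1_continuous c1s)).
  pose B := `|B1| + `|B2| + `|B3|.
  have BB1 : B1 <= B by rewrite (le_trans (ler_norm _))// /B -addrA lerDl addr_ge0.
  have BB2 : B2 <= B by rewrite (le_trans (ler_norm _))// /B addrAC lerDr addr_ge0.
  have BB3 : B3 <= B by rewrite (le_trans (ler_norm _))// /B lerDr addr_ge0.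
  split; apply/esym/eqP; rewrite -subr_eq0; apply/eqP;
    apply: (@small_cost_eq0 _ (d%:R * B * 2 + B * (2 / kappa))) => c c0;
    have [mu [c1 [c2 [adm b1 b2 cc con]]]] := lk c c0.
  - apply: (bulk_change adm b1 b2 cc c0 con c1u).
      by move=> i p; exact: le_trans (gB1 i p) BB1.
    by move=> p; exact: le_trans (uB3 p) BB3.
  - apply: (bdry_change adm b1 b2 cc c0 con c1u).
      by move=> i p; exact: le_trans (gB2 i p) BB2.
    by move=> p; exact: le_trans (uB3 p) BB3.
move=> A mA; split.
- apply: (eq_measure_C1 (K := closure Omega)) => //.
  + exact: closed_closure.
  + exact: bulk_part_concentrated.
  + exact: bulk_part_concentrated.
  + by move=> u /key[].
- apply: (eq_measure_C1 (K := bdry Omega)) => //.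
  + exact: closed_bdry.
  + exact: bdry_part_concentrated.
  + exact: bdry_part_concentrated.
  + by move=> u /key[].
Qed.

End rigidity.

(** * The distance *)

Section distance.
Context {R : realType} {d : nat}.
Variables (hd : (0 < d)%N) (Omega : set 'rV[R]_d).
Hypothesis hOmega : smooth_bounded_domain Omega.
Variables (kappa : R) (hkappa : 0 < kappa).
Implicit Types (rho sigma : Poplus Omega).
Local Notation linked c rho sigma := (linked Omega kappa c (rho_end rho) (rho_end sigma)).

Lemma CE_connects rho sigma mu :
  CE rho sigma mu <-> admissible Omega mu /\ connects Omega mu (rho_end rho) (rho_end sigma).
Proof.
split=> [[adm be de]|[adm con]].
  by split => // phi c1; rewrite bulk_lhsE bdry_lhsE be// de.
split => // phi c1; have [] := con phi c1; first by rewrite bulk_lhsE.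
by rewrite bdry_lhsE.
Qed.

Lemma linked_W2_le c rho sigma : linked c rho sigma -> (W2 kappa rho sigma <= c%:E)%E.
Proof.
move=> [mu [c1 [c2 [adm b1 b2 cc con]]]].
apply: (@le_trans _ _ (action Omega kappa mu)).
  by apply: ereal_inf_lbound; exists mu => //; exact/CE_connects.
by apply/(action_leP hd hkappa _ adm); exists c1, c2.
Qed.

Lemma W2_lt_linked c rho sigma : (W2 kappa rho sigma < c%:E)%E -> linked c rho sigma.
Proof.
move=> /ereal_inf_lt[_ [mu /CE_connects[adm con] <-]] /ltW.
by move=> /(action_leP hd hkappa _ adm)[c1 [c2 [b1 b2 cc]]]; exists mu, c1, c2.
Qed.

Lemma W2_ge0 rho sigma : (0 <= W2 kappa rho sigma)%E.
Proof. by apply: le_ereal_inf_tmp => _ [mu _ <-]; exact: action_ge0. Qed.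

(** Finiteness turns the square root in [W_dist] into one of real numbers. *)
Lemma W2_fin_num rho sigma : W2 kappa rho sigma \is a fin_num.
Proof.
have [c l] := linked_any hOmega kappa rho sigma.
by rewrite ge0_fin_numE ?W2_ge0// (le_lt_trans (linked_W2_le l))// ltry.
Qed.

Lemma W2_sym_le rho sigma : (W2 kappa rho sigma <= W2 kappa sigma rho)%E.
Proof.
rewrite -(fineK (W2_fin_num sigma rho)); apply/lee_addgt0Pr => e e0; rewrite -EFinD.
apply: linked_W2_le; apply: (linked_sym hOmega); apply: W2_lt_linked.
by rewrite EFinD fineK ?W2_fin_num// lteDl ?lte_fin ?W2_fin_num.
Qed.

Lemma W2_eq0 rho sigma : W2 kappa rho sigma = 0%E <-> eq_Poplus rho sigma.
Proof.
split=> [W0|E].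
  by apply: (rigidity hd hOmega hkappa) => c c0; apply: W2_lt_linked; rewrite W0 lte_fin.
apply/eqP; rewrite eq_le W2_ge0 andbT; apply: linked_W2_le.
have := linked_static hOmega kappa rho; apply: linked_ext => // u _.
split; rewrite /rho_end/= /Rintegral; congr fine; apply: eq_measure_integral => A mA _;
  by case: (E A mA).
Qed.

Lemma W_distE rho sigma : W_dist kappa rho sigma = (Num.sqrt (fine (W2 kappa rho sigma)))%:E.
Proof. by rewrite /W_dist -(fineK (W2_fin_num rho sigma)). Qed.

(** Costs [p ^+ 2] and [q ^+ 2] are best combined by spending the fraction [p / (p + q)] of
    the time on the first path: the total is then [(p + q) ^+ 2]. *)
Lemma W_triangle rho sigma tau :
  (W_dist kappa rho tau <= W_dist kappa rho sigma + W_dist kappa sigma tau)%E.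
Proof.
rewrite !W_distE -EFinD lee_fin.
set x := Num.sqrt (fine (W2 kappa rho sigma)); set y := Num.sqrt (fine (W2 kappa sigma tau)).
apply/ler_addgt0Pr => e e0.
pose p := x + e / 2; pose q := y + e / 2.
have e2 : 0 < e / 2 by rewrite divr_gt0.
have x0 : 0 <= x by exact: sqrtr_ge0.
have y0 : 0 <= y by exact: sqrtr_ge0.
have p0 : 0 < p by rewrite /p; lra.
have q0 : 0 < q by rewrite /q; lra.
have lt_sqr rho1 rho2 z : Num.sqrt (fine (W2 kappa rho1 rho2)) < z -> linked (z ^+ 2) rho1 rho2.
  move=> xz; apply: W2_lt_linked; rewrite -(fineK (W2_fin_num rho1 rho2)) lte_fin.
  rewrite -[ltLHS]sqr_sqrtr; last by rewrite fine_ge0// W2_ge0.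
  by rewrite ltr_pXn2r// nnegrE; [exact: sqrtr_ge0|exact: le_trans (sqrtr_ge0 _) (ltW xz)].
have l1 : linked (p ^+ 2) rho sigma by apply: lt_sqr; rewrite ltrDl.
have l2 : linked (q ^+ 2) sigma tau by apply: lt_sqr; rewrite ltrDl.
have pq0 : 0 < p + q by exact: addr_gt0.
have t01 : 0 < p / (p + q) < 1.
  apply/andP; split; first exact: divr_gt0.
  by rewrite ltr_pdivrMr// mul1r ltrDl.
have := linked_trans hOmega t01 l1 l2.
have -> : p ^+ 2 / (p / (p + q)) + q ^+ 2 / (1 - p / (p + q)) = (p + q) ^+ 2.
  have -> : 1 - p / (p + q) = q / (p + q) by field; rewrite gt_eqF.
  by field; rewrite !gt_eqF.
move=> /linked_W2_le; rewrite -(fineK (W2_fin_num rho tau)) lee_fin => H.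
apply: (@le_trans _ _ (p + q)); last by rewrite /p /q; lra.
by rewrite -[leRHS]gtr0_norm// -sqrtr_sqr ler_wsqrtr.
Qed.

End distance.

Theorem proposition3p10 (R : realType) (d : nat) (hd : (0 < d)%N)
    (Omega : set 'rV[R]_d) (hOmega : smooth_bounded_domain Omega)
    (kappa : R) (hkappa : 0 < kappa) :
  is_distance (@eq_Poplus R d Omega) (W_dist kappa).
Proof.
split.
- by move=> rho sigma; rewrite W_distE// lee_fin sqrtr_ge0 ltry.
- move=> rho sigma; rewrite -(W2_eq0 hd hOmega hkappa) W_distE//.
  have W0 : 0 <= fine (W2 kappa rho sigma) by rewrite fine_ge0// W2_ge0.
  split=> [[/eqP]|->]; last by rewrite sqrtr0.
  rewrite sqrtr_eq0 => W0'; rewrite -(fineK (W2_fin_num hd hOmega hkappa rho sigma)).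
  by congr (_%:E); apply/eqP; rewrite eq_le W0'.
- move=> rho sigma; congr sqrte; apply/eqP.
  by rewrite eq_le !W2_sym_le.
- by move=> rho sigma tau; exact: W_triangle.
Qed.
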